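(* Let $d\ge 1$, let $(L,r)$ and $\mathcal C=(C_L,C_{L-r},\dots,C_{-L})\in\mathbb C^{d+1}$ with $C_LC_{-L}\neq 0$ be as in the context, and let $E=E_{\mathcal C}$. Suppose that $D_d(\mathcal C)\neq 0$. Then: (1) the matrices $H_n=H_n(\mathcal C)$ (defined in the context from the solutions of the linear equations with matrices $L_n^\pm(\mathcal C)$) are well-defined for all $1\le n\le d$; (2) the pair of functions $(A(t,z),B(t,z))$ defined in the context satisfies the quasi-canonical system $$-\frac{d}{dt}\begin{bmatrix}A(t,z)\\ B(t,z)\end{bmatrix}=z\begin{bmatrix}0&-1\\ 1&0\end{bmatrix}H(t)\begin{bmatrix}A(t,z)\\ B(t,z)\end{bmatrix}\quad(z\in\mathbb C)$$ on $[0,L)$ associated with $H(t)=H_{\mathcal C}(t):=H_n$ for $r(n-1)/2\le t<rn/2$, $1\le n\le d$, together with the boundary conditions $$\begin{bmatrix}A(0,z)\\ B(0,z)\end{bmatrix}=\begin{bmatrix}A_{\mathcal C}(z)\\ B_{\mathcal C}(z)\end{bmatrix},\qquad \lim_{t\to L}\begin{bmatrix}A(t,z)\\ B(t,z)\end{bmatrix}=\begin{bmatrix}A_{\mathcal C}(0)\\ B_{\mathcal C}(0)\end{bmatrix};$$ (3) for $r(n-1)/2\le t<rn/2$ and $1\le n\le d$, $$A(t,z)=\frac12\sum_{j=0}^{d-n}\Bigl[a_n(L-rj)e^{i(L-rj-t)z}+\overline{a_n(L-rj)}e^{-i(L-rj-t)z}\Bigr],$$ $$B(t,z)=\frac12\sum_{j=0}^{d-n}\Bigl[b_n(L-rj)e^{i(L-rj-t)z}+\overline{b_n(L-rj)}e^{-i(L-rj-t)z}\Bigr],$$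 where $a_n(k)$ and $b_n(k)$ are explicit complex numbers depending only on $\{H_n\}_{1\le n\le d}$; (4) there exist positive definite real symmetric $2\times2$ matrices $\widetilde H_n$ such that $$H_n=\frac{1}{D_{n-1}(\mathcal C)D_n(\mathcal C)}\,\widetilde H_n\qquad(1\le n\le d).$$ In particular, the positivity of $H_{\mathcal C}(t)$ is equivalent to that of $D_n(\mathcal C)$ for all $1\le n\le d$.
   Context: Basic data. For an entire function $F$ put $F^\sharp(z)=\overline{F(\bar z)}$. For a positive integer $d$ put $(L,r)=(d/2,1)$ if $d$ is even and $(L,r)=(d,2)$ if $d$ is odd, so $2L=rd$. For $\mathcal C=(C_L,C_{L-r},C_{L-2r},\dots,C_{-L})\in\mathbb C^{d+1}$ with $C_LC_{-L}\ne0$ put $E_{\mathcal C}(z)=\sum_{j=0}^dC_{L-rj}e^{i(L-rj)z}$, $A_{\mathcal C}=\frac12(E_{\mathcal C}+E_{\mathcal C}^\sharp)$, $B_{\mathcal C}=\frac i2(E_{\mathcal C}-E_{\mathcal C}^\sharp)$. For $1\le n\le d$ let $M_n,N_n$ be the upper triangular $n\times n$ matrices with $(j,k)$ entries ($k\ge j$) $C_{-L+r(k-j)}$ and $C_{L-r(k-j)}$ respectively, and $$L_n^\pm(\mathcal C)=\begin{bmatrix}{}^{\rm t}M_n&\pm{}^{\rm t}\overline{N_n}\\ \pm N_n&\overline{M_n}\end{bmatrix},\quad D_n(\mathcal C)=\det L_n^+(\mathcal C)=\det L_n^-(\mathcal C)\in\mathbb R,\quad D_0(\mathcal C)=1.$$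 Definition of $H_n$. For $1\le n\le d$ let $z_n^\pm(1),\dots,z_n^\pm(n)$ be the solutions of $$L_n^\pm(\mathcal C)\,{}^{\rm t}\bigl[z_n^\pm(1)\ \cdots\ z_n^\pm(n)\ \ \overline{z_n^\pm(n)}\ \cdots\ \overline{z_n^\pm(1)}\bigr]=\mp\,{}^{\rm t}\bigl[0\cdots0\ \ 2\overline{C_L}\ \ 2C_L\ \ 0\cdots0\bigr],$$ the entries $2\overline{C_L},2C_L$ being the $n$th and $(n+1)$th. Let $Z_k=\begin{bmatrix}\Re z_k^+(1)&\Im z_k^+(1)\\ -\Im z_k^-(1)&\Re z_k^-(1)\end{bmatrix}$. The real symmetric $2\times2$ matrix $H_n=H_n(\mathcal C)$ is defined by $$Z_n\cdots Z_1\begin{bmatrix}0&-1\\ 1&0\end{bmatrix}H_n=\begin{bmatrix}0&1\\ -1&0\end{bmatrix}Z_n\cdots Z_1.$$ Quasi-canonical system. For a real symmetric $2\times 2$ matrix-valued function $H$ on $[t_0,t_1)$, the displayed first-order system parametrized by $z\in\mathbb C$ is called a quasi-canonical system; a solution consists of functions absolutely continuous in $t$ satisfying it for almost every $t$, for every fixed $z$. Definition of $(A(t,z),B(t,z))$. Put $X(k)=e^{i(r(k+1)-1-t)z}$, $Y(l)=e^{-i(r(l+1)-1-t)z}$ ($k,l\in\mathbb Z$). For $t\in\mathbb R\setminus(r/2)\mathbb Z$ let $V_t$ be the Hilbert space of functions of $z\in\mathbb R$ of the form $\phi=\sum_{k\in\mathbb Z}u(k)X(k)+\sum_{l\in\mathbb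 Z}v(l)Y(l-r+1)$ with $u,v\in l^2(\mathbb Z)$, $\|\phi\|^2=\sum|u(k)|^2+\sum|v(l)|^2$. For $n\ge0$ let $V_{t,n}$ be the closed subspace of $\phi$ with $u(k)=0$ for $k<0$ and $v(l)=0$ for $l\ge n$. Let $\mathsf P_0=0$, $\mathsf P_n\phi=\sum_{k=0}^{n-1}u(k)X(k)+\sum_{l=0}^{n-1}v(l)Y(l-r+1)$ for $n\geq 1$, and $(\mathsf J\phi)(z)=\overline{\phi(\bar z)}$. With $E_0(z)=e^{-i(r-1)z}E_{\mathcal C}(z)$, let $\mathsf E$ and $\mathsf E^\sharp$ be multiplication by $E_0$ and $E_0^\sharp$, and $\Theta=\mathsf E^{-1}\mathsf E^\sharp$ (if $D_d(\mathcal C)\ne0$ then $E_{\mathcal C}$ has no real zeros and $\mathsf{E}$ is invertible on $V_t$). For $0\le n\le d$ let $\phi_n^\pm\in V_{t,n}+\Theta\mathsf J\mathsf P_nV_{t,n}$ be the unique solutions of $(\mathsf I\pm\Theta\mathsf J\mathsf P_n)\phi_n^\pm=X(0)\mp\Theta Y(0)$ (for $n=0$: $\phi_0^\pm=X(0)\mp\Theta Y(0)$). Put $$A_n^*(t,z)=\tfrac12\bigl((\mathsf I+\mathsf J)\mathsf E(\phi_n^++X(0))\bigr)(t,z),\quad B_n^*(t,z)=\tfrac i2\bigl((\mathsf I-\mathsf J)\mathsf E(\phi_n^-+X(0))\bigr)(t,z);$$ these are finite linear combinations of the functions $X(k),Y(k)$ with coefficients independent of $t$ and $z$, and are extended by this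 expression to all $t\in\mathbb R$. For $1\le n\le d$ let $P_n^*$ be the invertible real $2\times2$ matrix, independent of $z$, with $$\begin{bmatrix}A_n^*(r(n-1)/2,z)\\ B_n^*(r(n-1)/2,z)\end{bmatrix}=P_n^*\begin{bmatrix}A_{n-1}^*(r(n-1)/2,z)\\ B_{n-1}^*(r(n-1)/2,z)\end{bmatrix},$$ $P_n=(P_1^* )^{-1}\cdots(P_n^* )^{-1}$, and define ${}^{\rm t}[A(t,z)\ B(t,z)]=P_n\,{}^{\rm t}[A_n^*(t,z)\ B_n^*(t,z)]$ for $r(n-1)/2\le t<rn/2$.
   Formalization: Added: D_n(C)≠0 for all 1≤n<d. V_t, Θ and φ_n^± live on a line Im z=h with E zero-free on Im z≥h (h=0 allowed if E has no zeros in Im z≥0), not always on real z. The a_n, b_n depend on {H_n} and also on (A_C(0),B_C(0)). *)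

(* Defs.v *)
From HB Require Import structures.
From mathcomp Require Import all_boot all_order all_algebra.
From mathcomp Require Import all_classical all_reals all_analysis.
From mathcomp Require Import complex.

Set Implicit Arguments.
Unset Strict Implicit.
Unset Printing Implicit Defensive.

Import Order.TTheory GRing.Theory Num.Theory.
Import numFieldNormedType.Exports.

Local Open Scope classical_set_scope.
Local Open Scope ring_scope.
Local Open Scope complex_scope.

Definition cexp (R : realType) (w : R[i]) : R[i] :=
  (expR (complex.Re w))%:C * (cos (complex.Im w) +i* sin (complex.Im w)).

Definition expi (R : realType) (a : R) (z : R[i]) : R[i] :=
  cexp ('i * a%:C * z).

(* F^#; on functions of a complex variable this is also the operator J *)
Definition sharp (R : realType) (F : R[i] -> R[i]) (z : R[i]) : R[i] :=
  (F z^*)^*.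

Definition normc2 (R : realType) (z : R[i]) : R :=
  complex.Re z ^+ 2 + complex.Im z ^+ 2.

Definition mx2 (T : pzRingType) (a b c d : T) : 'M[T]_2 :=
  \matrix_(i < 2, j < 2) nth 0 (nth [::] [:: [:: a; b]; [:: c; d]] i) j.

Definition col2 (T : pzRingType) (a b : T) : 'cV[T]_2 :=
  \col_(i < 2) nth 0 [:: a; b] i.

Definition Jmx (T : pzRingType) : 'M[T]_2 := mx2 0 (- 1) 1 0.

Definition cmx (R : realType) (m n : nat) (M : 'M[R]_(m, n)) : 'M[R[i]]_(m, n) :=
  map_mx (real_complex R) M.

Definition posdef (R : realType) (M : 'M[R]_2) : Prop :=
  M^T = M /\ forall x : 'cV[R]_2, x != 0 -> 0 < (x^T *m M *m x) 0 0.

Definition possemidef (R : realType) (M : 'M[R]_2) : Prop :=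
  M^T = M /\ forall x : 'cV[R]_2, 0 <= (x^T *m M *m x) 0 0.

Definition rpar (d : nat) : nat := if odd d then 2 else 1.

Definition Lpar (R : realType) (d : nat) : R :=
  if odd d then d%:R else d%:R / 2.

(* The family C = (C_L, C_{L-r}, ..., C_{-L}) is c : 'I_d.+1 -> R[i] with
   C_{L-rj} = c j; in particular C_L = c ord0, C_{-L} = c ord_max and
   C_{-L+rm} = c (d - m). *)
Definition freq (R : realType) (d j : nat) : R := Lpar R d - (rpar d * j)%:R.

Definition Eexp (R : realType) (d : nat) (c : 'I_d.+1 -> R[i]) (z : R[i]) : R[i] :=
  \sum_(j < d.+1) c j * expi (freq R d j) z.

Definition Aexp (R : realType) (d : nat) (c : 'I_d.+1 -> R[i]) (z : R[i]) : R[i] :=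
  2^-1 * (Eexp c z + sharp (Eexp c) z).

Definition Bexp (R : realType) (d : nat) (c : 'I_d.+1 -> R[i]) (z : R[i]) : R[i] :=
  'i / 2 * (Eexp c z - sharp (Eexp c) z).

Definition Mmx (R : realType) (d : nat) (c : 'I_d.+1 -> R[i]) (n : nat) :
    'M[R[i]]_n :=
  \matrix_(j, k) if (j <= k)%N then c (inord (d - (k - j))) else 0.

Definition Nmx (R : realType) (d : nat) (c : 'I_d.+1 -> R[i]) (n : nat) :
    'M[R[i]]_n :=
  \matrix_(j, k) if (j <= k)%N then c (inord (k - j)) else 0.

(* s = 1 for L_n^+, s = -1 for L_n^- *)
Definition Lmx (R : realType) (d : nat) (c : 'I_d.+1 -> R[i]) (n : nat)
    (s : R[i]) : 'M[R[i]]_(n + n) :=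
  block_mx (Mmx c n)^T (s *: (map_mx (fun x => x^*) (Nmx c n))^T)
           (s *: Nmx c n) (map_mx (fun x => x^*) (Mmx c n)).

(* D_0 = 1 as the determinant of an empty matrix.  In R[i], 0 < x means that
   x is real and positive. *)
Definition Ddet (R : realType) (d : nat) (c : 'I_d.+1 -> R[i]) (n : nat) : R[i] :=
  \det (Lmx c n 1).

Definition rhs (R : realType) (d : nat) (c : 'I_d.+1 -> R[i]) (n : nat) :
    'cV[R[i]]_(n + n) :=
  col_mx (\col_(i < n) if i.+1 == n then 2 * (c ord0)^* else 0)
         (\col_(i < n) if i == 0%N :> nat then 2 * c ord0 else 0).

Definition is_z (R : realType) (d : nat) (c : 'I_d.+1 -> R[i]) (n : nat)
    (s : R[i]) (z : 'cV[R[i]]_n) : Prop :=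
  Lmx c n s *m col_mx z (\col_(i < n) (z (rev_ord i) 0)^*) = - s *: rhs c n.

Fixpoint Zprod (R : realType) (zp zm : forall k, 'cV[R[i]]_k) (n : nat) :
    'M[R]_2 :=
  match n with
  | 0 => 1%:M
  | m.+1 =>
      mx2 (complex.Re (zp m.+1 ord0 ord0)) (complex.Im (zp m.+1 ord0 ord0))
          (- complex.Im (zm m.+1 ord0 ord0)) (complex.Re (zm m.+1 ord0 ord0))
      *m Zprod zp zm m
  end.

Definition is_H (R : realType) (d : nat) (c : 'I_d.+1 -> R[i]) (n : nat)
    (Hn : 'M[R]_2) : Prop :=
  Hn^T = Hn /\
  exists zp zm : forall k, 'cV[R[i]]_k,
    (forall k, (1 <= k <= n)%N -> is_z c 1 (zp k) /\ is_z c (- 1) (zm k)) /\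
    Zprod zp zm n *m Jmx R *m Hn = - Jmx R *m Zprod zp zm n.

Definition in_step (R : realType) (d n : nat) (t : R) : Prop :=
  (rpar d)%:R * n.-1%:R / 2 <= t < (rpar d)%:R * n%:R / 2.

Definition is_Hstep (R : realType) (d : nat) (H : nat -> 'M[R]_2)
    (Hc : R -> 'M[R]_2) : Prop :=
  forall (n : nat) (t : R), (1 <= n <= d)%N -> in_step d n t -> Hc t = H n.

Definition abs_continuous_on (R : realType) (I : set R) (f : R -> R) : Prop :=
  forall e : R, 0 < e -> exists2 del : R, 0 < del &
    forall (m : nat) (a b : 'I_m -> R),
      (forall i, a i <= b i /\ `[a i, b i] `<=` I) ->
      trivIset [set: 'I_m] (fun i => `]a i, b i[%classic) ->
      \sum_(i < m) (b i - a i) < del ->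
      \sum_(i < m) `|f (b i) - f (a i)| < e.

Definition cabs_continuous_on (R : realType) (I : set R) (f : R -> R[i]) : Prop :=
  abs_continuous_on I (fun t => complex.Re (f t)) /\
  abs_continuous_on I (fun t => complex.Im (f t)).

Definition is_cderive (R : realType) (f : R -> R[i]) (t : R) (df : R[i]) : Prop :=
  is_derive t 1 (fun t => complex.Re (f t)) (complex.Re df) /\
  is_derive t 1 (fun t => complex.Im (f t)) (complex.Im df).

Definition ctends_left (R : realType) (f : R -> R[i]) (t0 : R) (l : R[i]) : Prop :=
  (complex.Re (f t) @[t --> t0^'-] --> complex.Re l) /\
  (complex.Im (f t) @[t --> t0^'-] --> complex.Im l).

Definition quasi_canonical_solution (R : realType) (t0 t1 : R) (H : R -> 'M[R]_2)
    (A B : R -> R[i] -> R[i]) : Prop :=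
  (forall t, t0 <= t < t1 -> (H t)^T = H t) /\
  forall z : R[i],
    [/\ cabs_continuous_on `[t0, t1[ (A ^~ z),
        cabs_continuous_on `[t0, t1[ (B ^~ z) &
        {ae (@lebesgue_measure R), forall t, t0 <= t < t1 ->
          exists dA dB : R[i],
            [/\ is_cderive (A ^~ z) t dA,
                is_cderive (B ^~ z) t dB &
                - col2 dA dB =
                  z *: (Jmx R[i] *m cmx (H t) *m col2 (A t z) (B t z))]}].

Definition Xfun (R : realType) (d : nat) (k : int) (t : R) : R[i] -> R[i] :=
  expi ((rpar d)%:R * (k + 1)%:~R - 1 - t).

Definition Yfun (R : realType) (d : nat) (l : int) (t : R) : R[i] -> R[i] :=
  expi (- ((rpar d)%:R * (l + 1)%:~R - 1 - t)).

(* the functions Y(l-r+1) occurring in the elements of V_t *)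
Definition Yshift (R : realType) (d : nat) (l : int) : R -> R[i] -> R[i] :=
  Yfun d (l - (rpar d)%:Z + 1).

Definition E0 (R : realType) (d : nat) (c : 'I_d.+1 -> R[i]) (z : R[i]) : R[i] :=
  expi (- ((rpar d)%:R - 1)) z * Eexp c z.

Definition Theta (R : realType) (d : nat) (c : 'I_d.+1 -> R[i]) (z : R[i]) : R[i] :=
  (E0 c z)^-1 * sharp (E0 c) z.

Definition symsum (V : nmodType) (N : nat) (F : int -> V) : V :=
  \sum_(i < N.*2.+1) F (i%:Z - N%:Z).

Definition generic_time (R : realType) (d : nat) (t : R) : Prop :=
  forall k : int, t != (rpar d)%:R / 2 * k%:~R.

(* [Vexpansion d h t u v phi]: x |-> phi x is the function
     sum_k u(k) X(k) + sum_l v(l) Y(l-r+1)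
   on the line z = x + ih, the series converging in L^2 on bounded intervals,
   and the coefficients being square summable with respect to the norms of
   X(k), Y(l-r+1), which have constant modulus on the line.  For h = 0 the
   moduli are 1 and the functions phi are exactly the elements of V_t (functions
   up to equality almost everywhere).  When E has zeros in the upper half-plane
   the expansion of Theta on the real line is not one-sided and the functions
   built below on that line do not solve the system; a line above all zeros of
   E has to be used. *)
Definition Vexpansion (R : realType) (d : nat) (h t : R) (u v : int -> R[i])
    (phi : R -> R[i]) : Prop :=
  [/\ measurable_fun [set: R] (fun x => complex.Re (phi x)),
      measurable_fun [set: R] (fun x => complex.Im (phi x)),
      (\esum_(k in [set: int]) (normc2 (u k * Xfun d k t (0 +i* h)))%R%:E < +oo)%E,
      (\esum_(l in [set: int]) (normc2 (v l * Yshift d l t (0 +i* h)))%R%:E < +oo)%E &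
      forall M : R, 0 < M ->
        (\int[@lebesgue_measure R]_(x in `[(- M)%R, M])
           ((normc2 (phi x -
              symsum N (fun k => u k * Xfun d k t (x +i* h)
                               + v k * Yshift d k t (x +i* h))))%R)%:E)%E
          @[N --> \oo] --> 0%E].

Definition Vn_coef (R : realType) (n : nat) (u v : int -> R[i]) : Prop :=
  (forall k : int, (k < 0)%R -> u k = 0) /\
  (forall l : int, (n%:Z <= l)%R -> v l = 0).

(* P_n phi, a finite sum and hence an entire function *)
Definition Pproj (R : realType) (d n : nat) (t : R) (u v : int -> R[i])
    (z : R[i]) : R[i] :=
  \sum_(k < n) u k%:Z * Xfun d k%:Z t z + \sum_(l < n) v l%:Z * Yshift d l%:Z t z.

(* phi in V_{t,n} + Theta J P_n V_{t,n} *)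
Definition in_sol_space (R : realType) (d : nat) (c : 'I_d.+1 -> R[i]) (h : R)
    (n : nat) (t : R) (phi : R -> R[i]) : Prop :=
  exists (phi1 phi2 : R -> R[i]) (u1 v1 u2 v2 : int -> R[i]),
    [/\ Vexpansion d h t u1 v1 phi1 /\ Vn_coef n u1 v1,
        Vexpansion d h t u2 v2 phi2 /\ Vn_coef n u2 v2 &
        {ae (@lebesgue_measure R), forall x, phi x =
          phi1 x + Theta c (x +i* h) * sharp (Pproj d n t u2 v2) (x +i* h)}].

(* (I + s Theta J P_n) phi = X(0) - s Theta Y(0), s = 1 or -1.  For n = 0 this
   equation is the definition of phi, and phi need not belong to V_{t,0}. *)
Definition is_phi (R : realType) (d : nat) (c : 'I_d.+1 -> R[i]) (h : R)
    (n : nat) (s : R[i]) (t : R) (phi : R -> R[i]) : Prop :=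
  exists u v : int -> R[i],
    [/\ Vexpansion d h t u v phi,
        (0 < n)%N -> in_sol_space c h n t phi &
        {ae (@lebesgue_measure R), forall x,
          phi x + s * Theta c (x +i* h) * sharp (Pproj d n t u v) (x +i* h)
          = Xfun d 0 t (x +i* h) - s * Theta c (x +i* h) * Yfun d 0 t (x +i* h)}].

Definition is_unique_phi (R : realType) (d : nat) (c : 'I_d.+1 -> R[i]) (h : R)
    (n : nat) (s : R[i]) (t : R) (phi : R -> R[i]) : Prop :=
  is_phi c h n s t phi /\
  forall psi, is_phi c h n s t psi ->
    {ae (@lebesgue_measure R), forall x, psi x = phi x}.

Definition fin_comb (R : realType) (d : nat) (G : R -> R[i] -> R[i]) : Prop :=
  exists (K : nat) (p q : int -> R[i]), forall (t : R) (z : R[i]),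
    G t z = symsum K (fun k => p k * Xfun d k t z + q k * Yfun d k t z).

(* G = E (phi_n^s + X(0)), extended to all real t and complex z *)
Definition is_Ephi (R : realType) (d : nat) (c : 'I_d.+1 -> R[i]) (h : R)
    (n : nat) (s : R[i]) (G : R -> R[i] -> R[i]) : Prop :=
  fin_comb d G /\
  forall t : R, generic_time d t ->
    exists phi : R -> R[i], is_unique_phi c h n s t phi /\
      {ae (@lebesgue_measure R), forall x,
        G t (x +i* h) = E0 c (x +i* h) * (phi x + Xfun d 0 t (x +i* h))}.

Definition is_Astar (R : realType) (d : nat) (c : 'I_d.+1 -> R[i]) (h : R)
    (n : nat) (F : R -> R[i] -> R[i]) : Prop :=
  exists G, is_Ephi c h n 1 G /\
    forall t z, F t z = 2^-1 * (G t z + sharp (G t) z).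

Definition is_Bstar (R : realType) (d : nat) (c : 'I_d.+1 -> R[i]) (h : R)
    (n : nat) (F : R -> R[i] -> R[i]) : Prop :=
  exists G, is_Ephi c h n (- 1) G /\
    forall t z, F t z = 'i / 2 * (G t z - sharp (G t) z).

(* Ps n is P_n^*, and the ordered product is P_n = (P_1^* )^-1 ... (P_n^* )^-1 *)
Definition is_AB (R : realType) (d : nat) (c : 'I_d.+1 -> R[i]) (h : R)
    (A B : R -> R[i] -> R[i]) : Prop :=
  exists (As Bs : nat -> R -> R[i] -> R[i]) (Ps : nat -> 'M[R]_2),
    [/\ forall n, (n <= d)%N -> is_Astar c h n (As n) /\ is_Bstar c h n (Bs n),
        forall n, (1 <= n <= d)%N -> Ps n \in unitmx /\
          forall z : R[i], let t := (rpar d)%:R * n.-1%:R / 2 in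
            col2 (As n t z) (Bs n t z) =
            cmx (Ps n) *m col2 (As n.-1 t z) (Bs n.-1 t z) &
        forall (n : nat) (t : R) (z : R[i]), (1 <= n <= d)%N -> in_step d n t ->
          col2 (A t z) (B t z) =
          cmx (\prod_(1 <= k < n.+1) invmx (Ps k)) *m col2 (As n t z) (Bs n t z)].

(* [abcoef d H v m j] is the column (a_n(L-rj), b_n(L-rj)), n = d - m, built
   from the H_n and the (real) boundary value v = (A_C(0), B_C(0)).  As
   (J H_n)^2 = -I, the propagator of the system over a length s is
     cos(sz) + sin(sz) J H_n
       = ((I - i J H_n) e^{isz} + (I + i J H_n) e^{-isz}) / 2;
   the recursion is its composition with the solution on the next interval. *)
Fixpoint abcoef (R : realType) (d : nat) (H : nat -> 'M[R]_2) (v : 'cV[R[i]]_2)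
    (m j : nat) : 'cV[R[i]]_2 :=
  match m with
  | 0 => if j == 0%N then (1%:M - 'i *: (Jmx R[i] *m cmx (H d))) *m v else 0
  | m'.+1 =>
      if (j <= m)%N then
        2^-1 *: ((1%:M - 'i *: (Jmx R[i] *m cmx (H (d - m)%N))) *m
          (abcoef d H v m' j
           + map_mx (fun x => x^*) (abcoef d H v m' (m - j))))
      else 0
  end.

(* Main.v *)
Require Import Defs.
From HB Require Import structures.
From mathcomp Require Import all_boot all_order all_algebra.
From mathcomp Require Import all_classical all_reals all_analysis.
From mathcomp Require Import complex.
From mathcomp Require Import measurable_realfun.
From mathcomp Require Import zify ring lra.

Set Implicit Arguments.
Unset Strict Implicit.
Unset Printing Implicit Defensive.

Import Order.TTheory GRing.Theory Num.Theory.
Import numFieldNormedType.Exports.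

Local Open Scope classical_set_scope.
Local Open Scope ring_scope.
Local Open Scope complex_scope.

(** Put [q = e^{irz}].  Then [E(z) = e^{-iLz} p(q)] for a polynomial [p] of
    degree [d], and [F |-> F^#] becomes conjugate reversal of coefficients; let
    [p^*] be the reversal of [p].  The theorem rests on the Szego recursion
    [x_0 = 2], [y_0 = 0], [f_n = p x_n + p^* y_n],
    [f_{n+1} = (f_n - g_n rev(f_n)) / (1 - |g_n|^2)], where [rev] is the reversal
    at degree [d + n] and [g_n] is chosen to cancel the coefficient of degree [n].
    So [f_n] has its degrees in [n, ..., d] with leading coefficient [2 C_L]
    ([fn_coef]), and [f_d = 2 C_L q^d].

    The matrices [L_n] compute the lowest coefficients, and those from degree [d]
    on, of the combinations [p x + p^* y] ([Lmx_pvec]).  Hence [D_n <> 0] gives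
    [|g_{n-1}| <> 1] ([ngood_det]), and the vectors [z_n^+], [z_n^-] are read off
    from [x_n] and [y_n] ([zpol_is_z], [is_z_uniq]).  It follows that
    [Z_n = - x_n(0) S_{n-1}], where [S_k] has determinant [1 - |g_k|^2] and is the
    matrix of the [k]th Szego step in a suitable basis, and
    [H_n = - W_n^T W_n / det W_n] with [W_n = S_{n-1} ... S_0].  Cramer's rule gives
    [D_n x_n(0) = - 2 |C_L|^2 D_{n-1}] ([Ddet_xpol]), while [x_n(0) det W_n = 2];
    so [H_n] is a positive definite matrix divided by [D_{n-1} D_n].

    The pair [K_n(t, z)] made of the two halves of [e^{-itz} e^{-iLz} f_n(q)]
    under [#] satisfies a system with constant coefficients, and
    [W_n^{-1} K_n / x_n(0)] satisfies the one with [H_n] ([JHU], [Uf_ode]).  At the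
    joint [t = rn/2] the recursion is exactly the relation [K_{n+1} = S_n K_n] up to
    a scalar, so these pieces agree there ([Uf_joint]).  The first piece starts at
    [(A_C, B_C)], and the last one is constant in [z] at [t = L] because [f_d] is a
    monomial; both boundary conditions follow, and reading the coefficients of
    [f_n] through the recursion gives [a_n] and [b_n] ([abcoef_abn]).

    It remains to identify [A_n^*] and [B_n^*] with [K_n].  On a horizontal line
    above the zeros of [E] the Taylor series of [p^* / p] in [q] converges
    absolutely ([theta_exists]), so [Theta J] applied to a finite sum has an
    explicit expansion in [X(k)], [Y(l-r+1)].  Such expansions are unique
    ([Vexp_unique], by an [L^2] lower bound on a bounded interval), so the operator
    equation is a finite linear system for the coefficients of [P_n phi].  Cleared
    of the denominator [p], this system again prescribes the coefficients that
    [L_n] computes, and its unique solution is [1 - x_n], [- s y_n] ([solves_AB],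
    [solves_uniq]).  This gives [A_n^*] and [B_n^*] in closed form ([Gf_Af],
    [Gf_Bf]), and [P_n^*] is then determined by linear independence
    ([Kf_indep]). *)

(** * Conjugate reversal of polynomials *)

Section ConjAlgebra.
Local Notation "z ^*" := (conjc z) : ring_scope.
Variable R : realType.
Implicit Types x y : R[i].

Lemma conjcM x y : (x * y)^* = x^* * y^*. Proof. exact: rmorphM. Qed.
Lemma conjcD x y : (x + y)^* = x^* + y^*. Proof. exact: rmorphD. Qed.
Lemma conjcN x : (- x)^* = - x^*. Proof. exact: rmorphN. Qed.
Lemma conjcB x y : (x - y)^* = x^* - y^*. Proof. exact: rmorphB. Qed.
Lemma conjcX x n : (x ^+ n)^* = x^* ^+ n. Proof. exact: rmorphXn. Qed.
Lemma conjc_sum I (r : seq I) (P : pred I) (F : I -> R[i]) :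
  (\sum_(i <- r | P i) F i)^* = \sum_(i <- r | P i) (F i)^*.
Proof. exact: rmorph_sum. Qed.

End ConjAlgebra.

Lemma coefM_trunc (C : comNzRingType) (f x : {poly C}) n m :
  (size x <= n)%N ->
  (f * x)`_m = \sum_(k < n) (if (k <= m)%N then f`_(m - k) else 0) * x`_k.
Proof.
move=> sx.
rewrite coefMr (big_ord_widen _ (fun j => f`_(m - j) * x`_j) (leq_maxl m.+1 n)).
rewrite [RHS](big_ord_widen (maxn m.+1 n)
  (fun k => (if (k <= m)%N then f`_(m - k) else 0) * x`_k)) ?leq_maxr //.
rewrite big_mkcond /= [RHS]big_mkcond /=; apply: eq_bigr => k _.
rewrite ltnS; case: (leqP k m) => km; case: (ltnP k n) => // kn.
- by rewrite (@nth_default _ 0 x) ?mulr0 // (leq_trans sx).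
- by rewrite mul0r.
Qed.

Section Reversal.
Local Notation "z ^*" := (conjc z) : ring_scope.
Variable R : realType.
Implicit Types f g : {poly R[i]}.

(** The coefficients of [q^k] times the conjugate of [f(1 / conj q)].  Under
    [q = e^{irz}] this becomes [F |-> F^#], see [sharp_exp_poly]. *)
Definition revp k f : {poly R[i]} := \poly_(i < k.+1) (f`_(k - i))^*.

Lemma coef_revp k f i :
  (revp k f)`_i = if (i <= k)%N then (f`_(k - i))^* else 0.
Proof. by rewrite coef_poly ltnS. Qed.

Lemma size_revp k f : (size (revp k f) <= k.+1)%N.
Proof. exact: size_poly. Qed.

Lemma revpK k f : (size f <= k.+1)%N -> revp k (revp k f) = f.
Proof.
move=> sf; apply/polyP => i; rewrite !coef_revp leq_subr.
case: leqP => ik; first by rewrite subKn // conjcK.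
by rewrite nth_default // (leq_trans sf).
Qed.

Lemma revpD k f g : revp k (f + g) = revp k f + revp k g.
Proof.
apply/polyP => i; rewrite coefD !coef_revp coefD.
by case: ifP => _; rewrite ?rmorphD ?addr0.
Qed.

Lemma revpZ k (a : R[i]) f : revp k (a *: f) = a^* *: revp k f.
Proof.
apply/polyP => i; rewrite coefZ !coef_revp coefZ.
by case: ifP => _; rewrite ?rmorphM ?mulr0.
Qed.

Lemma revpN k f : revp k (- f) = - revp k f.
Proof. by rewrite -scaleN1r revpZ conjcN conjc1 scaleN1r. Qed.

Lemma revpB k f g : revp k (f - g) = revp k f - revp k g.
Proof. by rewrite revpD revpN. Qed.

Lemma revp0 k : revp k 0 = 0.
Proof. by rewrite -(scale0r 0) revpZ rmorph0 !scale0r. Qed.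

Lemma revp_sum k (I : Type) (r : seq I) (F : I -> {poly R[i]}) :
  revp k (\sum_(i <- r) F i) = \sum_(i <- r) revp k (F i).
Proof. by apply: (big_morph _ (revpD k) (revp0 k)). Qed.

Lemma revpXn k l i g : (i <= k)%N -> (size g <= l.+1)%N ->
  revp (k + l) ('X^i * g) = 'X^(k - i) * revp l g.
Proof.
move=> ik sg; apply/polyP => j.
rewrite coefXnM !coef_revp coefXnM.
have [h1|h1] := ltnP j (k - i).
  case: ifP => // _; rewrite ifF; last by lia.
  by rewrite nth_default ?rmorph0 //; apply: leq_trans sg _; lia.
have -> : (j - (k - i) <= l)%N = (j + i <= k + l)%N by lia.
have [h2|h2] := leqP j (k + l).
  have -> : (k + l - j < i)%N = ~~ (j + i <= k + l)%N by lia.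
  case: leqP => h3; last by rewrite conjc0.
  by congr (_`_ _)^*; lia.
by rewrite ifF //; lia.
Qed.

(** Both sides are additive in [f], and for a monomial multiplication is a
    shift of coefficients. *)
Lemma revpM k l f g : (size f <= k.+1)%N -> (size g <= l.+1)%N ->
  revp (k + l) (f * g) = revp k f * revp l g.
Proof.
move=> sf sg.
have fE : f = \sum_(i < k.+1) f`_i *: 'X^i.
  rewrite -poly_def; apply/polyP => i; rewrite coef_poly; case: ltnP => // h.
  by rewrite nth_default // (leq_trans sf).
rewrite {1 2}fE; move: (fun i => f`_i) => F.
rewrite mulr_suml !revp_sum mulr_suml; apply: eq_bigr => i _.
have ik : (i <= k)%N by rewrite -ltnS.
rewrite -scalerAl !revpZ revpXn // -scalerAl; congr (_ *: _).
have := @revpXn k 0 i 1 ik; rewrite addn0 !mulr1 size_poly1 => -> //.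
have -> : revp 0 (1 : {poly R[i]}) = 1; last by rewrite mulr1.
apply/polyP => j; rewrite coef_revp !coef1 leqn0 sub0n eqxx conjc1.
by case: eqP.
Qed.

End Reversal.

(** * The Szego recursion *)

Section Szego.
Local Notation "z ^*" := (conjc z) : ring_scope.
Variables (R : realType) (d : nat) (c : 'I_d.+1 -> R[i]).
Implicit Types (x y f g : {poly R[i]}) (n i j : nat).

(** The polynomial [p] with [E(z) = e^{-iLz} p(e^{irz})], see
    [Eexp_exp_poly]; its reversal [p^*], here [qpol], plays the
    same role for [E^#]. *)
Definition ppol : {poly R[i]} := \poly_(m < d.+1) c (inord (d - m)).

Definition qpol : {poly R[i]} := revp d ppol.

Lemma coef_ppol m : ppol`_m = if (m <= d)%N then c (inord (d - m)) else 0.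
Proof. by rewrite coef_poly ltnS. Qed.

Lemma size_ppol : (size ppol <= d.+1)%N.
Proof. exact: size_poly. Qed.

Lemma coef_qpol m : qpol`_m = if (m <= d)%N then (c (inord m))^* else 0.
Proof.
rewrite coef_revp coef_ppol leq_subr; case: ifP => // md.
by rewrite subKn.
Qed.

Lemma size_qpol : (size qpol <= d.+1)%N.
Proof. exact: size_revp. Qed.

Lemma revp_qpol : revp d qpol = ppol.
Proof. exact/revpK/size_ppol. Qed.

Definition c0 : R[i] := c ord0.

Lemma inord0E : c (inord 0) = c0.
Proof. by congr c; apply/val_inj; rewrite /= inordK. Qed.

Definition fpol (xy : {poly R[i]} * {poly R[i]}) : {poly R[i]} :=
  ppol * xy.1 + qpol * xy.2.

(** The reversal at degree [d + n] of [f_n] has [2 conj c0] as coefficient of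
    degree [n], since [f_n] has leading coefficient [2 c0]; subtracting this
    multiple of the reversal therefore cancels that coefficient in [f_n]. *)
Definition reflection_coef n f : R[i] := f`_n / (2 * c0^*).

(** A Szego step.  As reversal at degree [d + n] sends [p x + p^* y] to
    [p rev(y) + p^* rev(x)], it replaces [f] by [(f - g rev(f)) / (1 - |g|^2)]. *)
Definition szego_step n (xy : {poly R[i]} * {poly R[i]}) :=
  let g := reflection_coef n (fpol xy) in
  ((1 - g * g^*)^-1 *: (xy.1 - g *: revp n xy.2),
   (1 - g * g^*)^-1 *: (xy.2 - g *: revp n xy.1)).

Fixpoint szego n : {poly R[i]} * {poly R[i]} :=
  if n is n'.+1 then szego_step n' (szego n') else (2%:P, 0).

Definition xpol n := (szego n).1.
Definition ypol n := (szego n).2.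
Definition fn n := fpol (szego n).
Definition gn n : R[i] := reflection_coef n (fn n).
Definition kn n : R[i] := (1 - gn n * (gn n)^*)^-1.

Lemma xpolS n : xpol n.+1 = kn n *: (xpol n - gn n *: revp n (ypol n)).
Proof. by []. Qed.
Lemma ypolS n : ypol n.+1 = kn n *: (ypol n - gn n *: revp n (xpol n)).
Proof. by []. Qed.
Lemma fnE n : fn n = ppol * xpol n + qpol * ypol n.
Proof. by []. Qed.

Lemma revp_comb n x y : (size x <= n.+1)%N -> (size y <= n.+1)%N ->
  revp (d + n) (ppol * x + qpol * y) = ppol * revp n y + qpol * revp n x.
Proof.
move=> sx sy; rewrite revpD !revpM ?size_ppol ?size_qpol //.
by rewrite revp_qpol addrC.
Qed.

Lemma size_ypol_xpol n : (size (ypol n) <= n)%N /\ (size (xpol n) <= maxn 1 n)%N.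
Proof.
elim: n => [|n [IHy IHx]]; first by rewrite size_poly0 size_polyC; case: eqP.
have comb m (k g : R[i]) x y : (size x <= m)%N -> (size y <= m)%N ->
    (size (k *: (x - g *: y))%R <= m)%N.
  move=> sx sy; apply: leq_trans (size_scale_leq _ _) _.
  rewrite (leq_trans (size_polyD _ _)) // size_polyN geq_max sx /=.
  exact: leq_trans (size_scale_leq _ _) _.
rewrite ypolS xpolS; split; apply: comb; rewrite ?size_revp //.
- exact: leqW.
- by apply: leq_trans IHx _; lia.
- by rewrite maxnE subSS subn0 add1n size_revp.
Qed.

Lemma size_xpolS n : (size (xpol n) <= n.+1)%N.
Proof. by case: (size_ypol_xpol n) => _ h; apply: leq_trans h _; lia. Qed.

Lemma size_ypolS n : (size (ypol n) <= n.+1)%N.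
Proof. by case: (size_ypol_xpol n) => h _; apply: leq_trans h _; lia. Qed.

Lemma revp_fn n : revp (d + n) (fn n) = ppol * revp n (ypol n) + qpol * revp n (xpol n).
Proof. by rewrite fnE revp_comb ?size_xpolS ?size_ypolS. Qed.

Lemma fnS n : fn n.+1 = kn n *: (fn n - gn n *: revp (d + n) (fn n)).
Proof.
rewrite fnE xpolS ypolS revp_fn -!scalerAr -scalerDr; congr (_ *: _).
by rewrite fnE !mulrBr -!scalerAr scalerDr; ring.
Qed.

Hypothesis c0N0 : c0 != 0.

Definition ngood n := forall k, (k < n)%N -> 1 - gn k * (gn k)^* != 0.

(** Reversal at degree [d + n] maps the interval of degrees [n, ..., d] to
    itself, so no coefficient appears outside of it.  Of the two end
    coefficients, the step cancels the lower one, and the factor [k_n] restores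
    the upper one. *)
Lemma fn_coef n : (n <= d)%N -> ngood n ->
  [/\ forall i, (i < n)%N -> (fn n)`_i = 0, (fn n)`_d = 2 * c0 &
      forall i, (d < i)%N -> (fn n)`_i = 0].
Proof.
have gnE m : (fn m)`_m = gn m * (2 * c0^*).
  by rewrite /gn /reflection_coef divfK // mulf_eq0 pnatr_eq0 /= conjc_eq0.
elim: n => [_ _|n IH nd good].
  rewrite fnE mulr0 addr0; split => // [|i di].
    by rewrite coefMC coef_ppol leqnn subnn inord0E mulrC.
  by rewrite coefMC coef_ppol leqNgt di /= mul0r.
have [|k kn|h1 h2 h3] := IH; [lia|by apply: good; lia|].
have kg : 1 - gn n * (gn n)^* != 0 by exact: good.
split=> [i|| i di]; rewrite fnS coefZ coefB coefZ coef_revp.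
- rewrite ltnS leq_eqVlt => /predU1P[->|ni].
    rewrite leq_addl addnK h2 gnE conjcM conjc_nat.
    by rewrite subrr mulr0.
  rewrite (h1 i ni) (h3 (d + n - i)%N); last by lia.
  by rewrite rmorph0 if_same mulr0 subrr mulr0.
- rewrite leq_addr h2 addKn gnE (conjcM (gn n)) (conjcM 2) conjc_nat conjcK /kn.
  rewrite -[X in X = _](mulKf kg) mulVKf //.
  by field.
- rewrite (h3 i di); case: leqP => [idn|_]; last by rewrite mulr0 subrr mulr0.
  by rewrite (h1 (d + n - i)%N) ?conjc0 ?mulr0 ?subrr ?mulr0 //; lia.
Qed.

Lemma ypol_top0 n : (ypol n)`_n = 0.
Proof. by rewrite nth_default //; case: (size_ypol_xpol n). Qed.

Lemma xpolS0 n : (xpol n.+1)`_0 = kn n * (xpol n)`_0.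
Proof.
by rewrite xpolS coefZ coefB coefZ coef_revp leq0n subn0 ypol_top0 conjc0 mulr0 subr0.
Qed.

Lemma ypolS_top n : (ypol n.+1)`_n = - gn n * kn n * ((xpol n)`_0)^*.
Proof.
rewrite ypolS coefZ coefB coefZ coef_revp leqnn subnn.
by rewrite ypol_top0 sub0r mulrN mulNr mulNr mulrCA mulrA.
Qed.

End Szego.

(** * The matrices [L_n] acting on pairs of polynomials *)

Section Lmatrix.
Local Notation "z ^*" := (conjc z) : ring_scope.
Variables (R : realType) (d : nat) (c : 'I_d.+1 -> R[i]).
Implicit Types (x y f g : {poly R[i]}) (n i j : nat).
Local Notation ppol := (ppol c).
Local Notation qpol := (qpol c).
Local Notation c0 := (c0 c).

Definition pvec n x : 'cV[R[i]]_n := \col_(i < n) x`_i.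

(** Each block of [L_n] is a triangular Toeplitz matrix, so it multiplies by [p]
    or [p^*] and keeps either the [n] lowest coefficients or the [n] coefficients
    from degree [d] on. *)
Lemma Lmx_pvec n (s : R[i]) x y : s * s = 1 -> (n <= d)%N ->
  (size x <= n)%N -> (size y <= n)%N ->
  let f := ppol * x + s *: (qpol * y) in
  Lmx c n s *m col_mx (pvec n x) (pvec n y) =
  col_mx (\col_i f`_i) (\col_i (s * f`_(d + i))).
Proof.
move=> ss nd sx sy f; rewrite /Lmx mul_block_col.
congr col_mx; apply/matrixP => i j; rewrite !mxE /f coefD coefZ !(coefM_trunc _ _ sx) !(coefM_trunc _ _ sy).
- rewrite mulr_sumr; congr (_ + _); apply: eq_bigr => k _; rewrite !mxE.
    case: leqP => // ki; rewrite coef_ppol ifT //.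
    by have := ltn_ord i; lia.
  rewrite mulrA; congr (_ * _); case: leqP => ki; last by rewrite conjc0.
  by rewrite coef_qpol ifT //; have := ltn_ord i; lia.
- rewrite mulrDr; rewrite !mulr_sumr; congr (_ + _); apply: eq_bigr => k _; rewrite !mxE.
    rewrite mulrA; congr (_ * _); case: (leqP k (d + i)) => ki; last first.
      by have := ltn_ord k; lia.
    rewrite coef_ppol; case: (leqP i k) => ik.
      rewrite ifT; last by lia.
      by congr (_ * c (inord _)); lia.
    by rewrite ifF //; apply/negbTE; lia.
  rewrite !mulrA ss mul1r; congr (_ * _); case: (leqP k (d + i)) => ki; last first.
    by have := ltn_ord k; lia.
  rewrite coef_qpol; case: (leqP i k) => ik.
    rewrite ifT; last by lia.
    by congr ((c (inord _))^*); lia.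
  by rewrite ifF ?conjc0 //; apply/negbTE; lia.
Qed.

Lemma pvec_inj n x y : (size x <= n)%N -> (size y <= n)%N ->
  pvec n x = pvec n y -> x = y.
Proof.
move=> sx sy /matrixP e; apply/polyP => i; case: (ltnP i n) => hi.
  by have := e (Ordinal hi) 0; rewrite !mxE.
by rewrite !nth_default // ?(leq_trans sx) ?(leq_trans sy).
Qed.

Lemma pvecP n (v : 'cV[R[i]]_n) : {x : {poly R[i]} | (size x <= n)%N & v = pvec n x}.
Proof.
exists (\poly_(i < n) if insub i is Some j then v j 0 else 0); first exact: size_poly.
apply/matrixP => i j; rewrite !mxE coef_poly ltn_ord valK ord1 //.
Qed.

Lemma Lmx_ker n x y : Ddet c n != 0 -> (n <= d)%N ->
  (size x <= n)%N -> (size y <= n)%N ->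
  (forall i, (i < n)%N -> (ppol * x + qpol * y)`_i = 0) ->
  (forall i, (i < n)%N -> (ppol * x + qpol * y)`_(d + i) = 0) ->
  x = 0 /\ y = 0.
Proof.
move=> Dn nd sx sy lo hi.
have := Lmx_pvec (mulr1 1) nd sx sy; rewrite /= scale1r.
have -> : col_mx (\col_i (ppol * x + qpol * y)`_i)
     (\col_(i < n) (1 * (ppol * x + qpol * y)`_(d + i))) = 0 :> 'cV_(n + n).
  rewrite -[RHS]col_mx0; congr col_mx; apply/matrixP => i j; rewrite !mxE ?mul1r.
    exact: lo.
  exact: hi.
move=> /(congr1 (mulmx (invmx (Lmx c n 1)))).
rewrite mulKmx ?unitmxE ?unitfE // mulmx0 -[RHS]col_mx0 => /eq_col_mx [e1 e2].
have p0 : pvec n 0 = 0 by apply/matrixP => i j; rewrite !mxE coef0.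
by split; apply: (@pvec_inj n); rewrite ?size_poly0 // p0.
Qed.

Lemma Lmx_uniq n x y x' y' : Ddet c n != 0 -> (n <= d)%N ->
  (size x <= n)%N -> (size y <= n)%N -> (size x' <= n)%N -> (size y' <= n)%N ->
  (forall i, (i < n)%N -> (ppol * x + qpol * y)`_i = (ppol * x' + qpol * y')`_i) ->
  (forall i, (i < n)%N ->
     (ppol * x + qpol * y)`_(d + i) = (ppol * x' + qpol * y')`_(d + i)) ->
  x = x' /\ y = y'.
Proof.
move=> Dn nd sx sy sx' sy' lo hi.
have sB (u v : {poly R[i]}) : (size u <= n)%N -> (size v <= n)%N -> (size (u - v)%R <= n)%N.
  by move=> su sv; rewrite (leq_trans (size_polyD _ _)) // size_polyN geq_max su.
have e : ppol * (x - x') + qpol * (y - y') =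
   (ppol * x + qpol * y) - (ppol * x' + qpol * y') by ring.
have [] := @Lmx_ker n (x - x') (y - y') Dn nd (sB _ _ sx sx') (sB _ _ sy sy').
- by move=> i hi'; rewrite e coefB lo // subrr.
- by move=> i hi'; rewrite e coefB hi // subrr.
by move=> /subr0_eq -> /subr0_eq ->.
Qed.

Hypothesis c0N0 : c0 != 0.

Lemma xpol0N0 n : ngood c n -> (xpol c n)`_0 != 0.
Proof.
elim: n => [_|n IH good]; first by rewrite /xpol /= coefC /= pnatr_eq0.
rewrite xpolS0 mulf_neq0 //; last by apply: IH => k kn; apply: good; lia.
by rewrite invr_eq0; apply: good.
Qed.

(** If [|g_n| = 1], the Szego step without its scalar factor cancels the
    coefficients of degree [n] and [d] of [f_n] at the same time, which yields a
    nonzero element of the kernel of [L_{n+1}]. *)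
Lemma ngood_det n : (n <= d)%N ->
  (forall k, (1 <= k <= n)%N -> Ddet c k != 0) -> ngood c n.
Proof.
elim: n => [//|n IH] nd D; have good : ngood c n.
  by apply: IH => [|k kn]; [lia|apply: D; lia].
move=> k; rewrite ltnS leq_eqVlt => /predU1P[->|]; last exact: good.
apply/eqP => g1.
have [h1 h2 h3] := fn_coef c0N0 (ltnW nd) good.
have gnE : (fn c n)`_n = gn c n * (2 * c0^*).
  by rewrite /gn /reflection_coef divfK // mulf_eq0 pnatr_eq0 /= conjc_eq0.
pose x := xpol c n - gn c n *: revp n (ypol c n).
pose y := ypol c n - gn c n *: revp n (xpol c n).
have e : ppol * x + qpol * y = fn c n - gn c n *: revp (d + n) (fn c n).
  by rewrite revp_fn fnE /x /y !mulrBr -!scalerAr scalerDr; ring.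
have sz (u v : {poly R[i]}) : (size u <= n.+1)%N -> (size (u - gn c n *: revp n v)%R <= n.+1)%N.
  move=> su; rewrite (leq_trans (size_polyD _ _)) // size_polyN geq_max su /=.
  by rewrite (leq_trans (size_scale_leq _ _)) ?size_revp.
have Dn1 : Ddet c n.+1 != 0 by apply: D; lia.
have [||x0 _] := @Lmx_ker n.+1 x y Dn1 nd (sz _ _ (size_xpolS c n)) (sz _ _ (size_ypolS c n)).
- move=> i; rewrite ltnS e coefB coefZ coef_revp leq_eqVlt => /predU1P[->|ni].
    by rewrite leq_addl addnK h2 gnE conjcM conjc_nat subrr.
  rewrite (h1 i ni) (h3 (d + n - i)%N); last by lia.
  by rewrite conjc0 if_same mulr0 subrr.
- move=> i ni; rewrite e coefB coefZ coef_revp; case: i ni => [|i] ni.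
    rewrite addn0 leq_addr h2 addKn gnE (conjcM (gn c n)) (conjcM 2) conjc_nat conjcK.
    have -> : 2 * c0 - gn c n * ((gn c n)^* * (2 * c0)) =
       2 * c0 * (1 - gn c n * (gn c n)^*) by ring.
    by rewrite g1 mulr0.
  have e1 : (fn c n)`_(d + i.+1) = 0 by apply: h3; lia.
  have e2 : (fn c n)`_(d + n - (d + i.+1)) = 0 by apply: h1; lia.
  rewrite e1 e2.
  by rewrite conjc0 if_same mulr0 subrr.
have := xpol0N0 good; have : x`_0 = 0 by rewrite x0 coef0.
by rewrite coefB coefZ coef_revp leq0n subn0 ypol_top0 conjc0 mulr0 subr0 => ->; rewrite eqxx.
Qed.

End Lmatrix.

(** * The determinants [D_n] *)

Lemma det_reindex (C : comNzRingType) k l (e : k = l) (A : 'M[C]_k) (B : 'M[C]_l) :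
  (forall i j, A i j = B (cast_ord e i) (cast_ord e j)) -> \det A = \det B.
Proof.
case: l / e B => B AB; congr (\det _); apply/matrixP => i j.
by rewrite AB !cast_ord_id.
Qed.

Section Determinants.
Local Notation "z ^*" := (conjc z) : ring_scope.
Variables (R : realType) (d : nat) (c : 'I_d.+1 -> R[i]).
Local Notation c0 := (c0 c).

(** The entries of [L_n^+] with indices in [nat], so that deleting rows and
    columns involves no casts of ordinals. *)
Definition Lentry n (i j : nat) : R[i] :=
  if (i < n)%N then
    if (j < n)%N then if (j <= i)%N then c (inord (d - (i - j))) else 0
    else if (j - n <= i)%N then (c (inord (i - (j - n))))^* else 0
  else
    if (j < n)%N then if (i - n <= j)%N then c (inord (j - (i - n))) else 0
    else if (i <= j)%N then (c (inord (d - (j - i))))^* else 0.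

Lemma LmxE n (i j : 'I_(n + n)) : Lmx c n 1 i j = Lentry n i j.
Proof.
rewrite /Lentry; case: (split_ordP i) => i' ->; case: (split_ordP j) => j' ->;
  rewrite ?block_mxEul ?block_mxEur ?block_mxEdl ?block_mxEdr !mxE /= ?ltn_ord
    ?mul1r ?ltnNge ?leq_addr ?addKn /= ?leq_add2l //.
- by case: ifP; rewrite ?conjc0.
- by case: ifP; rewrite ?conjc0 // subnDl.
Qed.

Lemma size_xpol n : (0 < n)%N -> (size (xpol c n) <= n)%N.
Proof. by case: n => // n _; have [_] := size_ypol_xpol c n.+1; rewrite maxnE subn1 add1n. Qed.

Lemma size_ypol n : (size (ypol c n) <= n)%N.
Proof. by case: (size_ypol_xpol c n). Qed.

(** Once column [0] is deleted, row [0] has the single nonzero entry [conj c0];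
    deleting this row and the column of that entry leaves [L_m^+]. *)
Lemma Lmx_minor m (L := Lmx c m.+1 1) :
  cofactor L (rshift m.+1 ord0) (lshift m.+1 ord0) = - c0^* * Ddet c m.
Proof.
rewrite /cofactor addn0 [nat_of_ord _]/= addn0.
set M1 := row' _ _.
pose j0 : 'I_(m + m.+1) := rshift m ord0; pose i0 : 'I_(m + m.+1) := cast_ord (addnC _ _) (lshift m ord0).
have M1E (i j : 'I_(m + m.+1)) : M1 i j = Lentry m.+1 (bump m.+1 i) (bump 0 j).
  by rewrite mxE mxE LmxE /= addn0.
have i0E : i0 = 0%N :> nat by [].
have j0E : j0 = m :> nat by rewrite /= addn0.
rewrite (expand_det_row M1 i0) (bigD1 j0) //= big1 ?addr0; last first.
  move=> j jj; rewrite M1E i0E /Lentry /bump /= !add1n !ltnS.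
  have jm : (j : nat) != m.
    by apply: contra jj => /eqP jm; apply/eqP/val_inj; rewrite /= addn0.
  case: ltnP => mj; first by rewrite mul0r.
  by rewrite ifF ?mul0r //; apply/negbTE; lia.
have -> : M1 i0 j0 = c0^*.
  by rewrite M1E i0E j0E /Lentry /bump /= !add1n ltnn subnn leqnn inord0E.
have -> : cofactor M1 i0 j0 = (-1) ^+ m * Ddet c m.
  have e0 : (i0 + j0)%N = m by rewrite /= addn0.
  rewrite /cofactor; congr ((-1) ^+ _ * _); first exact: e0.
  apply: (det_reindex (e := _)) => [|e i j]; first by lia.
  rewrite LmxE mxE mxE M1E /= addn0 /Lentry /bump.
  have := ltn_ord i; have := ltn_ord j; move: (nat_of_ord i) (nat_of_ord j) => a b.
  move=> hb ha.
  have -> : ((m < (0 <= a) + a) + ((0 <= a) + a) = if a < m then a.+1 else a.+2)%N.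
    by case: ltnP; lia.
  have -> : ((0 <= (m <= b) + b) + ((m <= b) + b) = if b < m then b.+1 else b.+2)%N.
    by case: (ltnP b m); lia.
  by case: (ltnP a m) => am; case: (ltnP b m) => bm; rewrite !(ltnS, subSS) ?am ?bm;
    rewrite ?[(a.+1 < m)%N]ltnNge ?[(b.+1 < m)%N]ltnNge ?(leqW am) ?(leqW bm) /= ?(subSn am) ?(subSn bm) //;
    rewrite ?ltnS ?subSS.
have sg : (-1) ^+ m * (-1) ^+ m = 1 :> R[i] by rewrite -expr2 sqrr_sign.
rewrite exprS mulN1r; move: ((-1) ^+ m) sg => e sg.
have -> : - e * (c0^* * (e * Ddet c m)) = (e * e) * (- c0^* * Ddet c m) by ring.
by rewrite sg mul1r.
Qed.

(** Cramer's rule.  Among the coefficients of [f_n] computed by [L_n^+], only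
    the one of degree [d] is nonzero, and it equals [2 c0]. *)
Lemma Ddet_xpol m : c0 != 0 -> (m < d)%N -> ngood c m.+1 ->
  Ddet c m.+1 * (xpol c m.+1)`_0 = - (2 * c0 * c0^*) * Ddet c m.
Proof.
move=> c0N0 md good; set n := m.+1; set L := Lmx c n 1.
have [lo top hi] := fn_coef c0N0 md good.
have := Lmx_pvec c (mulr1 1) md (size_xpol (ltn0Sn m)) (size_ypol n).
rewrite scale1r /= -fnE => /(congr1 (mulmx (\adj L))).
rewrite mulmxA mul_adj_mx mul_scalar_mx => /matrixP/(_ (lshift n ord0) ord0).
rewrite mxE col_mxEu mxE -/(Ddet c n) => ->.
rewrite mxE (bigD1 (rshift n ord0)) //= col_mxEd !mxE addn0 mul1r top.
rewrite big1 ?addr0 => [|i].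
  by rewrite Lmx_minor; ring.
case: (split_ordP i) => i' ->; rewrite ?col_mxEu ?col_mxEd !mxE.
  by rewrite lo ?mulr0.
rewrite (inj_eq (@rshift_inj _ _)) => i0.
rewrite hi ?mulr0 //.
have : (i' : nat) != 0%N by [].
lia.
Qed.

End Determinants.

(** * The matrices [H_n] *)

Section Mx2.
Variable T : comNzRingType.

Lemma mx2P (A B : 'M[T]_2) : A 0 0 = B 0 0 -> A 0 1 = B 0 1 ->
  A 1 0 = B 1 0 -> A 1 1 = B 1 1 -> A = B.
Proof.
have o (i : 'I_2) : i = 0 \/ i = 1.
  by case: i => [[|[|//]] ?]; [left|right]; apply/val_inj.
by move=> h1 h2 h3 h4; apply/matrixP => i j; case: (o i) (o j) => -> [] ->.
Qed.

Lemma col2P (A B : 'cV[T]_2) : A 0 0 = B 0 0 -> A 1 0 = B 1 0 -> A = B.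
Proof.
move=> h1 h2; apply/matrixP => i j; rewrite ord1.
case: i => [[|[|//]] p]; first by have -> : Ordinal p = 0 by apply/val_inj.
by have -> : Ordinal p = 1 by apply/val_inj.
Qed.

Lemma mulmx2E m n (A : 'M[T]_(m, 2)) (B : 'M[T]_(2, n)) i j :
  (A *m B) i j = A i 0 * B 0 j + A i 1 * B 1 j.
Proof.
rewrite mxE big_ord_recl big_ord_recl big_ord0 addr0.
by have -> : lift ord0 ord0 = 1 :> 'I_2 by apply/val_inj.
Qed.

Lemma det_mx2E (A : 'M[T]_2) : \det A = A 0 0 * A 1 1 - A 0 1 * A 1 0.
Proof.
rewrite (expand_det_row _ 0) big_ord_recl big_ord_recl big_ord0 addr0 /cofactor.
rewrite !det_mx11 !mxE /= expr0 expr1 mul1r mulN1r mulrN.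
by congr (_ * A _ _ - A _ _ * A _ _); apply/val_inj.
Qed.

Lemma mx2_00 (a b c d : T) : mx2 a b c d 0 0 = a. Proof. by rewrite mxE. Qed.
Lemma mx2_01 (a b c d : T) : mx2 a b c d 0 1 = b. Proof. by rewrite mxE. Qed.
Lemma mx2_10 (a b c d : T) : mx2 a b c d 1 0 = c. Proof. by rewrite mxE. Qed.
Lemma mx2_11 (a b c d : T) : mx2 a b c d 1 1 = d. Proof. by rewrite mxE. Qed.
Definition mx2E := (mx2_00, mx2_01, mx2_10, mx2_11).

Lemma col2_0 (a b : T) : col2 a b 0 0 = a. Proof. by rewrite mxE. Qed.
Lemma col2_1 (a b : T) : col2 a b 1 0 = b. Proof. by rewrite mxE. Qed.
Definition col2E := (col2_0, col2_1).

Lemma mul_J_tr (A : 'M[T]_2) : A *m Jmx T *m A^T = \det A *: Jmx T.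
Proof.
by apply: mx2P; rewrite !mulmx2E !mxE /= det_mx2E; ring.
Qed.

End Mx2.

Section ZandH.
Local Notation "z ^*" := (conjc z) : ring_scope.
Variables (R : realType) (d : nat) (c : 'I_d.+1 -> R[i]).
Local Notation c0 := (c0 c).
Local Notation ppol := (ppol c).
Local Notation qpol := (qpol c).
Hypothesis c0N0 : c0 != 0.
Hypothesis DN0 : forall n, (1 <= n <= d)%N -> Ddet c n != 0.

Let good n : (n <= d)%N -> ngood c n.
Proof. by move=> nd; apply: ngood_det => // k kn; apply: DN0; lia. Qed.

(** The polynomial [f_n] and its reversal at degree [d + n - 1] each have a
    single nonzero coefficient in the degrees seen by [L_n].  Adding them makes
    the pair of unknowns conjugate symmetric, as [is_z] requires. *)
Definition zpol n (s : R[i]) : {poly R[i]} := - (xpol c n + s *: revp n.-1 (ypol c n)).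

Lemma size_zpol n s : (0 < n)%N -> (size (zpol n s) <= n)%N.
Proof.
move=> n0; rewrite size_polyN (leq_trans (size_polyD _ _)) // geq_max size_xpol //.
rewrite (leq_trans (size_scale_leq _ _)) // (leq_trans (size_revp _ _)) //.
by rewrite prednK.
Qed.

Lemma is_zP n (s : R[i]) (x : {poly R[i]}) : s * s = 1 -> (1 <= n <= d)%N ->
  (size x <= n)%N ->
  let f := ppol * x + s *: (qpol * revp n.-1 x) in
  is_z c s (pvec n x) <->
  (forall i, (i < n)%N -> f`_i = - s * (if i.+1 == n then 2 * c0^* else 0)) /\
  (forall i, (i < n)%N -> f`_(d + i) = - (if i == 0%N then 2 * c0 else 0)).
Proof.
move=> ss /andP[n0 nd] sx f.
have sr : (size (revp n.-1 x) <= n)%N by rewrite (leq_trans (size_revp _ _)) ?prednK.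
have -> : is_z c s (pvec n x) <->
    Lmx c n s *m col_mx (pvec n x) (pvec n (revp n.-1 x)) = - s *: rhs c n.
  rewrite /is_z; suff -> : \col_(i < n) (pvec n x (rev_ord i) 0)^* = pvec n (revp n.-1 x) by [].
  apply/matrixP => i j; rewrite !mxE coef_revp /= ifT; last by have := ltn_ord i; lia.
  by congr ((x`_ _)^*); have := ltn_ord i; lia.
rewrite (Lmx_pvec c ss nd sx sr) -/f /rhs scale_col_mx.
have sN : s != 0 by apply/eqP => s0; move/eqP: ss; rewrite s0 mul0r eq_sym oner_eq0.
split=> [/eq_col_mx[/matrixP lo /matrixP hi]|[lo hi]].
  split=> i hi'.
    by have := lo (Ordinal hi') 0; rewrite !mxE.
  by have := hi (Ordinal hi') 0; rewrite !mxE /= mulNr -mulrN => /(mulfI sN).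
congr col_mx; apply/matrixP => i j; rewrite !mxE.
  by rewrite lo.
by rewrite hi // mulNr mulrN.
Qed.

Lemma zpol_is_z n (s : R[i]) : s^* = s -> s * s = 1 -> (1 <= n <= d)%N ->
  is_z c s (pvec n (zpol n s)).
Proof.
move=> sr ss nd; have [n0 nd'] : (0 < n)%N /\ (n <= d)%N by lia.
apply/is_zP; rewrite ?size_zpol //.
have [lo top hi] := fn_coef c0N0 nd' (good nd').
have -> : ppol * zpol n s + s *: (qpol * revp n.-1 (zpol n s)) =
    - (fn c n + s *: revp (d + n.-1) (fn c n)).
  rewrite fnE revp_comb ?prednK ?size_xpol ?size_ypol // /zpol.
  rewrite revpN revpD revpZ revpK ?prednK ?size_ypol // sr.
  rewrite !mulrN scalerN !mulrDr -!scalerAr !scalerDr scalerA ss scale1r.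
  by ring.
split=> i hi'; rewrite coefN coefD coefZ coef_revp.
  rewrite (lo i hi') add0r ifT; last by lia.
  case: eqP => [i1|i1].
    have -> : (d + n.-1 - i = d)%N by lia.
    by rewrite top conjcM conjc_nat mulNr.
  by rewrite hi ?conjc0 ?mulr0 ?oppr0 //; lia.
rewrite ifT; last by lia.
rewrite [X in conjc X]lo ?conjc0 ?mulr0 ?addr0; last by lia.
by case: i hi' => [|i] hi'; rewrite ?addn0 ?top // hi //; lia.
Qed.

Lemma is_z_uniq n (s : R[i]) (z : 'cV[R[i]]_n) : s^* = s -> s * s = 1 ->
  (1 <= n <= d)%N -> is_z c s z -> z = pvec n (zpol n s).
Proof.
move=> sr ss nd; have [n0 nd'] : (0 < n)%N /\ (n <= d)%N by lia.
have [x sx ->] := pvecP z => /(is_zP ss nd sx) [lo hi].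
have /(is_zP ss nd (size_zpol s n0)) [lo' hi'] := zpol_is_z sr ss nd.
have sz (u : {poly R[i]}) : (size (s *: revp n.-1 u)%R <= n)%N.
  by rewrite (leq_trans (size_scale_leq _ _)) // (leq_trans (size_revp _ _)) // prednK.
have [||-> //] := @Lmx_uniq _ _ c n x (s *: revp n.-1 x) (zpol n s) (s *: revp n.-1 (zpol n s))
  (DN0 nd) nd' sx (sz _) (size_zpol s n0) (sz _).
- by move=> i h; rewrite -!scalerAr lo ?lo'.
- by move=> i h; rewrite -!scalerAr hi ?hi'.
Qed.

Definition xr n : R := complex.Re (xpol c n)`_0.
Definition rn n : R := 1 - normc2 (gn c n).

Lemma mul_conjc (g : R[i]) : g * g^* = (normc2 g)%:C.
Proof. by case: g => a b; apply/eqP; rewrite eq_complex /normc2 /=; apply/andP; split; apply/eqP; ring. Qed.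

Lemma one_sub_gg n : 1 - gn c n * (gn c n)^* = (rn n)%:C.
Proof. by rewrite mul_conjc /rn rmorphB rmorph1. Qed.

Lemma kn_real n : kn c n = ((rn n)^-1)%:C.
Proof. by rewrite /kn one_sub_gg fmorphV. Qed.

Lemma rn_N0 n : (n < d)%N -> rn n != 0.
Proof.
move=> nd; have := good nd (ltnSn n); rewrite one_sub_gg.
by apply: contra => /eqP ->.
Qed.

Lemma xpol0_real n : (xpol c n)`_0 = (xr n)%:C.
Proof.
rewrite /xr; elim: n => [|n IH].
  by rewrite /xpol /= coefC; apply/eqP; rewrite eq_complex /= addr0 !eqxx.
by rewrite xpolS0 IH kn_real -rmorphM.
Qed.

Lemma xrS n : xr n.+1 = (rn n)^-1 * xr n.
Proof. by rewrite /xr xpolS0 xpol0_real kn_real -rmorphM. Qed.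

Lemma xr_N0 n : (n <= d)%N -> xr n != 0.
Proof.
move=> nd; have := xpol0N0 c0N0 (good nd); rewrite xpol0_real.
by apply: contra => /eqP ->.
Qed.

(** The matrix [Z_{n+1}] divided by [- x_{n+1}(0)], see [zpol_0]. *)
Definition Smx n : 'M[R]_2 :=
  mx2 (1 - complex.Re (gn c n)) (complex.Im (gn c n))
      (complex.Im (gn c n)) (1 + complex.Re (gn c n)).

Fixpoint Wmx n : 'M[R]_2 := if n is m.+1 then Smx m *m Wmx m else 1%:M.

Lemma det_Smx n : \det (Smx n) = rn n.
Proof. by rewrite det_mx2E !mx2E /rn /normc2; ring. Qed.

Lemma det_WmxS n : \det (Wmx n.+1) = rn n * \det (Wmx n).
Proof. by rewrite /= det_mulmx det_Smx. Qed.

(** A step multiplies [det W_n] by [1 - |g_n|^2] and [x_n(0)] by its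
    inverse. *)
Lemma det_Wmx n : (n <= d)%N -> \det (Wmx n) * xr n = 2.
Proof.
elim: n => [|n IH] nd; first by rewrite det1 /xr /xpol /= coefC mul1r.
rewrite det_WmxS xrS -IH; last by lia.
by field; exact: rn_N0.
Qed.

Lemma Wmx_unit n : (n <= d)%N -> Wmx n \in unitmx.
Proof.
move=> nd; rewrite unitmxE unitfE; apply/eqP => W0.
by have := det_Wmx nd; rewrite W0 mul0r => /eqP; rewrite eq_sym pnatr_eq0.
Qed.

Lemma zpol_0 n (s : R[i]) : (zpol n.+1 s)`_0 =
  - (xr n.+1)%:C * (1 - s * (gn c n)^*).
Proof.
rewrite coefN coefD (coefZ s) coef_revp leq0n subn0 ypolS_top xpol0_real conjcM conjcM conjcN.
rewrite conjcK xpol0_real kn_real !conjc_real xrS rmorphM; ring.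
Qed.

Fixpoint Zscal n : R := if n is m.+1 then - xr m.+1 * Zscal m else 1.

Lemma Zscal_N0 n : (n <= d)%N -> Zscal n != 0.
Proof.
elim: n => [|n IH] nd /=; first exact: oner_neq0.
by rewrite mulf_neq0 ?oppr_eq0 ?xr_N0 // IH //; lia.
Qed.

Lemma Zprod_Wmx n (zp zm : forall k, 'cV[R[i]]_k) : (n <= d)%N ->
  (forall k, (1 <= k <= n)%N -> is_z c 1 (zp k) /\ is_z c (- 1) (zm k)) ->
  Zprod zp zm n = Zscal n *: Wmx n.
Proof.
elim: n => [|n IH] nd z; first by rewrite scale1r.
have [zp1 zm1] : is_z c 1 (zp n.+1) /\ is_z c (- 1) (zm n.+1) by apply: z; lia.
rewrite [LHS]/= IH; [|lia|by move=> k kn; apply: z; lia].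
rewrite (is_z_uniq _ _ _ zp1) ?conjc1 ?mulr1 //.
rewrite (is_z_uniq _ _ _ zm1) ?conjcN ?conjc1 ?mulNr ?mulrN ?mulr1 ?opprK //.
rewrite !mxE !zpol_0 /= -scalemxAr [- xr _ * Zscal _]mulrC -scalerA; congr (_ *: _).
rewrite scalemxAl; congr (_ *m _).
rewrite /Smx; case: (gn c n) => a b.
by apply: mx2P; rewrite [RHS]mxE !mx2E /=; ring.
Qed.

(** The solution of the equation defining [H_n], in which the scalar relating
    [Z_n ... Z_1] to [W_n] cancels; it follows from [W J W^T = det W J]. *)
Definition Hmx n : 'M[R]_2 := - (\det (Wmx n))^-1 *: ((Wmx n)^T *m Wmx n).

Lemma Hmx_spec n : (n <= d)%N -> Wmx n *m Jmx R *m Hmx n = - Jmx R *m Wmx n.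
Proof.
move=> nd; have WN : \det (Wmx n) != 0.
  by have := Wmx_unit nd; rewrite unitmxE unitfE.
rewrite /Hmx -scalemxAr mulmxA mul_J_tr -scalemxAl scalerA mulNr mulVf //.
by rewrite scaleN1r mulNmx.
Qed.

Lemma is_H_uniq n Hn : (n <= d)%N -> is_H c n Hn -> Hn = Hmx n.
Proof.
move=> nd [_ [zp [zm [/(Zprod_Wmx nd) ->]]]].
rewrite mulNmx -!scalemxAl -!scalemxAr -scalerN => /(scalerI (Zscal_N0 nd)).
rewrite -mulNmx -Hmx_spec // -!mulmxA => /(can_inj (mulKmx (Wmx_unit nd))).
have Ju : Jmx R \in unitmx by rewrite unitmxE det_mx2E !mx2E mul0r sub0r mulN1r opprK unitr1.
by move=> /(can_inj (mulKmx Ju)).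
Qed.

Lemma Hmx_is_H n : (n <= d)%N -> is_H c n (Hmx n).
Proof.
move=> nd; split; first by rewrite /Hmx linearZ /= trmx_mul trmxK.
exists (fun k => pvec k (zpol k 1)), (fun k => pvec k (zpol k (-1))).
have z k : (1 <= k <= n)%N -> is_z c 1 (pvec k (zpol k 1)) /\
    is_z c (-1) (pvec k (zpol k (-1))).
  by move=> kn; split; apply: zpol_is_z; rewrite ?conjcN ?conjc1 ?mulNr ?mulrN ?mulr1 ?opprK //; lia.
split=> //; rewrite (Zprod_Wmx nd z).
by rewrite -[in LHS]scalemxAl -[in LHS]scalemxAl -[in RHS]scalemxAr Hmx_spec.
Qed.

Definition Dr n : R := complex.Re (Ddet c n).

Lemma Ddet0 : Ddet c 0 = 1.
Proof. by rewrite /Ddet det_mx00. Qed.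

Lemma Ddet_realS n : (n < d)%N -> Ddet c n = (Dr n)%:C -> Ddet c n.+1 = (Dr n.+1)%:C /\
  Dr n.+1 * xr n.+1 = - (2 * normc2 c0) * Dr n.
Proof.
move=> nd Dn; have := Ddet_xpol c0N0 nd (good nd).
rewrite -mulrA mul_conjc Dn xpol0_real => e.
have xN : (xr n.+1)%:C != 0 by rewrite fmorph_eq0 xr_N0.
have e2 : Ddet c n.+1 = ((- (2 * normc2 c0) * Dr n) / xr n.+1)%:C.
  apply: (mulIf xN); rewrite e -rmorphM divfK ?xr_N0 //.
  by rewrite rmorphM rmorphN rmorphM rmorph_nat.
by rewrite /Dr e2 /= divfK ?xr_N0.
Qed.

Lemma Ddet_real n : (n <= d)%N -> Ddet c n = (Dr n)%:C.
Proof.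
elim: n => [_|n IH nd]; first by rewrite /Dr Ddet0.
by have [] := Ddet_realS nd (IH (ltnW nd)).
Qed.

Lemma Dr_rec n : (n < d)%N -> Dr n.+1 * xr n.+1 = - (2 * normc2 c0) * Dr n.
Proof. by move=> nd; have [] := Ddet_realS nd (Ddet_real (ltnW nd)). Qed.

Lemma Dr_N0 n : (n <= d)%N -> Dr n != 0.
Proof.
case: n => [_|n nd]; first by rewrite /Dr Ddet0 /= oner_neq0.
by have := DN0 (n := n.+1) nd; rewrite Ddet_real //; apply: contra => /eqP ->.
Qed.

Lemma normc2_c0 : 0 < normc2 c0.
Proof.
have h : 0 <= normc2 c0 by rewrite addr_ge0 ?sqr_ge0.
rewrite lt_def h andbT; apply: contra c0N0 => /eqP h0.
by have := mul_conjc c0; rewrite h0 => /eqP; rewrite mulf_eq0 conjc_eq0 orbb.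
Qed.

(** The comparison of [det_Wmx] with [Dr_rec] gives
    [det W_n = - D_n / (|c0|^2 D_{n-1})], whence the scalar. *)
Definition Htilde n : 'M[R]_2 :=
  (normc2 c0 * Dr n.-1 ^+ 2) *: ((Wmx n)^T *m Wmx n).

Lemma Hmx_Htilde n : (1 <= n <= d)%N -> Hmx n = (Dr n.-1 * Dr n)^-1 *: Htilde n.
Proof.
case: n => // n nd; rewrite /Hmx /Htilde scalerA; congr (_ *: _) => /=.
have Dn := Dr_N0 (ltnW nd); have Dn1 := Dr_N0 nd; have e := Dr_rec nd.
have dW := det_Wmx nd.
have -> : \det (Wmx n.+1) = - Dr n.+1 / (normc2 c0 * Dr n).
  have xN := xr_N0 nd.
  have cN : normc2 c0 != 0 by rewrite gt_eqF ?normc2_c0.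
  apply: (mulIf xN); rewrite dW.
  have -> : - Dr n.+1 / (normc2 c0 * Dr n) * xr n.+1 =
    - (Dr n.+1 * xr n.+1) / (normc2 c0 * Dr n) by ring.
  by rewrite e; field; rewrite Dn cN.
by field; rewrite Dn Dn1 gt_eqF ?normc2_c0.
Qed.

Lemma col_sqr_gt0 (y : 'cV[R]_2) : y != 0 -> 0 < (y^T *m y) 0 0.
Proof.
move=> yN; rewrite mulmx2E !mxE.
rewrite -!expr2 lt_def addr_ge0 ?sqr_ge0 // andbT paddr_eq0 ?sqr_ge0 //.
rewrite !sqrf_eq0; apply: contra yN => /andP[/eqP y0 /eqP y1].
by apply/eqP/col2P; rewrite mxE.
Qed.

Lemma gram_posdef (a : R) (W : 'M[R]_2) : 0 < a -> W \in unitmx -> posdef (a *: (W^T *m W)).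
Proof.
move=> a0 Wu; split; first by rewrite linearZ /= trmx_mul trmxK.
move=> x x0.
have -> : x^T *m (a *: (W^T *m W)) *m x = a *: ((W *m x)^T *m (W *m x)).
  by rewrite -scalemxAr -scalemxAl trmx_mul !mulmxA.
rewrite mxE mulr_gt0 // col_sqr_gt0 //.
by apply: contra x0 => /eqP y0; rewrite -[x](mulKmx Wu) y0 mulmx0.
Qed.

Lemma Htilde_posdef n : (1 <= n <= d)%N -> posdef (Htilde n).
Proof.
move=> /andP[n1 nd]; apply: gram_posdef; last exact: Wmx_unit.
by rewrite mulr_gt0 ?normc2_c0 // exprn_even_gt0 //= Dr_N0 //; lia.
Qed.

Lemma possemidef_Hmx_gt0 n : (1 <= n <= d)%N -> possemidef (Hmx n) -> 0 < Dr n.-1 * Dr n.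
Proof.
move=> nd [_ h]; rewrite Hmx_Htilde // in h.
have [_ p] := Htilde_posdef nd.
have x0 : (col2 1 0 : 'cV[R]_2) != 0.
  by apply/eqP => /matrixP/(_ 0 0); rewrite !mxE /= => /eqP; rewrite oner_eq0.
have := h (col2 1 0); rewrite -scalemxAr -scalemxAl mxE pmulr_lge0 ?p //.
by rewrite invr_ge0 le_eqVlt eq_sym mulf_eq0 !(negbTE (Dr_N0 _)) //; lia.
Qed.

Lemma posdef_Hmx n : (1 <= n <= d)%N -> 0 < Dr n.-1 * Dr n -> posdef (Hmx n).
Proof.
move=> nd h; rewrite Hmx_Htilde // /Htilde scalerA; apply: gram_posdef; last by apply: Wmx_unit; lia.
by rewrite mulr_gt0 ?invr_gt0 // mulr_gt0 ?normc2_c0 // exprn_even_gt0 //= Dr_N0 //; lia.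
Qed.

End ZandH.

(** * Exponential polynomials *)

Section Exponentials.
Local Notation "z ^*" := (conjc z) : ring_scope.
Variable R : realType.
Implicit Types (a b t : R) (z w : R[i]).

Lemma cexpD z w : cexp (z + w) = cexp z * cexp w.
Proof.
case: z w => [x y] [x' y']; apply/eqP; rewrite eq_complex /cexp /= expRD cosD sinD.
by apply/andP; split; apply/eqP; ring.
Qed.

Lemma cexp0 : cexp (0 : R[i]) = 1.
Proof. by rewrite /cexp /= expR0 cos0 sin0 mul1r. Qed.

Lemma expiD a b z : expi (a + b) z = expi a z * expi b z.
Proof. by rewrite /expi rmorphD mulrDr mulrDl cexpD. Qed.

Lemma expi0 z : expi 0 z = 1.
Proof. by rewrite /expi rmorph0 mulr0 mul0r cexp0. Qed.

Lemma expiz0 a : expi a 0 = 1.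
Proof. by rewrite /expi mulr0 cexp0. Qed.

Lemma expiNl a z : expi (- a) z * expi a z = 1.
Proof. by rewrite -expiD addNr expi0. Qed.

Lemma expi_N0 a z : expi a z != 0.
Proof. by apply/eqP => e; have := expiNl a z; rewrite e mulr0 => /eqP; rewrite eq_sym oner_eq0. Qed.

Lemma expiN a z : expi (- a) z = (expi a z)^-1.
Proof. by apply: (mulIf (expi_N0 a z)); rewrite expiNl mulVf ?expi_N0. Qed.

Lemma expiB a b z : expi (a - b) z = expi a z / expi b z.
Proof. by rewrite expiD expiN. Qed.

Lemma expiX a n z : expi a z ^+ n = expi (a * n%:R) z.
Proof.
elim: n => [|n IH]; first by rewrite mulr0 expi0.
by rewrite exprS IH -expiD -natr1 mulrDr mulr1 addrC.
Qed.

Lemma expiE a (x y : R) :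
  expi a (x +i* y) = (expR (- (a * y)))%:C * (cos (a * x) +i* sin (a * x)).
Proof.
rewrite /expi /cexp /=.
have -> : 0 * a - 1 * 0 = 0 by ring.
have -> : 0 * 0 + 1 * a = a by ring.
by rewrite !mul0r sub0r add0r.
Qed.

Lemma sharp_expi a z : (expi a z^*)^* = expi (- a) z.
Proof.
case: z => x y; rewrite [(x +i* y)^*]/= !expiE mulNr mulrN mulNr cosN sinN.
by rewrite conjcM conjc_real.
Qed.

End Exponentials.

Section Deriv.
Variable R : realType.
Implicit Types (f g : R -> R[i]) (t : R).

Lemma is_cderiveD f g t df dg : is_cderive f t df -> is_cderive g t dg ->
  is_cderive (fun t => f t + g t) t (df + dg).
Proof.
move=> [f1 f2] [g1 g2]; case: df f1 f2 => a b f1 f2; case: dg g1 g2 => a' b' g1 g2.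
split => /=.
  rewrite (_ : (fun t => _) = (fun t => complex.Re (f t)) \+ (fun t => complex.Re (g t))).
    exact: is_deriveD.
  by apply/funext => u /=; case: (f u) (g u) => ? ? [].
rewrite (_ : (fun t => _) = (fun t => complex.Im (f t)) \+ (fun t => complex.Im (g t))).
  exact: is_deriveD.
by apply/funext => u /=; case: (f u) (g u) => ? ? [].
Qed.

Lemma is_cderiveZ f t df (k : R[i]) : is_cderive f t df ->
  is_cderive (fun t => k * f t) t (k * df).
Proof.
case: k df => a b [u v] [/= f1 f2]; split => /=.
  rewrite (_ : (fun t => _) = (a \*: (fun t => complex.Re (f t))) \- (b \*: (fun t => complex.Im (f t)))).
    exact: is_deriveB.
  by apply/funext => s /=; case: (f s).
rewrite (_ : (fun t => _) = (a \*: (fun t => complex.Im (f t))) \+ (b \*: (fun t => complex.Re (f t)))).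
  exact: is_deriveD.
by apply/funext => s /=; case: (f s).
Qed.

Lemma is_cderive_expi (b k : R) z t :
  is_cderive (fun t => expi (b + k * t) z) t ('i * k%:C * z * expi (b + k * t) z).
Proof.
case: z => x y.
have Ef s : expi (b + k * s) (x +i* y) =
   (expR (- ((b + k * s) * y)))%:C * (cos ((b + k * s) * x) +i* sin ((b + k * s) * x)).
  exact: expiE.
have dl (w : R) : is_derive t 1 (fun s => (b + k * s) * w) (k * w).
  rewrite (_ : (fun s => _) = (fun s : R => w *: (b + k * s))); last first.
    by apply/funext => s; rewrite mulrC.
  rewrite mulrC; apply: is_deriveZ.
  rewrite -[X in is_derive _ _ _ X]add0r; apply: is_deriveD.
  rewrite -[X in is_derive _ _ _ X]mulr1; apply: is_deriveZ.
have dE := is_derive1_comp (is_derive_expR _) (is_deriveN (dl y)).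
have dC := is_derive1_comp (is_derive_cos _) (dl x).
have dS := is_derive1_comp (is_derive_sin _) (dl x).
have d1 := is_deriveM dE dC.
have d2 := is_deriveM dE dS.
rewrite Ef (funext Ef); split => /=.
  rewrite (_ : (fun s => _) = fun s => expR (- ((b + k * s) * y)) * cos ((b + k * s) * x)); last first.
    by apply/funext => s; rewrite mul0r subr0.
  by apply: is_derive_eq d1 _; rewrite /GRing.scale /=; ring.
rewrite (_ : (fun s => _) = fun s => expR (- ((b + k * s) * y)) * sin ((b + k * s) * x)); last first.
  by apply/funext => s; rewrite mul0r addr0.
by apply: is_derive_eq d2 _; rewrite /GRing.scale /=; ring.
Qed.

End Deriv.

Section ExpPol.
Variables (R : realType) (d : nat).
Local Notation L := (Lpar R d).
Local Notation r := ((rpar d)%:R : R).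
Implicit Types (f g : {poly R[i]}) (t : R) (z : R[i]).

Definition qz z : R[i] := expi r z.

Definition exp_poly f z : R[i] := expi (- L) z * f.[qz z].

Lemma two_Lpar : 2 * L = r * d%:R.
Proof.
rewrite /Lpar /rpar; case: ifP => _ //.
by rewrite mul1r mulrC divfK // pnatr_eq0.
Qed.

Lemma expi_L_qz m z : expi L z * qz z ^+ m = expi (- L) z * qz z ^+ (d + m).
Proof.
rewrite /qz !expiX -expiD -(expiD (- L)); congr (expi _ z).
rewrite natrD mulrDr -two_Lpar.
by ring.
Qed.

Lemma exp_polyZ (a : R[i]) f z : exp_poly (a *: f) z = a * exp_poly f z.
Proof. by rewrite /exp_poly hornerZ mulrCA. Qed.

Lemma exp_polyB f g z : exp_poly (f - g) z = exp_poly f z - exp_poly g z.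
Proof. by rewrite /exp_poly hornerD hornerN mulrBr. Qed.

Lemma exp_poly_sum n f z : (size f <= n)%N ->
  exp_poly f z = \sum_(m < n) f`_m * expi (r * m%:R - L) z.
Proof.
move=> sf; rewrite /exp_poly (horner_coef_wide _ sf) mulr_sumr; apply: eq_bigr => m _.
by rewrite /qz expiX addrC expiD mulrCA.
Qed.

(** The operation [#] sends the exponent [-L + rm] to [L - rm] and conjugates the
    coefficients; a reversal at degree [d + n] instead of [d] shifts the exponents
    by [rn]. *)
Lemma sharp_exp_poly n f z : (size f <= (d + n).+1)%N ->
  sharp (exp_poly f) z = expi (- (r * n%:R)) z * exp_poly (revp (d + n) f) z.
Proof.
move=> sf; rewrite /sharp (exp_poly_sum _ sf) (exp_poly_sum _ (size_revp _ _)) conjc_sum mulr_sumr.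
rewrite [RHS](reindex_inj rev_ord_inj) /=; apply: eq_bigr => m _.
have md : (m <= d + n)%N by rewrite -ltnS.
rewrite conjcM sharp_expi coef_revp subSS leq_subr subKn // [RHS]mulrCA -expiD; congr (_ * expi _ z).
rewrite natrB // natrD mulrBr mulrDr -two_Lpar; ring.
Qed.

Lemma sharp_exp_poly0 f z : (size f <= d.+1)%N -> sharp (exp_poly f) z = exp_poly (revp d f) z.
Proof.
move=> sf; have := @sharp_exp_poly 0 f z; rewrite addn0 => ->//.
by rewrite mulr0 oppr0 expi0 mul1r.
Qed.

Lemma Eexp_exp_poly (c : 'I_d.+1 -> R[i]) z : Eexp c z = exp_poly (ppol c) z.
Proof.
rewrite (exp_poly_sum _ (size_ppol c)) (reindex_inj rev_ord_inj) /Eexp; apply: eq_bigr => j _ /=.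
have jd : (j <= d)%N by rewrite -ltnS.
rewrite coef_ppol subSS leq_subr subKn // inord_val; congr (_ * expi _ z).
rewrite /freq natrB // natrM mulrBr -two_Lpar; ring.
Qed.

Definition Af f t z := 2^-1 * (expi (- t) z * exp_poly f z + expi t z * sharp (exp_poly f) z).
Definition Bf f t z := 'i / 2 * (expi (- t) z * exp_poly f z - expi t z * sharp (exp_poly f) z).
(** The pair [(G + G^#) / 2], [i (G - G^#) / 2] for
    [G(z) = e^{-itz} exp_poly f z].  For [t = 0] and [f = p] this is
    [(A_C, B_C)]. *)
Definition Kf f t z : 'cV[R[i]]_2 := col2 (Af f t z) (Bf f t z).

Lemma col2_pm (a b : R[i]) : col2 (2^-1 * (a + b)) ('i / 2 * (a - b)) =
  (2^-1 * a) *: col2 1 'i + (2^-1 * b) *: col2 1 (- 'i).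
Proof. by apply: col2P; rewrite [RHS]mxE !mxE /=; ring. Qed.

Lemma KfE f t z : Kf f t z =
  (2^-1 * (expi (- t) z * exp_poly f z)) *: col2 1 'i +
  (2^-1 * (expi t z * sharp (exp_poly f) z)) *: col2 1 (- 'i).
Proof. exact: col2_pm. Qed.

(** At [t = rn/2] the factors [e^{-itz}] and [e^{itz}], together with the shift
    in [sharp_exp_poly], agree.  What remains is linear in [f] and its reversal at
    degree [d + n], the two polynomials that the Szego step combines. *)
Lemma Kf_joint n f z : (size f <= (d + n).+1)%N ->
  Kf f (r * n%:R / 2) z = (2^-1 * expi (- (r * n%:R / 2)) z) *:
    (exp_poly f z *: col2 1 'i + exp_poly (revp (d + n) f) z *: col2 1 (- 'i)).
Proof.
move=> sf; rewrite KfE (sharp_exp_poly _ sf) (mulrA (expi _ z) (expi _ z)) -expiD.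
have -> : r * n%:R / 2 - r * n%:R = - (r * n%:R / 2) by field.
by rewrite scalerDr !scalerA !mulrA.
Qed.

Lemma Kf_deriv f t z :
  is_cderive (Af f ^~ z) t (- (z * Bf f t z)) /\ is_cderive (Bf f ^~ z) t (z * Af f t z).
Proof.
have d1 : is_cderive (fun t => exp_poly f z * expi (- t) z) t (- 'i * z * (exp_poly f z * expi (- t) z)).
  have := is_cderiveZ (exp_poly f z) (is_cderive_expi 0 (-1) z t).
  under eq_fun do rewrite add0r mulN1r.
  by rewrite add0r mulN1r rmorphN1 mulrN1 mulrCA.
have d2 : is_cderive (fun t => sharp (exp_poly f) z * expi t z) t ('i * z * (sharp (exp_poly f) z * expi t z)).
  have := is_cderiveZ (sharp (exp_poly f) z) (is_cderive_expi 0 1 z t).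
  under eq_fun do rewrite add0r mul1r.
  by rewrite add0r mul1r rmorph1 mulr1 mulrCA.
have ii : 'i * 'i = -1 :> R[i] by rewrite -expr2 sqr_i.
split.
  have := is_cderiveZ 2^-1 (is_cderiveD d1 d2).
  under eq_fun do rewrite (mulrC (exp_poly f z)) (mulrC (sharp (exp_poly f) z)).
  by congr is_cderive; rewrite /Bf; ring.
have := is_cderiveZ ('i / 2) (is_cderiveD d1 (is_cderiveZ (-1) d2)).
under eq_fun do rewrite (mulrC (exp_poly f z)) (mulrC (sharp (exp_poly f) z)) mulN1r.
congr is_cderive; rewrite /Af.
transitivity (- ('i * 'i) / 2 * (z * (exp_poly f z * expi (- t) z + sharp (exp_poly f) z * expi t z))); first by ring.
by rewrite ii; ring.
Qed.

End ExpPol.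

Section Solution.
Local Notation "z ^*" := (conjc z) : ring_scope.
Variables (R : realType) (d : nat) (c : 'I_d.+1 -> R[i]).
Local Notation c0 := (c0 c).
Local Notation r := ((rpar d)%:R : R).
Hypothesis c0N0 : c0 != 0.
Hypothesis DN0 : forall n, (1 <= n <= d)%N -> Ddet c n != 0.

Let good n : (n <= d)%N -> ngood c n.
Proof. by move=> nd; apply: ngood_det => // k kn; apply: DN0; lia. Qed.

Lemma size_fn n : (n <= d)%N -> (size (fn c n) <= d.+1)%N.
Proof.
move=> nd; have [_ _ hi] := fn_coef c0N0 nd (good nd).
by apply/leq_sizeP => i; apply: hi.
Qed.

Lemma cmxM m n p (A : 'M[R]_(m, n)) (B : 'M[R]_(n, p)) : cmx (A *m B) = cmx A *m cmx B.
Proof. exact: map_mxM. Qed.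

Lemma cmxZ m n (a : R) (A : 'M[R]_(m, n)) : cmx (a *: A) = a%:C *: cmx A.
Proof. exact: map_mxZ. Qed.

(** In the basis [(1, i), (1, -i)], the matrix [S_n] is the one by which the
    Szego step acts on a polynomial and its reversal. *)
Lemma Smx_pm n : (n < d)%N ->
  cmx (Smx c n) *m col2 1 'i = col2 1 'i - (gn c n)^* *: col2 1 (- 'i) /\
  cmx (Smx c n) *m col2 1 (- 'i) = col2 1 (- 'i) - gn c n *: col2 1 'i.
Proof.
move=> nd; rewrite /Smx; case: (gn c n) => a b.
split; apply: col2P; rewrite mulmx2E !mxE /=; apply/eqP; rewrite eq_complex /=;
  apply/andP; split; apply/eqP; ring.
Qed.

Lemma Kf_step n z : (n < d)%N ->
  Kf d (fn c n.+1) (r * n%:R / 2) z =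
  cmx ((rn c n)^-1 *: Smx c n) *m Kf d (fn c n) (r * n%:R / 2) z.
Proof.
move=> nd; have sz k : (k <= d)%N -> (size (fn c k) <= (d + n).+1)%N.
  by move=> kd; apply: leq_trans (size_fn kd) _; rewrite ltnS leq_addr.
rewrite !Kf_joint ?sz //; last exact: ltnW.
have [s1 s2] := Smx_pm nd.
rewrite fnS revpZ revpB revpZ revpK ?sz 1?ltnW // kn_real // conjc_real.
rewrite !exp_polyZ !exp_polyB !exp_polyZ cmxZ -scalemxAl -!scalemxAr mulmxDr -!scalemxAr s1 s2.
move: (exp_poly _ _ _) (exp_poly _ _ _) (gn c n) (_%:C) (expi _ _) => E F g k e.
by apply: col2P; rewrite !mxE /=; ring.
Qed.

(** Half the adjugate of [W_n], by [det_Wmx]. *)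
Definition Umx n : 'M[R]_2 := (xr c n)^-1 *: invmx (Wmx c n).

Definition Uf n t z : 'cV[R[i]]_2 := cmx (Umx n) *m Kf d (fn c n) t z.

Lemma Smx_unit n : (n < d)%N -> Smx c n \in unitmx.
Proof. by move=> nd; rewrite unitmxE unitfE det_Smx rn_N0. Qed.

Lemma UmxS n : (n < d)%N -> Umx n.+1 *m ((rn c n)^-1 *: Smx c n) = Umx n.
Proof.
move=> nd; have rN := rn_N0 c0N0 DN0 nd; have xN := xr_N0 c0N0 DN0 (ltnW nd).
have Wu := Wmx_unit c0N0 DN0 (ltnW nd).
have Wu' := Wmx_unit c0N0 DN0 nd.
rewrite /Umx xrS -scalemxAr -scalemxAl scalerA.
have -> : (rn c n)^-1 * ((rn c n)^-1 * xr c n)^-1 = (xr c n)^-1 by field; rewrite rN xN.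
congr (_ *: _); rewrite -[RHS](mulKmx Wu'); congr (_ *m _).
by rewrite /= -mulmxA mulmxV // mulmx1.
Qed.

Lemma Uf_joint n z : (n < d)%N -> Uf n.+1 (r * n%:R / 2) z = Uf n (r * n%:R / 2) z.
Proof. by move=> nd; rewrite /Uf Kf_step // mulmxA -cmxM UmxS. Qed.

Lemma Uf0 z : Uf 0 0 z = col2 (Aexp c z) (Bexp c z).
Proof.
rewrite /Uf /Umx /= invmx1 cmxZ -scalemxAl /cmx map_mx1 mul1mx.
have -> : fn c 0 = 2 *: ppol c by rewrite fnE /xpol /ypol /= mulr0 addr0 mulrC mul_polyC.
have -> : (xr c 0)^-1%:C = 2^-1.
  by rewrite /xr /xpol /= coefC /= fmorphV rmorphD rmorph1.
rewrite /Kf /Af /Bf /Aexp /Bexp oppr0 !expi0 /sharp exp_polyZ exp_polyZ -!Eexp_exp_poly conjcM conjc_nat.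
by apply: col2P; rewrite !mxE /=; field.
Qed.

(** Through [U_n] the system with the matrix [H_n] becomes the system with
    constant coefficients that is solved by every [Kf]. *)
Lemma JHU n : (n <= d)%N ->
  Jmx R[i] *m cmx (Hmx c n) *m cmx (Umx n) = - (cmx (Umx n) *m Jmx R[i]).
Proof.
move=> nd; have Wu := Wmx_unit c0N0 DN0 nd.
have e : Jmx R *m Hmx c n *m Umx n = - (Umx n *m Jmx R).
  rewrite /Umx -scalemxAr -scalemxAl -scalerN; congr (_ *: _).
  apply: (can_inj (mulKmx Wu)); rewrite mulmxN !mulmxA Hmx_spec // mulmxV // mul1mx.
  by rewrite mulmxK // mulNmx.
have JE : Jmx R[i] = cmx (Jmx R).
  by apply: mx2P; rewrite !mxE /= ?rmorph0 ?rmorph1 ?rmorphN1.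
by rewrite JE -!cmxM e /cmx map_mxN.
Qed.

Lemma Uf_ode n t z : (n <= d)%N ->
  - (z *: (cmx (Umx n) *m (col2 (- Bf d (fn c n) t z) (Af d (fn c n) t z)))) =
  z *: (Jmx R[i] *m cmx (Hmx c n) *m Uf n t z).
Proof.
move=> nd; rewrite /Uf !mulmxA JHU //.
rewrite mulNmx scalerN; congr (- (_ *: _)); rewrite -mulmxA; congr (_ *m _).
by apply: col2P; rewrite mulmx2E !mxE /=; ring.
Qed.

End Solution.

(** * The coefficients [a_n], [b_n] *)

Section Coefficients.
Local Notation "z ^*" := (conjc z) : ring_scope.
Variables (R : realType) (d : nat) (c : 'I_d.+1 -> R[i]).
Local Notation c0 := (c0 c).
Local Notation L := (Lpar R d).
Local Notation r := ((rpar d)%:R : R).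
Hypothesis c0N0 : c0 != 0.
Hypothesis DN0 : forall n, (1 <= n <= d)%N -> Ddet c n != 0.

Let good n : (n <= d)%N -> ngood c n.
Proof. by move=> nd; apply: ngood_det => // k kn; apply: DN0; lia. Qed.

Local Notation vp := (col2 1 'i : 'cV[R[i]]_2).
Local Notation vm := (col2 1 (- 'i) : 'cV[R[i]]_2).

Lemma Umx_pm_step n (E F : R[i]) : (n < d)%N ->
  cmx (Umx c n.+1) *m ((kn c n * (E - gn c n * F)) *: vp +
                     (kn c n * (F - (gn c n)^* * E)) *: vm) =
  cmx (Umx c n) *m (E *: vp + F *: vm).
Proof.
move=> nd; rewrite -(UmxS c0N0 DN0 nd) cmxM -mulmxA; congr (_ *m _).
have [s1 s2] := Smx_pm c nd.
rewrite cmxZ -scalemxAl mulmxDr -!scalemxAr s1 s2 kn_real.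
move: (gn c n) (_%:C) vp vm => g k v w.
by apply/matrixP => i j; rewrite !mxE; ring.
Qed.

(** At [z = 0] the pieces do not depend on [t], and they agree at the
    joints. *)
Lemma Uf_at0 n t : (n <= d)%N -> Uf c n t 0 = col2 (Aexp c 0) (Bexp c 0).
Proof.
have indep k s s' : Uf c k s 0 = Uf c k s' 0 by rewrite /Uf /Kf /Af /Bf !expiz0.
elim: n t => [|n IH] t nd; first by rewrite (indep _ t 0) Uf0.
by rewrite (indep _ _ (r * n%:R / 2)) Uf_joint // IH // ltnW.
Qed.

Lemma fn_end : fn c d = (2 * c0) *: 'X^d.
Proof.
have [lo top hi] := fn_coef c0N0 (leqnn d) (good (leqnn d)).
apply/polyP => i; rewrite coefZ coefXn.
by case: (ltngtP i d) => [id|id|->]; [rewrite lo ?mulr0|rewrite hi ?mulr0|rewrite top mulr1].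
Qed.

(** As [f_d] is a monomial, the factors [e^{iLz}] and [e^{-iLz}] cancel. *)
Lemma Kf_end z : Kf d (fn c d) L z = c0 *: vp + c0^* *: vm.
Proof.
have e : exp_poly d (fn c d) z = 2 * c0 * expi L z.
  rewrite /exp_poly fn_end hornerZ hornerXn mulrCA; congr (_ * _).
  by have := expi_L_qz d 0 z; rewrite addn0 expr0 mulr1 => ->.
have e' : sharp (exp_poly d (fn c d)) z = 2 * c0^* * expi (- L) z.
  rewrite /sharp /exp_poly fn_end hornerZ hornerXn conjcM sharp_expi opprK.
  rewrite conjcM conjcM conjc_nat conjcX sharp_expi mulrCA; congr (_ * _).
  rewrite expiX -expiD; congr (expi _ z); rewrite mulNr -two_Lpar; ring.
have h1 w : expi (- L) z * (w * expi L z) = w by rewrite mulrCA expiNl mulr1.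
have h2 w : expi L z * (w * expi (- L) z) = w.
  by rewrite mulrCA [expi L z * _]mulrC expiNl mulr1.
rewrite KfE e e' h1 h2.
by congr (_ *: _ + _ *: _); field.
Qed.

Lemma Uf_end z : Uf c d L z = col2 (Aexp c 0) (Bexp c 0).
Proof. by rewrite -(Uf_at0 L (leqnn d)) /Uf !Kf_end. Qed.

(** By [JHU] the matrix [I - i J H_n] acts as [I + i J] on the right of [U_n], and
    the latter is twice the projection onto [(1, i)] along [(1, -i)]. *)
Lemma Qmx_pm n (a b : R[i]) : (n <= d)%N ->
  (1%:M - 'i *: (Jmx R[i] *m cmx (Hmx c n))) *m (cmx (Umx c n) *m (a *: vp + b *: vm))
  = (2 * a) *: (cmx (Umx c n) *m vp).
Proof.
move=> nd.
have -> : (1%:M - 'i *: (Jmx R[i] *m cmx (Hmx c n))) *m (cmx (Umx c n) *m (a *: vp + b *: vm))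
  = cmx (Umx c n) *m ((1%:M + 'i *: Jmx R[i]) *m (a *: vp + b *: vm)).
  move: (a *: vp + b *: vm) => Y; rewrite mulmxBl mulmxDl mulmxDr !mul1mx; congr (_ + _).
  by rewrite -!scalemxAl !mulmxA JHU // mulNmx scalerN opprK -!mulmxA scalemxAr.
rewrite scalemxAr; congr (_ *m _).
by apply: col2P; rewrite mulmx2E !mxE /=; apply/eqP; rewrite eq_complex; case: a b => ? ? [? ?] /=;
  apply/andP; split; apply/eqP; ring.
Qed.

(** The coefficient of [e^{i(L-rj-t)z}] in twice the [n]th piece. *)
Definition abn n j : 'cV[R[i]]_2 := (fn c n)`_(d - j) *: (cmx (Umx c n) *m vp).

Lemma conj_cmx_mul (M : 'M[R]_2) (v : 'cV[R[i]]_2) :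
  map_mx (fun x => x^*) (cmx M *m v) = cmx M *m map_mx (fun x => x^*) v.
Proof. by apply: col2P; rewrite [LHS]mxE !mulmx2E conjcD !conjcM !mxE !conjc_real. Qed.

Lemma conj_abn n j : map_mx (fun x => x^*) (abn n j) =
  ((fn c n)`_(d - j))^* *: (cmx (Umx c n) *m vm).
Proof.
have -> : vm = map_mx (fun x => x^*) vp.
  by apply: col2P; rewrite !mxE /= ?conjc1 //; apply/eqP; rewrite eq_complex /= oppr0 !eqxx.
by rewrite -conj_cmx_mul; apply/matrixP => i k; rewrite !mxE conjcM.
Qed.

Lemma abcoefS (H : nat -> 'M[R]_2) v m j : abcoef d H v m.+1 j =
  if (j <= m.+1)%N then 2^-1 *: ((1%:M - 'i *: (Jmx R[i] *m cmx (H (d - m.+1)%N))) *m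
    (abcoef d H v m j + map_mx (fun x => x^*) (abcoef d H v m (m.+1 - j)))) else 0.
Proof. by []. Qed.

(** Descending induction on [n].  By [Umx_pm_step], the vector [U_n] applied to
    the pair of coefficients of [f_n] and of its reversal equals [U_{n+1}] applied
    to the pair for [f_{n+1}]; by [Qmx_pm], the factor [I - i J H_n] selects the
    part belonging to [f_n]. *)
Lemma abcoef_abn (H : nat -> 'M[R]_2) m j : (m < d)%N ->
  (forall n, (1 <= n <= d)%N -> H n = Hmx c n) ->
  abcoef d H (col2 (Aexp c 0) (Bexp c 0)) m j = if (j <= m)%N then abn (d - m) j else 0.
Proof.
move=> + HE; elim: m j => [|m IH] j md.
  rewrite /= leqn0; case: eqP => // ->; rewrite HE; last by lia.
  rewrite -(Uf_end 0) {1}/Uf (Kf_end 0) (Qmx_pm _ _ (leqnn d)) /abn subn0; congr (_ *: _).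
  by have [] := fn_coef c0N0 (leqnn d) (good (leqnn d)).
rewrite abcoefS; case: leqP => [jm|_]; last by [].
rewrite HE; last by lia.
rewrite !IH; try lia.
set n := (d - m.+1)%N.
have nd : (n < d)%N by lia.
have [lo' top' hi'] := fn_coef c0N0 nd (good nd).
have dm : (d - m = n.+1)%N by lia.
have -> : (if (j <= m)%N then abn (d - m) j else 0) = abn n.+1 j.
  by rewrite dm; case: leqP => // mj; rewrite /abn lo' ?scale0r //; lia.
have -> : (if (m.+1 - j <= m)%N then abn (d - m) (m.+1 - j) else 0) = abn n.+1 (m.+1 - j).
  by rewrite dm; case: leqP => // mj; rewrite /abn lo' ?scale0r //; lia.
rewrite conj_abn {1}/abn.
have e1 : (fn c n.+1)`_(d - j) = kn c n * ((fn c n)`_(d - j) - gn c n * (revp (d + n) (fn c n))`_(d - j)).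
  by rewrite fnS coefZ coefB (coefZ (gn c n)).
have e2 : ((fn c n.+1)`_(d - (m.+1 - j)))^* =
    kn c n * ((revp (d + n) (fn c n))`_(d - j) - (gn c n)^* * (fn c n)`_(d - j)).
  have -> : (d - (m.+1 - j) = d + n - (d - j))%N by lia.
  have -> : ((fn c n.+1)`_(d + n - (d - j)))^* = (revp (d + n) (fn c n.+1))`_(d - j).
    by rewrite coef_revp ifT //; lia.
  rewrite fnS revpZ revpB revpZ kn_real // conjc_real revpK.
    by rewrite coefZ coefB (coefZ (gn c n)^*).
  by rewrite (leq_trans (size_fn c0N0 DN0 (ltnW nd))) // ltnS leq_addr.
have key (M : 'M[R[i]]_2) x y : x *: (M *m vp) + y *: (M *m vm) = M *m (x *: vp + y *: vm).
  by rewrite mulmxDr -!scalemxAr.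
rewrite e1 e2 key (Umx_pm_step ((fn c n)`_(d - j)) ((revp (d + n) (fn c n))`_(d - j)) nd).
rewrite Qmx_pm; last by lia.
by rewrite scalerA mulrA mulVf ?pnatr_eq0 // mul1r.
Qed.

Lemma exp_poly_fn n z : (n <= d)%N ->
  exp_poly d (fn c n) z = \sum_(j < (d - n).+1) (fn c n)`_(d - j) * expi (freq R d j) z.
Proof.
move=> nd; have [lo _ _] := fn_coef c0N0 nd (good nd).
rewrite (exp_poly_sum _ _ (size_fn c0N0 DN0 nd)) (reindex_inj rev_ord_inj) /=.
rewrite [RHS](big_ord_widen d.+1 (fun j => (fn c n)`_(d - j) * expi (freq R d j) z)); last by lia.
rewrite [RHS]big_mkcond /=; apply: eq_bigr => j _; rewrite subSS.
have jd : (j <= d)%N by rewrite -ltnS.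
case: ltnP => jn; last by rewrite lo ?mul0r //; lia.
congr (_ * expi _ z); rewrite /freq natrB // natrM mulrBr -two_Lpar; ring.
Qed.

Lemma Uf_formula (H : nat -> 'M[R]_2) n t z :
  (1 <= n <= d)%N -> (forall n, (1 <= n <= d)%N -> H n = Hmx c n) ->
  let ab j := abcoef d H (col2 (Aexp c 0) (Bexp c 0)) (d - n) j in
  forall i, Uf c n t z i 0 = 2^-1 * \sum_(j < (d - n).+1)
     (ab j i 0 * expi (freq R d j - t) z + (ab j i 0)^* * expi (- (freq R d j - t)) z).
Proof.
move=> nd HE ab i; have nd' : (n <= d)%N by lia.
have abE j : (j <= d - n)%N -> ab j = abn n j.
  move=> jn; have dd : (d - n < d)%N by lia.
  by rewrite /ab (abcoef_abn j dd HE) jn (subKn nd').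
have abE' j : (j <= d - n)%N -> (ab j i 0)^* =
    ((fn c n)`_(d - j))^* * (cmx (Umx c n) *m vm) i 0.
  move=> jn; rewrite abE //; have /matrixP/(_ i 0) e := conj_abn n j.
  by rewrite [LHS]mxE [RHS]mxE in e.
have addE (A B : 'cV[R[i]]_2) : (A + B) i 0 = A i 0 + B i 0 by rewrite mxE.
have scaleE a (A : 'cV[R[i]]_2) : (a *: A) i 0 = a * A i 0 by rewrite mxE.
rewrite /Uf KfE mulmxDr -!scalemxAr addE !scaleE.
rewrite /sharp !exp_poly_fn // conjc_sum !mulr_sumr !mulr_suml -big_split /=.
apply: eq_bigr => j _; have jn : (j <= d - n)%N by rewrite -ltnS.
have e1 : expi (freq R d j - t) z = expi (freq R d j) z * expi (- t) z := expiD _ _ _.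
have e2 : expi (- (freq R d j - t)) z = expi (- freq R d j) z * expi t z.
  by rewrite opprB addrC expiD.
rewrite abE' // abE // /abn scaleE conjcM sharp_expi e1 e2.
ring.
Qed.

End Coefficients.

(** * The Taylor expansion behind [Theta] *)

Section Norm.
Variable R : realType.
Implicit Types z w : R[i].

(** The modulus as an element of [R], whereas the norm of [R[i]] has its values
    in [R[i]]. *)
Definition nm z : R := ComplexField.Normc.normc z.

Lemma nmM z w : nm (z * w) = nm z * nm w.
Proof. exact: ComplexField.Normc.normcM. Qed.

Lemma nmD z w : nm (z + w) <= nm z + nm w.
Proof. exact: le_normcD. Qed.

Lemma nmN z : nm (- z) = nm z.
Proof. exact: normcN. Qed.

Lemma nm0 : nm 0 = 0. Proof. exact: ComplexField.Normc.normc0. Qed.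
Lemma nm1 : nm 1 = 1. Proof. exact: ComplexField.Normc.normc1. Qed.

Lemma nm_ge0 z : 0 <= nm z.
Proof. by case: z => a b; rewrite /nm /= sqrtr_ge0. Qed.

Lemma nm_sqr z : normc2 z = nm z ^+ 2.
Proof. by case: z => a b; rewrite /nm /= sqr_sqrtr // addr_ge0 ?sqr_ge0. Qed.

Lemma nm_eq0 z : (nm z == 0) = (z == 0).
Proof.
apply/eqP/eqP => [|->]; last exact: nm0.
exact: ComplexField.Normc.eq0_normc.
Qed.

Lemma nm_gt0 z : (0 < nm z) = (z != 0).
Proof. by rewrite lt_def nm_eq0 nm_ge0 andbT. Qed.

Lemma nmV z : nm z^-1 = (nm z)^-1.
Proof. exact: ComplexField.Normc.normcV. Qed.

Lemma nmX z n : nm (z ^+ n) = nm z ^+ n.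
Proof. by elim: n => [|n IH]; rewrite ?expr0 ?nm1 // !exprS nmM IH. Qed.

Lemma nm_real (a : R) : nm a%:C = `|a|.
Proof. by rewrite /nm /= expr0n /= addr0 sqrtr_sqr. Qed.

Lemma nm_conjc z : nm (conjc z) = nm z.
Proof. by case: z => a b; rewrite /nm /= sqrrN. Qed.

Lemma nm_sum I (s : seq I) (P : pred I) (F : I -> R[i]) :
  nm (\sum_(i <- s | P i) F i) <= \sum_(i <- s | P i) nm (F i).
Proof.
apply: (big_ind2 (fun x y => nm x <= y)) => //; first by rewrite nm0.
by move=> x x' y y' h h'; apply: le_trans (nmD _ _) _; apply: lerD.
Qed.

Lemma nm_expi a (x y : R) : nm (expi a (x +i* y)) = expR (- (a * y)).
Proof.
rewrite expiE nmM nm_real ger0_norm ?expR_ge0 // /nm /=.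
by rewrite cos2Dsin2 sqrtr1 mulr1.
Qed.

Lemma polar z : z != 0 -> exists x, z = (nm z)%:C * (cos x +i* sin x).
Proof.
move=> z0; have n0 : nm z != 0 by rewrite nm_eq0.
case: z z0 n0 => a b z0 n0; set n := nm _ in n0 *.
have np : 0 < n by rewrite nm_gt0.
have n2 : n ^+ 2 = a ^+ 2 + b ^+ 2 by rewrite -nm_sqr.
have ab : (a / n) ^+ 2 + (b / n) ^+ 2 = 1.
  by rewrite !expr_div_n -mulrDl -n2 divff // expf_neq0.
have a1 : -1 <= a / n <= 1.
  rewrite -ler_norml -(@ler_pXn2r _ 2) ?nnegrE // expr1n -normrX ger0_norm ?sqr_ge0 //.
  by rewrite -ab lerDl sqr_ge0.
pose x := if 0 <= b then acos (a / n) else - acos (a / n).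
have cx : cos x = a / n.
  by rewrite /x; case: ifP => _; rewrite ?cosN acosK // itv_boundlr /= !bnd_simp.
have sx : sin x = b / n.
  have sa : sin (acos (a / n)) = `|b / n|.
    by rewrite sin_acos // -{1}ab addrAC subrr add0r sqrtr_sqr.
  rewrite /x; case: ifP => b0; rewrite ?sinN sa normf_div (gtr0_norm np).
    by rewrite ger0_norm.
  by rewrite ltr0_norm ?mulNr ?opprK // ltNge b0.
exists x; apply/eqP; rewrite eq_complex /= cx sx !mul0r subr0 addr0.
by apply/andP; split; apply/eqP; field.
Qed.

End Norm.

Section PowerSeries.
Variables (R : realType) (rho : R).
Hypothesis rho_gt0 : 0 < rho.
Implicit Types (P Q : {poly R[i]}) (a b : nat -> R[i]) (q w : R[i]).

Definition psum a N : {poly R[i]} := \poly_(m < N.+1) a m.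

Definition wsummable a := exists C : R, forall N, \sum_(m < N) nm (a m) * rho ^+ m <= C.

(** [a] is the sequence of Taylor coefficients of the rational function [Q / P]
    (formally, the last clause) and its Taylor series converges absolutely and
    uniformly on the circle of radius [rho]. *)
Definition taylor P Q a :=
  [/\ wsummable a,
      exists2 e : nat -> R, e @ \oo --> 0 & forall q N, nm q = rho ->
        nm (Q.[q] / P.[q] - (psum a N).[q]) <= e N &
      forall N, exists S, P * psum a N = Q + 'X^(N.+1) * S].

Lemma wsummable_cvg0 a : wsummable a -> (fun N => nm (a N) * rho ^+ N) @ \oo --> 0.
Proof.
move=> [C aC]; apply: cvg_series_cvg_0; apply: nondecreasing_is_cvgn.
  by apply: nondecreasing_series => n _ _; rewrite mulr_ge0 ?nm_ge0 ?exprn_ge0 // ltW.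
exists C => _ [N _ <-]; rewrite /series /= big_mkord; exact: aC.
Qed.

Lemma taylor_const (k : R[i]) Q : k != 0 -> taylor k%:P Q (fun m => k^-1 * Q`_m).
Proof.
move=> k0; pose a m := k^-1 * Q`_m; rewrite -[fun m => _]/a.
have sz N : (size Q <= N)%N -> psum a N = k^-1 *: Q.
  move=> sQ; apply/polyP => i; rewrite coef_poly coefZ; case: ltnP => // iN.
  by rewrite nth_default ?mulr0 // (leq_trans sQ) // ltnW.
split.
- exists (\sum_(m < size Q) nm (a m) * rho ^+ m) => N.
  rewrite (big_ord_widen (maxn N (size Q)) (fun m => nm (a m) * rho ^+ m)) ?leq_maxl //.
  rewrite [leRHS](big_ord_widen (maxn N (size Q)) (fun m => nm (a m) * rho ^+ m)) ?leq_maxr //.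
  rewrite big_mkcond [leRHS]big_mkcond /=; apply: ler_sum => m _.
  have p : 0 <= nm (a m) * rho ^+ m by rewrite mulr_ge0 ?nm_ge0 ?exprn_ge0 // ltW.
  case: ifP => // _; case: ltnP => // h.
  by rewrite /a nth_default // mulr0 nm0 mul0r.
- pose B := \sum_(m < size Q) nm (a m) * rho ^+ m.
  exists (fun N => if (size Q <= N)%N then 0 else B).
    apply: cvg_near_cst; exists (size Q) => // N /= h; by rewrite h.
  move=> q N qr; rewrite hornerC; case: leqP => h.
    by rewrite sz // hornerZ mulrC subrr nm0.
  rewrite mulrC -hornerZ -hornerN -hornerD.
  have -> : k^-1 *: Q - psum a N = \sum_(m < size Q) (if (m <= N)%N then 0 else a m) *: 'X^m.
    rewrite -(poly_def (size Q) (fun m => if (m <= N)%N then 0 else a m)); apply/polyP => i; rewrite coefB coefZ !coef_poly ltnS.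
    case: (ltnP i (size Q)) => iQ; case: (leqP i N) => iN; rewrite /a ?subrr ?subr0 //.
    by rewrite nth_default ?mulr0.
  rewrite horner_sum; apply: le_trans (nm_sum _ _ _) _; apply: ler_sum => m _.
  rewrite hornerZ hornerXn nmM nmX qr; apply: ler_wpM2r; first by rewrite exprn_ge0 // ltW.
  by case: ifP => _; rewrite ?nm0 ?nm_ge0.
- move=> N; exists (- drop_poly N.+1 Q).
  rewrite mul_polyC; have -> : k *: psum a N = take_poly N.+1 Q.
    apply/polyP => i; rewrite coefZ coef_take_poly coef_poly.
    by case: ifP; rewrite ?mulr0 // /a mulrA mulfV ?mul1r.
  by rewrite -{2}(poly_take_drop N.+1 Q) mulrN (mulrC 'X^_) addrK.
Qed.

(** The coefficients of the product of the series [a] with [1 / (1 - w q)]. *)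
Fixpoint geom w a m : R[i] := if m is m'.+1 then a m + w * geom w a m' else a 0%N.

Lemma psum_geom w a N :
  (1 - w *: 'X) * psum (geom w a) N = psum a N - (w * geom w a N) *: 'X^(N.+1).
Proof.
apply/polyP => i; rewrite mulrBl mul1r -scalerAl !coefB !coefZ coefXM coefXn !coef_poly.
case: i => [|i] /=; first by rewrite !mulr0.
rewrite !ltnS eqSS; case: (ltngtP i N) => h; rewrite ?mulr0 ?mulr1 ?subr0 ?sub0r ?addrK //.
by rewrite h.
Qed.

Lemma taylor_step P Q a w : taylor P Q a -> nm w * rho < 1 ->
  taylor (P * (1 - w *: 'X)) Q (geom w a).
Proof.
move=> [[C aC] [e e0 eN] aP] wr; set b := geom w a; set x := nm w * rho.
have x0 : 0 <= x by rewrite mulr_ge0 ?nm_ge0 // ltW.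
have x1 : 0 < 1 - x by rewrite subr_gt0.
have sb : wsummable b.
  exists (C / (1 - x)) => N; elim: N => [|N IH].
    by rewrite big_ord0 divr_ge0 // ?(ltW x1) //; have := aC 0%N; rewrite big_ord0.
  rewrite big_ord_recl /= expr0 mulr1.
  apply: (@le_trans _ _ (\sum_(m < N.+1) nm (a m) * rho ^+ m +
      x * \sum_(m < N) nm (b m) * rho ^+ m)).
    rewrite big_ord_recl /= expr0 mulr1 -addrA lerD2l mulr_sumr -big_split /=.
    apply: ler_sum => m _; rewrite /bump /= add1n /x exprS.
    have -> : nm w * rho * (nm (b m) * rho ^+ m) = nm (w * b m) * (rho * rho ^+ m).
      by rewrite nmM; ring.
    rewrite -mulrDl ler_wpM2r ?nmD // mulr_ge0 ?exprn_ge0 // ltW //.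
  apply: le_trans (lerD (aC _) (ler_wpM2l x0 IH)) _.
  rewrite le_eqVlt; apply/orP; left; apply/eqP; field; exact: lt0r_neq0.
split=> //.
- exists (fun N => (e N + x * (nm (b N) * rho ^+ N)) / (1 - x)).
    rewrite -[X in _ --> X](mul0r ((1 - x)^-1)); apply: cvgMr_tmp.
    rewrite -[X in _ --> X](addr0 0); apply: cvgD => //.
    rewrite -[X in _ --> X](mulr0 x); apply: cvgMl_tmp.
    exact: wsummable_cvg0.
  move=> q N qr.
  have wq : nm (w * q) = x by rewrite nmM qr.
  have w1 : 1 - x <= nm (1 - w * q).
    rewrite lerBlDr -wq -{1}nm1 -{1}(subrK (w * q) 1); exact: nmD.
  have wN : 1 - w * q != 0 by rewrite -nm_gt0; apply: lt_le_trans w1.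
  have e1 : (1 - w * q) * (psum b N).[q] = (psum a N).[q] - w * b N * q ^+ N.+1.
    have := congr1 (horner^~ q) (psum_geom w a N).
    by rewrite hornerM !hornerD !hornerN !hornerZ hornerX hornerXn hornerC.
  have -> : Q.[q] / (P * (1 - w *: 'X)).[q] - (psum b N).[q] =
     (1 - w * q)^-1 * ((Q.[q] / P.[q] - (psum a N).[q]) + w * b N * q ^+ N.+1).
    apply: (mulfI wN); rewrite mulVKf // mulrBr e1 hornerM hornerD hornerN hornerZ hornerX hornerC.
    rewrite invfM; have -> : (1 - w * q) * (Q.[q] * (P.[q]^-1 * (1 - w * q)^-1)) =
      ((1 - w * q) / (1 - w * q)) * (Q.[q] * P.[q]^-1) by ring.
    by rewrite mulfV //; ring.
  rewrite nmM nmV mulrC; apply: ler_pM; rewrite ?nm_ge0 ?invr_ge0 ?nm_ge0 //.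
    apply: le_trans (nmD _ _) _; apply: lerD; first exact: eN.
    rewrite nmM nmX qr nmM exprS /x.
    by rewrite le_eqVlt; apply/orP; left; apply/eqP; ring.
  by rewrite lef_pV2 // posrE // (lt_le_trans x1).
- move=> N; have [S aS] := aP N; exists (S - (w * b N) *: P).
  rewrite -mulrA psum_geom mulrBr aS mulrBr -!scalerAr; rewrite (mulrC 'X^_ P); ring.
Qed.

(** Each linear factor is a multiple of [1 - w^-1 q] with [|w^-1| rho < 1],
    and division by it is a convolution with a geometric series. *)
Lemma taylor_prod (k : R[i]) Q (s : seq R[i]) : k != 0 ->
  (forall w, w \in s -> rho < nm w) ->
  exists a, taylor (k *: \prod_(w <- s) ('X - w%:P)) Q a.
Proof.
move=> k0; elim: s k k0 => [|w s IH] k k0 sr.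
  exists (fun m => k^-1 * Q`_m); rewrite big_nil -mul_polyC mulr1; exact: taylor_const.
have rw : rho < nm w by apply: sr; rewrite mem_head.
have wN : w != 0 by rewrite -nm_gt0 (lt_trans rho_gt0).
have [||a aP] := IH (k * - w).
- by rewrite mulf_neq0 // oppr_eq0.
- by move=> v vs; apply: sr; rewrite in_cons vs orbT.
exists (geom w^-1 a).
have -> : k *: \prod_(v <- (w :: s)) ('X - v%:P) =
    ((k * - w) *: \prod_(v <- s) ('X - v%:P)) * (1 - w^-1 *: 'X).
  rewrite big_cons -!scalerAl -scalerA; congr (_ *: _).
  rewrite mulrC scalerAr; congr (_ * _).
  by rewrite scalerBr scalerA mulNr mulfV // scaleN1r opprK addrC alg_polyC polyCN.
apply: taylor_step => //.
by rewrite nmV mulrC ltr_pdivrMr ?mul1r // nm_gt0.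
Qed.

End PowerSeries.

Section ThetaExpansion.
Variables (R : realType) (d : nat) (c : 'I_d.+1 -> R[i]) (h : R).
Local Notation r := ((rpar d)%:R : R).
Hypothesis cN0 : c ord0 * c ord_max != 0.
Hypothesis hE : forall z : R[i], h <= complex.Im z -> Eexp c z != 0.

Definition qmod : R := expR (- (r * h)).

Lemma qmod_gt0 : 0 < qmod. Proof. exact: expR_gt0. Qed.

Lemma rpar_gt0 : 0 < r.
Proof. by rewrite /rpar; case: ifP => _; rewrite ltr0n. Qed.

Lemma nm_qz x : nm (qz d (x +i* h)) = qmod.
Proof. exact: nm_expi. Qed.

Lemma ppol_qz_N0 z : h <= complex.Im z -> (ppol c).[qz d z] != 0.
Proof.
move=> hz; have := hE hz; rewrite Eexp_exp_poly /exp_poly.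
by apply: contra => /eqP ->; rewrite mulr0.
Qed.

Lemma qz_surj w : w != 0 -> nm w <= qmod -> exists2 z, h <= complex.Im z & qz d z = w.
Proof.
move=> w0 wr; have [x wE] := polar w0.
have np : 0 < nm w by rewrite nm_gt0.
exists ((x / r) +i* (- (ln (nm w)) / r)) => /=.
  rewrite mulNr lerNr ler_pdivrMr ?rpar_gt0 // mulNr mulrC -ler_expR lnK ?posrE //.
rewrite /qz expiE mulrCA mulfV ?lt0r_neq0 ?rpar_gt0 // mulr1 opprK lnK ?posrE //.
by rewrite mulrCA mulfV ?lt0r_neq0 ?rpar_gt0 // mulr1 -wE.
Qed.

(** A root in the closed disc of radius [e^{-rh}] would be [e^{irz}] for a zero
    [z] of [E] with imaginary part at least [h]. *)
Lemma ppol_root_qmod w : root (ppol c) w -> qmod < nm w.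
Proof.
move=> rw; have w0 : w != 0.
  apply/eqP => w0; move: rw; rewrite w0 /root horner_coef0 coef_ppol leq0n subn0.
  have -> : inord d = ord_max :> 'I_d.+1 by apply/val_inj; rewrite /= inordK.
  by move/eqP => e; move: cN0; rewrite e mulr0 eqxx.
rewrite ltNge; apply/negP => wr; have [z hz e] := qz_surj w0 wr.
by have := ppol_qz_N0 hz; rewrite e; move: rw; rewrite /root => ->.
Qed.

Lemma theta_exists : exists a, taylor qmod (ppol c) (qpol c) a.
Proof.
have [s sE] := closed_field_poly_normal (ppol c).
have l0 : lead_coef (ppol c) != 0.
  rewrite lead_coef_eq0; apply/eqP => p0; move: cN0.
  have := coef_ppol c d; rewrite p0 coef0 leqnn subnn => e.
  by rewrite -[c ord0]/(c0 c) -(inord0E c) -e mul0r eqxx.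
rewrite sE; apply: taylor_prod => //; first exact: qmod_gt0.
move=> w ws; apply: ppol_root_qmod.
by rewrite sE rootZ // root_prod_XsubC.
Qed.

Lemma sharp_Eexp z : sharp (Eexp c) z = exp_poly d (qpol c) z.
Proof.
rewrite (_ : Eexp c = exp_poly d (ppol c)); last by apply/funext => w; rewrite Eexp_exp_poly.
by rewrite sharp_exp_poly0 ?size_ppol.
Qed.

Lemma sharp_E0 z : sharp (E0 c) z = expi (r - 1) z * exp_poly d (qpol c) z.
Proof. by rewrite {1}/sharp /E0 conjcM sharp_expi opprK -sharp_Eexp. Qed.

Lemma E0E z : E0 c z = expi (- (r - 1)) z * exp_poly d (ppol c) z.
Proof. by rewrite /E0 Eexp_exp_poly. Qed.

Lemma E0_N0 z : h <= complex.Im z -> E0 c z != 0.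
Proof. by move=> hz; rewrite mulf_neq0 ?expi_N0 // hE. Qed.

Lemma ThetaE z : Theta c z =
  expi (2 * (r - 1)) z * ((qpol c).[qz d z] / (ppol c).[qz d z]).
Proof.
have gen (a e p q : R[i]) : e != 0 -> (a^-1 * (e * p))^-1 * (a * (e * q)) = a * a * (q / p).
  move=> e0; rewrite !invfM invrK -[RHS]mul1r -(mulVf e0); ring.
rewrite /Theta sharp_E0 E0E /exp_poly expiN gen ?expi_N0 // -expiD.
by congr (expi _ z * _); ring.
Qed.

End ThetaExpansion.

(** * Almost periodic sums in local L^2 *)

Section ComplexContinuity.
Variable R : realType.
Implicit Types (f g : R -> R[i]).

Definition ccont f :=
  continuous (fun x => complex.Re (f x)) /\ continuous (fun x => complex.Im (f x)).

Lemma ccont_cst (k : R[i]) : ccont (fun=> k).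
Proof. by split => x; apply: cvg_cst. Qed.

Lemma ccontD f g : ccont f -> ccont g -> ccont (fun x => f x + g x).
Proof.
move=> [f1 f2] [g1 g2]; split => x.
  rewrite (_ : (fun x => _) = fun x => complex.Re (f x) + complex.Re (g x)).
    by apply: cvgD; [exact: f1|exact: g1].
  by apply/funext => y; case: (f y) (g y) => ? ? [].
rewrite (_ : (fun x => _) = fun x => complex.Im (f x) + complex.Im (g x)).
  by apply: cvgD; [exact: f2|exact: g2].
by apply/funext => y; case: (f y) (g y) => ? ? [].
Qed.

Lemma ccontM f g : ccont f -> ccont g -> ccont (fun x => f x * g x).
Proof.
move=> [f1 f2] [g1 g2]; split => x.
  rewrite (_ : (fun x => _) = fun x => complex.Re (f x) * complex.Re (g x)
      - complex.Im (f x) * complex.Im (g x)).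
    by apply: cvgB; apply: cvgM; [exact: f1|exact: g1|exact: f2|exact: g2].
  by apply/funext => y; case: (f y) (g y) => ? ? [].
rewrite (_ : (fun x => _) = fun x => complex.Re (f x) * complex.Im (g x)
      + complex.Im (f x) * complex.Re (g x)).
  by apply: cvgD; apply: cvgM; [exact: f1|exact: g2|exact: f2|exact: g1].
by apply/funext => y; case: (f y) (g y) => ? ? [].
Qed.

Lemma ccontV f : (forall x, f x != 0) -> ccont f -> ccont (fun x => (f x)^-1).
Proof.
move=> f0 [f1 f2].
have n0 x : complex.Re (f x) ^+ 2 + complex.Im (f x) ^+ 2 != 0.
  by rewrite -[_ + _]/(normc2 (f x)) nm_sqr expf_neq0 // nm_eq0.
have nc x : (fun y => complex.Re (f y) ^+ 2 + complex.Im (f y) ^+ 2) y @[y --> x] -->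
    complex.Re (f x) ^+ 2 + complex.Im (f x) ^+ 2.
  by apply: cvgD; apply: cvgM; (exact: f1 || exact: f2).
split => x.
  rewrite (_ : (fun x => _) = fun x => complex.Re (f x) / (complex.Re (f x) ^+ 2 + complex.Im (f x) ^+ 2)).
    by apply: cvgM; [exact: f1|apply: cvgV => //; exact: nc].
  by apply/funext => y; case: (f y).
rewrite (_ : (fun x => _) = fun x => - (complex.Im (f x) / (complex.Re (f x) ^+ 2 + complex.Im (f x) ^+ 2))).
  by apply: cvgN; apply: cvgM; [exact: f2|apply: cvgV => //; exact: nc].
by apply/funext => y; case: (f y).
Qed.

Lemma ccont_sum (I : Type) (s : seq I) (F : I -> R -> R[i]) :
  (forall i, ccont (F i)) -> ccont (fun x => \sum_(i <- s) F i x).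
Proof.
move=> Fc; elim: s => [|i s IH].
  by under eq_fun do rewrite big_nil; apply: ccont_cst.
by under eq_fun do rewrite big_cons; apply: ccontD.
Qed.

Lemma ccontX f n : ccont f -> ccont (fun x => f x ^+ n).
Proof.
move=> fc; elim: n => [|n IH]; first exact: ccont_cst.
by under eq_fun do rewrite exprS; apply: ccontM.
Qed.

Lemma is_cderive_ccont f : (forall x, exists df, is_cderive f x df) -> ccont f.
Proof.
move=> fd; split => x; have [df [[d1 _] [d2 _]]] := fd x.
  by move/derivable1_diffP: d1 => /differentiable_continuous.
by move/derivable1_diffP: d2 => /differentiable_continuous.
Qed.

Lemma continuous_normc2 f : ccont f -> continuous (fun x => normc2 (f x)).
Proof. by move=> [f1 f2] x; apply: cvgD; apply: cvgM; (exact: f1 || exact: f2). Qed.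

Lemma ccont_expi a h : ccont (fun x : R => expi a (x +i* h)).
Proof.
have e x : expi a (x +i* h) = expi a (0 +i* h) * expi (0 + a * x) 1.
  rewrite add0r /expi -cexpD; congr cexp; apply/eqP; rewrite eq_complex /=.
  by apply/andP; split; apply/eqP; ring.
under eq_fun do rewrite e; apply: ccontM; first exact: ccont_cst.
by apply: is_cderive_ccont => x; eexists; apply: (is_cderive_expi 0 a 1 x).
Qed.

End ComplexContinuity.

Section L2bound.
Variable R : realType.
Local Notation mu := (@lebesgue_measure R).
Implicit Types (f F : R -> R[i]) (a b s : R) (k : R[i]).

Lemma measurable_normc2 f (D : set R) : ccont f ->
  measurable_fun D (fun x => normc2 (f x)).
Proof.
move=> fc; apply: measurable_funTS.
by apply: continuous_measurable_fun; apply: continuous_normc2.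
Qed.

Lemma young_Re s k (w : R[i]) : 0 < s ->
  complex.Re (k * w) <= 2^-1 * (s * normc2 k) + 2^-1 * s^-1 * normc2 w.
Proof.
move=> s0; case: w k => [u v] [p q] /=; rewrite /normc2 /=.
have e : 2^-1 * (s * (p ^+ 2 + q ^+ 2)) + 2^-1 * s^-1 * (u ^+ 2 + v ^+ 2) - (p * u - q * v)
     = 2^-1 * s^-1 * ((s * p - u) ^+ 2 + (s * q + v) ^+ 2).
  by field; rewrite gt_eqF.
by rewrite -subr_ge0 e mulr_ge0 ?addr_ge0 ?sqr_ge0 // mulr_ge0 ?invr_ge0 // ltW.
Qed.

(** Young's inequality under the integral that the fundamental theorem of
    calculus provides; the free parameter [s] replaces the square root in the
    Cauchy-Schwarz inequality. *)
Lemma antideriv_young f F a b s k : a < b -> 0 < s -> ccont f ->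
  (forall x, is_cderive F x (f x)) ->
  ((complex.Re (k * (F b - F a)))%:E <=
   (2^-1 * (s * (b - a) * normc2 k))%:E +
   (2^-1 * s^-1)%:E * \int[mu]_(x in `[a, b]) (normc2 (f x))%:E)%E.
Proof.
move=> ab s0 fc dF.
have kf : ccont (fun x => k * f x) by apply: ccontM => //; apply: ccont_cst.
have dk x : is_cderive (fun y => k * F y) x (k * f x) by apply: is_cderiveZ.
have FTC : (\int[mu]_(x in `[a, b]) (complex.Re (k * f x))%:E =
    (complex.Re (k * F b))%:E - (complex.Re (k * F a))%:E)%E.
  apply: (@continuous_FTC2 R (fun x => complex.Re (k * f x)) (fun x => complex.Re (k * F x))) => //.
  - by apply: continuous_subspaceT; case: kf.
  - have Fc : continuous (fun x => complex.Re (k * F x)).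
      by have [] : ccont (fun x => k * F x) by apply: is_cderive_ccont => x; eexists; apply: dk.
    split=> [x _||]; first by case: (dk x) => [[]].
      by apply: cvg_at_right_filter; apply: Fc.
    by apply: cvg_at_left_filter; apply: Fc.
  - by move=> x _; rewrite derive1E; case: (dk x) => [[_ ->]].
have -> : ((complex.Re (k * (F b - F a)))%:E =
   (complex.Re (k * F b))%:E - (complex.Re (k * F a))%:E)%E.
  by rewrite mulrBr -EFinB; case: (k * F b) (k * F a) => ? ? [].
rewrite -FTC.
have cn : continuous (fun x => normc2 (f x)) := continuous_normc2 fc.
pose g x := 2^-1 * (s * normc2 k) + 2^-1 * s^-1 * normc2 (f x).
have gc : continuous g.
  by move=> x; apply: cvgD; [exact: cvg_cst|apply: cvgM; [exact: cvg_cst|exact: cn]].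
apply: (@le_trans _ _ (\int[mu]_(x in `[a, b]) (g x)%:E)%E).
  apply: le_integral => //.
  - apply: continuous_compact_integrable; first exact: segment_compact.
    by apply: continuous_subspaceT; case: kf.
  - apply: continuous_compact_integrable; first exact: segment_compact.
    exact: continuous_subspaceT.
  by move=> x _; rewrite lee_fin /g; apply: young_Re.
have n2 (z : R[i]) : 0 <= normc2 z by rewrite addr_ge0 ?sqr_ge0.
have mn : measurable_fun `[a, b] (fun x => (normc2 (f x))%:E).
  by apply/measurable_EFinP; apply: measurable_normc2.
have -> : (\int[mu]_(x in `[a, b]) (g x)%:E =
  \int[mu]_(x in `[a, b]) ((2^-1 * (s * normc2 k))%:E + (2^-1 * s^-1)%:E * (normc2 (f x))%:E))%E.
  by apply: eq_integral => x _; rewrite /g EFinD EFinM.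
have c1 : 0 <= 2^-1 * (s * normc2 k) by rewrite mulr_ge0 // mulr_ge0 // ltW.
have c2 : 0 <= 2^-1 * s^-1 by rewrite mulr_ge0 // invr_ge0 ltW.
rewrite ge0_integralD //=; last 2 first.
- by move=> x _; rewrite mule_ge0 ?lee_fin.
- by apply: measurable_funeM.
rewrite ge0_integralZl_EFin //; last by move=> x _; rewrite lee_fin.
rewrite integral_cst //= lebesgue_measure_itv /= lte_fin ab -EFinB -EFinM.
apply: leeD => //; rewrite lee_fin le_eqVlt; apply/orP; left; apply/eqP; ring.
Qed.

End L2bound.

Section LowerBound.
Local Notation "z ^*" := (conjc z) : ring_scope.
Variable R : realType.
Local Notation mu := (@lebesgue_measure R).
Implicit Types (x y T h : R) (nu lam : R).

Definition ex nu x : R[i] := expi (nu * x) 1.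

Lemma is_cderive_sum (I : Type) (s : seq I) (F dF : I -> R -> R[i]) x :
  (forall i, is_cderive (F i) x (dF i x)) ->
  is_cderive (fun x => \sum_(i <- s) F i x) x (\sum_(i <- s) dF i x).
Proof.
move=> Fd; elim: s => [|i s IH].
  rewrite big_nil; under eq_fun do rewrite big_nil.
  by split => /=; exact: is_derive_cst.
by rewrite big_cons; under eq_fun do rewrite big_cons; apply: is_cderiveD.
Qed.

Lemma expi_line a x h : expi a (x +i* h) = expi a (0 +i* h) * ex a x.
Proof.
rewrite /ex /expi -cexpD; congr cexp; apply/eqP; rewrite eq_complex /=.
by apply/andP; split; apply/eqP; ring.
Qed.

Lemma nm_ex nu x : nm (ex nu x) = 1.
Proof. by rewrite /ex (_ : 1 = 1 +i* 0) // nm_expi mulr0 oppr0 expR0. Qed.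

Lemma exDl nu lam x : ex (nu + lam) x = ex nu x * ex lam x.
Proof. by rewrite /ex mulrDl expiD. Qed.

Lemma exDr nu x y : ex nu (x + y) = ex nu x * ex nu y.
Proof. by rewrite /ex mulrDr expiD. Qed.

Lemma ex0 nu : ex nu 0 = 1.
Proof. by rewrite /ex mulr0 expi0. Qed.

Lemma ex_N0 nu x : ex nu x != 0. Proof. exact: expi_N0. Qed.

Lemma ex_deriv nu x : is_cderive (ex nu) x ('i * nu%:C * ex nu x).
Proof.
have := is_cderive_expi 0 nu 1 x; rewrite mulr1 add0r.
by under eq_fun do rewrite add0r.
Qed.

Lemma expi_2pi (n : int) : expi (2 * pi * n%:~R) 1 = 1 :> R[i].
Proof.
have e1 : expi (2 * pi) 1 = 1 :> R[i].
  rewrite (_ : (1 : R[i]) = 1 +i* 0) // expiE mulr0 oppr0 expR0 mulr1 mul1r.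
  by rewrite mulr_natl cos2pi sin2pi.
case: n => n; first by rewrite -expiX e1 expr1n.
by rewrite NegzE rmorphN /= mulrN expiN -expiX e1 expr1n invr1.
Qed.

Lemma expi_eq1 y : expi y 1 = 1 :> R[i] -> exists n : int, y = 2 * pi * n%:~R.
Proof.
move=> e; pose n := Num.floor (y / (2 * pi)); exists n.
have p0 : 0 < 2 * pi :> R by rewrite mulr_gt0 ?pi_gt0.
pose y' := y - 2 * pi * n%:~R.
have e' : expi y' 1 = 1 :> R[i] by rewrite expiB e expi_2pi divr1.
have /andP[h1 h2] := Num.Theory.floor_itv (y / (2 * pi)).
have y0 : 0 <= y' by rewrite subr_ge0 mulrC -ler_pdivlMr.
have y1 : y' < 2 * pi.
  rewrite ltrBlDr -{1}(mulr1 (2 * pi)) -mulrDr mulrC -ltr_pdivrMr //.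
  by rewrite addrC (_ : 1 = 1%:~R) // -intrD.
have c1 : cos y' = 1.
  move: e'; rewrite (_ : (1 : R[i]) = 1 +i* 0) // expiE mulr0 oppr0 expR0 mulr1.
  by rewrite mul1r => -[].
have c2 : cos y' = 1 - 2 * sin (y' / 2) ^+ 2.
  rewrite {1}(_ : y' = (y' / 2) *+ 2); last by rewrite -mulr_natr divfK // pnatr_eq0.
  by rewrite cos_mulr2n -[in LHS](subrK (sin (y' / 2) ^+ 2) (cos _ ^+ 2)) cos2sin2; ring.
have s0 : sin (y' / 2) = 0.
  apply/eqP; rewrite -sqrf_eq0; apply/eqP.
  move: c1; rewrite c2 => /eqP; rewrite -subr_eq0 addrAC subrr add0r oppr_eq0 mulf_eq0.
  by rewrite pnatr_eq0 => /eqP.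
suff : y' = 0 by move/eqP; rewrite subr_eq0 => /eqP.
apply/eqP; rewrite -[_ == _]negbK; apply/negP => yN.
have yp : 0 < y' by rewrite lt_def yN.
have : 0 < sin (y' / 2).
  by apply: sin_gt0_pi; rewrite divr_gt0 //= ltr_pdivrMr // mulrC.
by rewrite s0 ltxx.
Qed.

Definition ex_primitive nu x : R[i] := if nu == 0 then x%:C else ex nu x / ('i * nu%:C).

Lemma ex_primitive_deriv nu x : is_cderive (ex_primitive nu) x (ex nu x).
Proof.
rewrite /ex_primitive; case: eqP => [->|/eqP n0].
  have -> : ex 0 x = 1%:C by rewrite /ex mul0r expi0.
  by split => /=; [exact: is_derive_id|exact: is_derive_cst].
have iN : 'i * nu%:C != 0 :> R[i].
  by rewrite mulf_neq0 // ?fmorph_eq0 // eq_complex /= oner_eq0 andbF.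
have := is_cderiveZ ('i * nu%:C)^-1 (ex_deriv nu x).
rewrite (mulKf iN) => dx.
by under eq_fun do rewrite mulrC.
Qed.

(** The functional
    [S |-> e^{i nu0 T} int_T^{2T} S e^{-i nu0 x} dx - om int_0^T S e^{-i nu0 x} dx]
    sends [e^{i nu x}] to [(e^{i nu T} - om) int_0^T e^{i (nu - nu0) x} dx].  The
    first factor vanishes for the second family, and the integral vanishes for
    the members of the first family other than [nu0]. *)
Lemma family_bound (I J : finType) (ga : I -> R[i]) (nu : I -> R)
    (ga' : J -> R[i]) (nu' : J -> R) (i0 : I) T (om : R[i]) (S : R -> R[i]) :
  0 < T -> nm om = 1 ->
  (forall i, i != i0 -> nu i != nu i0 /\ ex (nu i - nu i0) T = 1) ->
  (forall j, ex (nu' j) T = om) -> ex (nu i0) T != om ->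
  (forall x, S x = \sum_i ga i * ex (nu i) x + \sum_j ga' j * ex (nu' j) x) ->
  ((normc2 (T%:C * (ex (nu i0) T - om) * ga i0))%:E <=
   (4 * T)%:E * \int[mu]_(x in `[(- (2 * T))%R, (2 * T)%R]) (normc2 (S x))%:E)%E.
Proof.
move=> T0 om1 hI hJ hom SE; set lam := nu i0; set w := T%:C * _ * _.
pose P x := \sum_i ga i * ex_primitive (nu i - lam) x + \sum_j ga' j * ex_primitive (nu' j - lam) x.
have exc a : ccont (ex a) by apply: is_cderive_ccont => x; eexists; apply: ex_deriv.
have Sc : ccont S.
  rewrite (funext SE).
  by apply: ccontD; apply: ccont_sum => i; apply: ccontM => //; apply: ccont_cst.
have csum (K : finType) (g : K -> R[i]) (n : K -> R) x :
    is_cderive (fun x => \sum_k g k * ex_primitive (n k) x) x (\sum_k g k * ex (n k) x).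
  apply: (@is_cderive_sum K _ (fun k x => g k * ex_primitive (n k) x) (fun k x => g k * ex (n k) x)) => k.
  by apply: is_cderiveZ; apply: ex_primitive_deriv.
have Pd x : is_cderive P x (ex (- lam) x * S x).
  rewrite (_ : _ * _ = \sum_i ga i * ex (nu i - lam) x + \sum_j ga' j * ex (nu' j - lam) x).
    exact: is_cderiveD.
  by rewrite SE mulrDr !mulr_sumr; congr (_ + _); apply: eq_bigr => k _; rewrite mulrCA exDl (mulrC (ex (- lam) x)).
(* the value of the functional on e^{i (n + lam) x} *)
pose dD n := ex lam T * (ex_primitive n (T + T) - ex_primitive n T) - om * (ex_primitive n T - ex_primitive n 0).
have dD0 : dD 0 = T%:C * (ex lam T - om).
  rewrite /dD /ex_primitive eqxx -!rmorphB /= addrK subr0; ring.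
have dD1 n : n != 0 -> ex n T = 1 -> dD n = 0.
  by move=> n0 e; rewrite /dD /ex_primitive (negbTE n0) exDr ex0 e mulr1 subrr !mulr0 subrr.
have dD2 n : n != 0 -> ex lam T * ex n T = om -> dD n = 0.
  move=> n0 e; rewrite /dD /ex_primitive (negbTE n0) exDr ex0 -e -!mulrBl; ring.
have total : ex lam T * (P (T + T) - P T) - om * (P T - P 0) = w.
  transitivity (\sum_i ga i * dD (nu i - lam) + \sum_j ga' j * dD (nu' j - lam)).
    have lin (K : finType) (g : K -> R[i]) (n : K -> R) :
        \sum_k g k * dD (n k) = ex lam T * (\sum_k g k * ex_primitive (n k) (T + T) - \sum_k g k * ex_primitive (n k) T)
        - om * (\sum_k g k * ex_primitive (n k) T - \sum_k g k * ex_primitive (n k) 0).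
      rewrite -!sumrB !mulr_sumr -sumrB; apply: eq_bigr => k _; rewrite /dD; ring.
    rewrite !lin /P; ring.
  rewrite (bigD1 i0) //= subrr dD0 big1 => [|i ii0]; last first.
    by have [h1 h2] := hI i ii0; rewrite dD1 ?mulr0 // subr_eq0.
  rewrite big1 => [|j _]; first by rewrite !addr0 /w mulrC.
  have e : ex lam T * ex (nu' j - lam) T = om by rewrite -exDl addrC subrK hJ.
  rewrite dD2 ?mulr0 //; apply: contra hom => /eqP n0; apply/eqP.
  by rewrite -e n0 /lam /ex mul0r expi0 mulr1.
have lamc : ccont (fun x => ex (- lam) x * S x) by apply: ccontM.
have nf (k : R[i]) x : nm k = 1 -> normc2 (k * (ex (- lam) x * S x)) = normc2 (S x).
  by move=> k1; rewrite nm_sqr nmM k1 mul1r nmM nm_ex mul1r -nm_sqr.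
have T2 : T < T + T by rewrite ltrDl.
(* this choice of s in antideriv_young leaves 1/4 of |w|^2 on the right, for each of the two halves *)
have s0 : 0 < (2 * T)^-1 by rewrite invr_gt0 mulr_gt0.
have c1 : ccont (fun x => - om * (ex (- lam) x * S x)) by apply: ccontM => //; apply: ccont_cst.
have c2 : ccont (fun x => ex lam T * (ex (- lam) x * S x)) by apply: ccontM => //; apply: ccont_cst.
have y1 := antideriv_young w^* T0 s0 c1 (fun x => is_cderiveZ (- om) (Pd x)).
have y2 := antideriv_young w^* T2 s0 c2 (fun x => is_cderiveZ (ex lam T) (Pd x)).
pose II := (\int[mu]_(x in `[(- (2 * T))%R, (2 * T)%R]) (normc2 (S x))%:E)%E.
have n2 (z : R[i]) : 0 <= normc2 z by rewrite nm_sqr sqr_ge0.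
have sub (a b : R) (f : R -> R[i]) : - (2 * T) <= a -> b <= 2 * T ->
    (forall x, normc2 (f x) = normc2 (S x)) ->
    (\int[mu]_(x in `[a, b]) (normc2 (f x))%:E <= II)%E.
  move=> ha hb fS; under eq_integral do rewrite fS.
  apply: ge0_subset_integral => //.
  - by apply/measurable_EFinP; apply: measurable_normc2.
  - by move=> x _; rewrite lee_fin.
  by apply: subset_itv; rewrite bnd_simp.
have I1 : (\int[mu]_(x in `[0%R, T]) (normc2 (- om * (ex (- lam) x * S x)))%:E <= II)%E.
  by apply: sub => [||x]; [lra|lra|rewrite nf ?nmN].
have I2 : (\int[mu]_(x in `[T, (T + T)%R]) (normc2 (ex lam T * (ex (- lam) x * S x)))%:E <= II)%E.
  by apply: sub => [||x]; [lra|lra|rewrite nf ?nm_ex].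
have II0 : (0 <= II)%E by apply: integral_ge0 => x _; rewrite lee_fin.
have wn : normc2 w^* = normc2 w by rewrite !nm_sqr nm_conjc.
have wE : normc2 w = complex.Re (w^* * (- om * P T - - om * P 0)) +
    complex.Re (w^* * (ex lam T * P (T + T) - ex lam T * P T)).
  have -> : normc2 w = complex.Re (w^* * w) by rewrite mulrC mul_conjc.
  rewrite -{2}total; set u := w^*.
  have ReD (a b : R[i]) : complex.Re (a + b) = complex.Re a + complex.Re b by case: a b => ? ? [].
  by rewrite -ReD; congr complex.Re; ring.
have := leeD y1 y2; rewrite -EFinD -!mulrBr wn.
have -> : complex.Re (w^* * (- om * (P T - P 0))) + complex.Re (w^* * (ex lam T * (P (T + T) - P T))) = normc2 w.
  by rewrite wE !mulrBr.
have fin (N : R) (y : \bar R) : (0 <= y)%E ->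
    (N%:E <= (4^-1 * N)%:E + T%:E * y + ((4^-1 * N)%:E + T%:E * y))%E ->
    (N%:E <= (4 * T)%:E * y)%E.
  case: y => [v||] //= y0; first by rewrite -!EFinM -!EFinD !lee_fin => h; lra.
  by move=> _; rewrite gt0_muley ?leey // lte_fin mulr_gt0.
have := II0; have -> : 2^-1 / (2 * T)^-1 = T :> R by field; lra.
have -> : 2^-1 * ((2 * T)^-1 * (T - 0) * normc2 w) = 4^-1 * normc2 w :> R by field; lra.
have -> : 2^-1 * ((2 * T)^-1 * (T + T - T) * normc2 w) = 4^-1 * normc2 w :> R by field; lra.
move: I1 I2 => I1 I2 {}II0 h.
have {}h : ((normc2 w)%:E <= (4^-1 * normc2 w)%:E + T%:E * II + ((4^-1 * normc2 w)%:E + T%:E * II))%E.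
  by apply: le_trans h _; rewrite leeD // leeD2l // lee_pmul2l // lte_fin.
exact: fin.
Qed.

End LowerBound.

Section Symsum.
Implicit Types (V : nmodType) (k l : int).

Lemma symsumD V N (F G : int -> V) :
  symsum N (fun k => F k + G k) = symsum N F + symsum N G.
Proof. exact: big_split. Qed.

Lemma eq_symsum V N (F G : int -> V) : F =1 G -> symsum N F = symsum N G.
Proof. by move=> FG; apply: eq_bigr => i _; apply: FG. Qed.

Lemma symsum0 V N (F : int -> V) : (forall k, F k = 0) -> symsum N F = 0.
Proof. by move=> F0; apply: big1. Qed.

Lemma symsumZ (T : pzRingType) N a (F : int -> T) :
  symsum N (fun k => a * F k) = a * symsum N F.
Proof. by rewrite /symsum mulr_sumr. Qed.

Lemma symsum_opp V N (F : int -> V) : symsum N (fun k => F (- k)) = symsum N F.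
Proof.
rewrite /symsum [RHS](reindex_inj rev_ord_inj) /=; apply: eq_bigr => i _; congr F.
by have := ltn_ord i; lia.
Qed.

Lemma symsum_half V N l (F : int -> V) : (`|l| <= N)%N -> (forall k, k < l -> F k = 0) ->
  symsum N F = \sum_(m < `|(N%:Z - l)%R|%N.+1) F (l + m%:Z).
Proof.
move=> lN F0; rewrite /symsum -(big_mkord xpredT (fun i => F (i%:Z - N%:Z))).
rewrite (@big_cat_nat _ _ _ `|(l + N%:Z)%R|%N) //=; last by lia.
rewrite big_nat big1 ?add0r; last by move=> i hi; apply: F0; lia.
rewrite -{1}[`|(l + N%:Z)%R|%N]add0n big_addn.
have -> : (N.*2.+1 - `|(l + N%:Z)%R|%N = `|(N%:Z - l)%R|%N.+1)%N by lia.
by rewrite big_mkord; apply: eq_bigr => i _; congr F; lia.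
Qed.

Lemma symsum_single V N l (F : int -> V) : (`|l| <= N)%N -> (forall k, k != l -> F k = 0) ->
  symsum N F = F l.
Proof.
move=> lN F0; rewrite (symsum_half lN) => [|k kl]; last by apply: F0; lia.
by rewrite big_ord_recl addr0 big1 ?addr0 // => i _; apply: F0; rewrite /= /bump; lia.
Qed.

Lemma symsum_ge (R : numDomainType) N k (F : int -> R) : (forall k, 0 <= F k) ->
  (`|k| <= N)%N -> F k <= symsum N F.
Proof.
move=> F0 kN.
have kb : (`|(k + N%:Z)%R|%N < N.*2.+1)%N by lia.
rewrite /symsum (bigD1 (Ordinal kb)) //=.
have -> : `|(k + N%:Z)%R|%N%:Z - N%:Z = k by lia.
by rewrite lerDl sumr_ge0.
Qed.

Lemma esum_symsum (R : realType) (f : int -> R) (C : R) : (forall k, 0 <= f k) ->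
  (forall N, symsum N f <= C) -> (\esum_(k in [set: int]) (f k)%:E <= C%:E)%E.
Proof.
move=> f0 fC; apply: ge_ereal_sup => _ [A [finA _] <-].
rewrite fsbig_finite //= sumEFin lee_fin.
set s := finmap.enum_fset _.
have us : uniq s by apply: finmap.fset_uniq.
pose N := \max_(k <- s) `|k|%N.
pose t := [seq (i%:Z - N%:Z)%R | i <- iota 0 N.*2.+1].
have ut : uniq t.
  by rewrite map_inj_uniq ?iota_uniq // => i j; lia.
have st k : k \in s -> k \in t.
  move=> ks; have kN : (`|k| <= N)%N by apply: (@leq_bigmax_seq _ s xpredT (fun k : int => `|k|%N)).
  by apply/mapP; exists `|(k + N%:Z)%R|%N; [rewrite mem_iota; lia|lia].
apply: le_trans (fC N).
have -> : symsum N f = \sum_(k <- t) f k.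
  by rewrite big_map /symsum -(big_mkord xpredT (fun i => f (i%:Z - N%:Z))) /index_iota subn0.
have -> : \sum_(k <- s) f k = \sum_(k <- t | k \in s) f k.
  rewrite -[RHS]big_filter; apply/esym/perm_big; apply: uniq_perm => //; first exact: filter_uniq.
  by move=> k; rewrite mem_filter /=; case ks : (k \in s) => //=; exact: st.
by rewrite [leRHS](bigID (mem s)) /= lerDl sumr_ge0.
Qed.

End Symsum.

Section FamilyZero.
Variable R : realType.
Local Notation mu := (@lebesgue_measure R).

(** The bound of [family_bound] does not depend on the number of terms, so it
    survives the passage to the limit. *)
Lemma family_zero (nu nu' : int -> R) (g g' : int -> R[i]) T (om : R[i]) :
  0 < T -> nm om = 1 ->
  (forall k l, k != l -> nu k != nu l /\ ex (nu k - nu l) T = 1) ->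
  (forall l, ex (nu' l) T = om) -> (forall k, ex (nu k) T != om) ->
  (forall M : R, 0 < M -> (\int[mu]_(x in `[(- M)%R, M])
      (normc2 (symsum N (fun k => g k * ex (nu k) x + g' k * ex (nu' k) x)))%:E)%E
      @[N --> \oo] --> 0%E) ->
  forall k, g k = 0.
Proof.
move=> T0 om1 h1 h2 h3 cv k.
have T20 : 0 < 2 * T by rewrite mulr_gt0.
have T40 : 0 < 4 * T by rewrite mulr_gt0.
have b0 : ((normc2 (T%:C * (ex (nu k) T - om) * g k) / (4 * T))%:E <= 0%:E)%E.
  apply: (cvge_to_ge (cv _ T20)); exists `|k|%N => // N /= kN.
  have kb : (`|(k + N%:Z)%R|%N < N.*2.+1)%N by lia.
  have kE : `|(k + N%:Z)%R|%N%:Z - N%:Z = k by lia.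
  rewrite EFinM muleC lee_pdivrMl //.
  rewrite -{1 2}kE; apply: (@family_bound R 'I_(N.*2.+1) 'I_(N.*2.+1)
    (fun i => g (i%:Z - N%:Z)) (fun i => nu (i%:Z - N%:Z))
    (fun i => g' (i%:Z - N%:Z)) (fun i => nu' (i%:Z - N%:Z)) (Ordinal kb)) => //.
  - move=> i; rewrite -val_eqE /= => ik; apply: h1; lia.
  by move=> x; rewrite symsumD.
move: b0; rewrite lee_fin pmulr_lle0 ?invr_gt0 // nm_sqr => b0.
have : nm (T%:C * (ex (nu k) T - om) * g k) == 0.
  by rewrite -sqrf_eq0 eq_le b0 sqr_ge0.
rewrite nm_eq0 !mulf_eq0 subr_eq0 (negbTE (h3 k)) orbF.
by rewrite (inj_eq (@complexI R) T 0) gt_eqF //= => /eqP.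
Qed.

End FamilyZero.

(** * Expansions in the functions [X(k)] and [Y(l-r+1)] *)

Section Expansion.
Variables (R : realType) (d : nat) (h t : R).
Local Notation r := ((rpar d)%:R : R).
Local Notation mu := (@lebesgue_measure R).
Implicit Types (u v : int -> R[i]) (phi : R -> R[i]) (k l : int).

Definition XW k (x : R) : R[i] := Xfun d k t (x +i* h).
Definition YW l (x : R) : R[i] := Yshift d l t (x +i* h).

Definition xfreq k : R := r * (k + 1)%:~R - 1 - t.
Definition yfreq l : R := - (r * (l - (rpar d)%:Z + 1 + 1)%:~R - 1 - t).

Lemma XWE k x : XW k x = XW k 0 * ex (xfreq k) x.
Proof. exact: expi_line. Qed.

Lemma YWE l x : YW l x = YW l 0 * ex (yfreq l) x.
Proof. exact: expi_line. Qed.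

Lemma XW_N0 k x : XW k x != 0. Proof. exact: expi_N0. Qed.
Lemma YW_N0 k x : YW k x != 0. Proof. exact: expi_N0. Qed.

(** The parameter [r] is [1] or [2]. *)
Lemma rr_case : (r - 1) * (r - 2) = 0.
Proof. by rewrite /rpar; case: ifP => _; ring. Qed.

Lemma xy_freq k l : xfreq k - yfreq l = r * (k + l)%:~R - 2 * t.
Proof.
rewrite /xfreq /yfreq !intrD rmorphN /= -pmulrn.
have := rr_case; set a := r => e.
have -> : a * (k%:~R + 1%:~R) - 1 - t - - (a * (l%:~R - a + 1%:~R + 1%:~R) - 1 - t) =
   a * (k%:~R + l%:~R) - 2 * t - (a - 1) * (a - 2) :> R by ring.
by rewrite e subr0.
Qed.

Lemma xy_freq_sum k : xfreq k + yfreq k = 2 * (r - 1).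
Proof.
rewrite /xfreq /yfreq !intrD rmorphN /= -pmulrn.
have := rr_case; set a := r => e.
have -> : a * (k%:~R + 1%:~R) - 1 - t + - (a * (k%:~R - a + 1%:~R + 1%:~R) - 1 - t) =
   2 * (a - 1) + (a - 1) * (a - 2) :> R by ring.
by rewrite e addr0.
Qed.

(** The frequencies of the [X(k)] form a class modulo [r Z], and so do those of
    the [Y(l-r+1)].  For generic [t] the two classes differ, and then
    [T = 2 pi / r] separates the two families. *)
Lemma coef_zero u v : generic_time d t ->
  (forall M : R, 0 < M -> (\int[mu]_(x in `[(- M)%R, M])
      (normc2 (symsum N (fun k => u k * XW k x + v k * YW k x)))%:E)%E
      @[N --> \oo] --> 0%E) ->
  (forall k, u k = 0) /\ (forall k, v k = 0).
Proof.
move=> gen cv.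
have r0 := rpar_gt0 R d; have rN : r != 0 by rewrite gt_eqF.
(* all frequencies within a family agree modulo 2 pi / T *)
pose T : R := 2 * pi / r.
have T0 : 0 < T by rewrite divr_gt0 // mulr_gt0 ?pi_gt0.
have rT n : ex (r * n%:~R) T = 1.
  by rewrite /ex -[RHS](expi_2pi R n); congr (expi _ 1); rewrite /T; field.
have exint nu nu' (n : int) : nu - nu' = r * n%:~R -> ex nu T = ex nu' T.
  by move=> e; rewrite -(subrK nu' nu) e exDl rT mul1r.
have xx k l : xfreq k - xfreq l = r * (k - l)%:~R by rewrite /xfreq !intrD rmorphN /=; ring.
have yy k l : yfreq k - yfreq l = r * (l - k)%:~R by rewrite /yfreq !intrD !rmorphN /=; ring.
have intN0 k l : k != l -> r * (k - l)%:~R != 0 :> R.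
  by move=> kl; rewrite mulf_neq0 // intr_eq0 subr_eq0.
have hx k l : k != l -> xfreq k != xfreq l /\ ex (xfreq k - xfreq l) T = 1.
  by move=> kl; rewrite -subr_eq0 xx intN0 // rT.
have hy k l : k != l -> yfreq k != yfreq l /\ ex (yfreq k - yfreq l) T = 1.
  by move=> kl; rewrite -subr_eq0 yy intN0 1?eq_sym // rT.
have sep k l : ex (xfreq k) T != ex (yfreq l) T.
  apply/eqP => e; have : expi ((xfreq k - yfreq l) * T) 1 = 1 :> R[i].
    have := exDl (xfreq k - yfreq l) (yfreq l) T; rewrite subrK e => e'.
    by apply: (mulIf (ex_N0 (yfreq l) T)); rewrite mul1r [RHS]e'.
  move=> /expi_eq1[n nE].
  have : xfreq k - yfreq l = r * n%:~R.
    have p0 : pi != 0 :> R by rewrite gt_eqF ?pi_gt0.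
    apply: (mulIf (lt0r_neq0 T0)); rewrite nE /T; field; exact: rN.
  rewrite xy_freq => e2; have /eqP := gen (k + l - n); apply.
  rewrite intrD rmorphN /=; lra.
have wX k : ex (xfreq k) T = ex (xfreq 0) T by apply: (exint _ _ (k - 0)); rewrite xx.
have wY k : ex (yfreq k) T = ex (yfreq 0) T by apply: (exint _ _ (0 - k)); rewrite yy.
have um k : u k * XW k 0 = 0.
  apply: (@family_zero R xfreq yfreq (fun k => u k * XW k 0) (fun k => v k * YW k 0)
    T (ex (yfreq 0) T) T0 (nm_ex _ _) hx wY) => [l|M M0]; first exact: sep.
  apply: cvg_trans (cv M M0); apply: near_eq_cvg; near=> N.
  by apply: eq_integral => x _; congr (normc2 _)%:E; apply: eq_symsum => l;
     rewrite XWE YWE !mulrA.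
have vm k : v k * YW k 0 = 0.
  apply: (@family_zero R yfreq xfreq (fun k => v k * YW k 0) (fun k => u k * XW k 0)
    T (ex (xfreq 0) T) T0 (nm_ex _ _) hy wX) => [l|M M0]; first by rewrite eq_sym sep.
  apply: cvg_trans (cv M M0); apply: near_eq_cvg; near=> N.
  by apply: eq_integral => x _; congr (normc2 _)%:E; apply: eq_symsum => l;
     rewrite XWE YWE !mulrA addrC.
split => k; [have := um k | have := vm k] => /eqP; rewrite mulf_eq0.
  by rewrite (negbTE (XW_N0 _ _)) orbF => /eqP.
by rewrite (negbTE (YW_N0 _ _)) orbF => /eqP.
Unshelve. all: by end_near. Qed.

(** A stronger form of expansion, along one of the two families only, which is
    stable under finite sums and which the Taylor series of [p^* / p] provides. *)
Definition famexp (W : int -> R -> R[i]) u phi : Prop :=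
  [/\ ccont phi, exists C, forall N, symsum N (fun k => nm (u k * W k 0)) <= C &
   exists2 e : nat -> R, e @ \oo --> 0 & exists N0, forall N x, (N0 <= N)%N ->
     nm (phi x - symsum N (fun k => u k * W k x)) <= e N ].

Lemma famexpD W u v phi psi : famexp W u phi -> famexp W v psi ->
  famexp W (fun k => u k + v k) (fun x => phi x + psi x).
Proof.
move=> [c1 [C1 h1] [e1 e10 [N1 g1]]] [c2 [C2 h2] [e2 e20 [N2 g2]]].
split; first exact: ccontD.
  exists (C1 + C2) => N; apply: le_trans (lerD (h1 N) (h2 N)).
  by rewrite -symsumD; apply: ler_sum => i _; rewrite mulrDl nmD.
exists (fun N => e1 N + e2 N); first by rewrite -[X in _ --> X]addr0; apply: cvgD.
exists (maxn N1 N2) => N x; rewrite geq_max => /andP[n1 n2].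
rewrite (_ : _ - _ = (phi x - symsum N (fun k => u k * W k x)) +
   (psi x - symsum N (fun k => v k * W k x))).
  by apply: le_trans (nmD _ _) _; apply: lerD; [exact: g1|exact: g2].
under eq_symsum do rewrite mulrDl.
by rewrite symsumD; ring.
Qed.

Lemma famexpZ W u phi a : famexp W u phi ->
  famexp W (fun k => a * u k) (fun x => a * phi x).
Proof.
move=> [c1 [C1 h1] [e1 e10 [N1 g1]]].
split; first by apply: ccontM => //; apply: ccont_cst.
  exists (nm a * C1) => N; apply: le_trans (ler_wpM2l (nm_ge0 a) (h1 N)).
  by rewrite -symsumZ; apply: ler_sum => i _; rewrite -mulrA nmM.
exists (fun N => nm a * e1 N).
  by rewrite -[X in _ --> X](mulr0 (nm a)); apply: cvgMl_tmp.
exists N1 => N x n1; under eq_symsum do rewrite -mulrA.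
by rewrite symsumZ -mulrBr nmM ler_wpM2l ?nm_ge0 // g1.
Qed.

Lemma famexp0 W : famexp W (fun=> 0) (fun=> 0).
Proof.
split; first exact: ccont_cst.
  by exists 0 => N; rewrite symsum0 // => k; rewrite mul0r nm0.
exists (fun=> 0); first exact: cvg_cst.
by exists 0%N => N x _; rewrite symsum0 ?subr0 ?nm0 // => k; rewrite mul0r.
Qed.

Lemma famexp_sum (I : Type) (s : seq I) W (U : I -> int -> R[i]) (F : I -> R -> R[i]) :
  (forall i, famexp W (U i) (F i)) ->
  famexp W (fun k => \sum_(i <- s) U i k) (fun x => \sum_(i <- s) F i x).
Proof.
move=> FU; elim: s => [|i s IH].
  by under eq_fun do rewrite big_nil; under [X in famexp _ _ X]eq_fun do rewrite big_nil;
    apply: famexp0.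
under eq_fun do rewrite big_cons; under [X in famexp _ _ X]eq_fun do rewrite big_cons.
exact: famexpD.
Qed.

Lemma famexp_opp W u phi :
  famexp (fun k => W (- k)) (fun k => u (- k)) phi -> famexp W u phi.
Proof.
move=> [c1 [C1 h1] [e1 e10 [N1 g1]]]; split => //.
  by exists C1 => N; rewrite -(symsum_opp N (fun k => nm (u k * W k 0))).
exists e1 => //; exists N1 => N x n1.
by rewrite -(symsum_opp N (fun k => u k * W k x)) g1.
Qed.

Lemma famexp_single W l : ccont (W l) -> famexp W (fun k => (k == l)%:R) (W l).
Proof.
move=> Wc; split=> //.
  exists (nm (W l 0)) => N; case: (leqP `|l|%N N) => lN.
    rewrite (symsum_single lN) ?eqxx ?mul1r // => k kl.
    by rewrite (negbTE kl) mul0r nm0.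
  rewrite /symsum big1 ?nm_ge0 // => i _; rewrite (_ : _ == l = false) ?mul0r ?nm0 //.
  by have := ltn_ord i; lia.
exists (fun=> 0); first exact: cvg_cst.
exists `|l|%N => N x lN.
rewrite (symsum_single lN) ?eqxx ?mul1r ?subrr ?nm0 // => k kl.
by rewrite (negbTE kl) mul0r.
Qed.

End Expansion.

Section Geometric.
Variables (R : realType) (d : nat) (c : 'I_d.+1 -> R[i]) (h t : R) (a : nat -> R[i]).
Local Notation r := ((rpar d)%:R : R).
Local Notation mu := (@lebesgue_measure R).
Local Notation XW := (XW d h t).
Local Notation YW := (YW d h t).
Hypothesis hE : forall z : R[i], h <= complex.Im z -> Eexp c z != 0.
Hypothesis aP : taylor (qmod d h) (ppol c) (qpol c) a.
Implicit Types (u v : int -> R[i]) (phi : R -> R[i]) (k l : int).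

Definition ath (j : int) : R[i] := if 0 <= j then a `|j|%N else 0.

Definition qline (x : R) : R[i] := qz d (x +i* h).
Definition QP x : R[i] := (qpol c).[qline x] / (ppol c).[qline x].

Lemma ccont_horner (f : {poly R[i]}) : ccont (fun x => f.[qline x]).
Proof.
under eq_fun do rewrite horner_coef.
apply: ccont_sum => i; apply: ccontM; first exact: ccont_cst.
by apply: ccontX; apply: ccont_expi.
Qed.

Lemma ppol_qline x : (ppol c).[qline x] != 0.
Proof. by apply: (ppol_qz_N0 hE) => /=. Qed.

Lemma ccont_QP : ccont QP.
Proof.
apply: ccontM; first exact: ccont_horner.
by apply: ccontV; [exact: ppol_qline|exact: ccont_horner].
Qed.

Lemma bounded_from (s : nat -> R) N0 C : (forall N, 0 <= s N) ->
  (forall N, (N0 <= N)%N -> s N <= C) -> exists C', forall N, s N <= C'.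
Proof.
move=> s0 sC; exists (C + \sum_(i < N0) s i) => N.
case: (leqP N0 N) => hN.
  by apply: le_trans (sC N hN) _; rewrite lerDl sumr_ge0.
apply: (@le_trans _ _ (\sum_(i < N0) s i)).
  by rewrite (bigD1 (Ordinal hN)) //= lerDl sumr_ge0.
by rewrite lerDr; apply: le_trans (s0 N0) (sC N0 (leqnn _)).
Qed.

(** Multiplication by [q^m] moves [W_l] to [W_{l+m}], so the Taylor series of
    [p^* / p] in [q] is already an expansion along the family. *)
Lemma famexp_geom (W : int -> R -> R[i]) l : ccont (W l) ->
  (forall x, nm (W l x) = nm (W l 0)) ->
  (forall (m : nat) x, W (l + m%:Z) x = W l x * qline x ^+ m) ->
  famexp W (fun k => ath (k - l)) (fun x => W l x * QP x).
Proof.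
move=> Wc Wn Wm; have [[C aC] [e e0 eN] _] := aP.
have q0 x : nm (qline x) = qmod d h := nm_qz d h x.
have athm (m : nat) : ath (l + m%:Z - l) = a m by rewrite addrC addKr.
have ath0 k : k < l -> ath (k - l) = 0 by move=> kl; rewrite /ath ifF //; lia.
split; first by apply: ccontM => //; exact: ccont_QP.
  apply: (@bounded_from _ `|l|%N (nm (W l 0) * C)) => [N|N lN].
    by apply: sumr_ge0 => i _; exact: nm_ge0.
  rewrite (symsum_half lN) => [|k kl]; last by rewrite ath0 // mul0r nm0.
  apply: le_trans (ler_wpM2l (nm_ge0 _) (aC _)); rewrite mulr_sumr.
  apply: ler_sum => m _; rewrite athm Wm !nmM nmX q0.
  by rewrite le_eqVlt; apply/orP; left; apply/eqP; ring.
exists (fun N => nm (W l 0) * e `|N%:Z - l|%N).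
  rewrite -[X in _ --> X](mulr0 (nm (W l 0))); apply: cvgMl_tmp.
  apply/cvgrPdist_lt => eps eps0.
  move/cvgrPdist_lt: e0 => /(_ eps eps0) [N1 _ H].
  by exists (N1 + `|l|)%N => // N /= hN; apply: H => /=; lia.
exists `|l|%N => N x lN.
rewrite (symsum_half lN) => [|k kl]; last by rewrite ath0 // mul0r.
rewrite (_ : _ - _ = W l x * (QP x - (psum a `|N%:Z - l|%N).[qline x])).
  by rewrite nmM Wn ler_wpM2l ?nm_ge0 //; apply: eN; rewrite q0.
rewrite mulrBr; congr (_ - _); rewrite horner_poly mulr_sumr.
by apply: eq_bigr => m _; rewrite athm Wm mulrCA.
Qed.

Lemma famexp_X l : famexp XW (fun k => ath (k - l)) (fun x => XW l x * QP x).
Proof.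
apply: famexp_geom => [|x|m x]; first exact: ccont_expi.
  by rewrite XWE nmM nm_ex mulr1.
rewrite /qline /qz expiX; rewrite -[XW l x]/(expi (r * (l + 1)%:~R - 1 - t) (x +i* h)).
rewrite -(expiD (r * (l + 1)%:~R - 1 - t) (r * m%:R)).
by rewrite -[LHS]/(expi (r * (l + m%:Z + 1)%:~R - 1 - t) (x +i* h)); congr (expi _ (x +i* h));
  rewrite !intrD -pmulrn; ring.
Qed.

Lemma famexp_Y l : famexp YW (fun k => ath (l - k)) (fun x => YW l x * QP x).
Proof.
apply: famexp_opp.
have -> : (fun k => ath (l - - k)) = (fun k => ath (k - - l)).
  by apply/funext => k; rewrite !opprK addrC.
have -> : (fun x => YW l x * QP x) = (fun x => YW (- - l) x * QP x) by rewrite opprK.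
apply: (@famexp_geom (fun k => YW (- k)) (- l)) => [|x|m x]; first exact: ccont_expi.
  by rewrite YWE nmM nm_ex mulr1.
pose yf k : R := - (r * (k - (rpar d)%:Z + 1 + 1)%:~R - 1 - t).
rewrite /qline /qz expiX; rewrite -[YW (- - l) x]/(expi (yf (- - l)) (x +i* h)).
rewrite -(expiD (yf (- - l)) (r * m%:R)).
by rewrite -[LHS]/(expi (yf (- (- l + m%:Z))) (x +i* h)); congr (expi _ (x +i* h));
  rewrite /yf opprK !intrD !rmorphN /= !intrD rmorphN /= -!pmulrn; ring.
Qed.

Lemma Theta_sharpX k x : Theta c (x +i* h) * sharp (Xfun d k t) (x +i* h) = YW k x * QP x.
Proof.
rewrite ThetaE mulrAC; congr (_ * _).
rewrite /sharp /Xfun sharp_expi -(expiD (2 * (r - 1))); congr (expi _ (x +i* h)).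
by rewrite -(xy_freq_sum d t k) addrC addKr.
Qed.

Lemma Theta_sharpY l x : Theta c (x +i* h) * sharp (Yshift d l t) (x +i* h) = XW l x * QP x.
Proof.
rewrite ThetaE mulrAC; congr (_ * _).
rewrite /sharp /Yshift /Yfun sharp_expi -(expiD (2 * (r - 1))); congr (expi _ (x +i* h)).
by rewrite -(xy_freq_sum d t l) addrK.
Qed.

(** Absolute summability entails square summability, and uniform convergence on
    the line entails convergence in local [L^2]. *)
Lemma Vexp_famexp u v phi phi1 phi2 : famexp XW u phi1 -> famexp YW v phi2 ->
  (forall x, phi x = phi1 x + phi2 x) -> Vexpansion d h t u v phi.
Proof.
move=> [c1 [C1 h1] [e1 e10 [N1 g1]]] [c2 [C2 h2] [e2 e20 [N2 g2]]] /funext ->.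
have sq (W : int -> R -> R[i]) w C : (forall N, symsum N (fun k => nm (w k * W k 0)) <= C) ->
    (\esum_(k in [set: int]) (normc2 (w k * W k 0))%:E < +oo)%E.
  move=> wC; apply: (@le_lt_trans _ _ ((C * C)%:E)); last exact: ltry.
  have nC k : nm (w k * W k 0) <= C.
    by apply: le_trans (wC `|k|%N); apply: (symsum_ge (F := fun k => nm (w k * W k 0))) => // j; exact: nm_ge0.
  have C0 : 0 <= C by apply: le_trans (nm_ge0 _) (nC 0).
  apply: esum_symsum => [k|N]; first by rewrite nm_sqr sqr_ge0.
  apply: le_trans (ler_wpM2l C0 (wC N)); rewrite -symsumZ; apply: ler_sum => i _.
  by rewrite nm_sqr expr2 ler_wpM2r ?nm_ge0.
have [c1r c1i] := c1; have [c2r c2i] := c2; have [cr ci] := ccontD c1 c2.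
split.
- by apply: continuous_measurable_fun.
- by apply: continuous_measurable_fun.
- exact: (sq XW).
- exact: (sq YW).
move=> M M0; pose e N := e1 N + e2 N.
have Sc N : ccont (fun x => symsum N (fun k => u k * XW k x + v k * YW k x)).
  apply: ccont_sum => i; apply: ccontD; apply: ccontM; try exact: ccont_cst.
    exact: ccont_expi.
  exact: ccont_expi.
have gc N : ccont (fun x => phi1 x + phi2 x - symsum N (fun k => u k * XW k x + v k * YW k x)).
  apply: ccontD; first exact: ccontD.
  by under eq_fun do rewrite -mulN1r; apply: ccontM => //; exact: ccont_cst.
apply: (@squeeze_cvge _ _ _ _ (fun=> 0%E) _ (fun N => ((2 * M) * e N ^+ 2)%:E)).
- exists (maxn N1 N2) => // N /=; rewrite geq_max => /andP[n1 n2].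
  rewrite integral_ge0 /=; last by move=> x _; rewrite lee_fin nm_sqr sqr_ge0.
  apply: (@le_trans _ _ (\int[mu]_(x in `[(- M)%R, M]) cst (e N ^+ 2)%:E x)%E).
    apply: ge0_le_integral => //.
    + by move=> x _; rewrite lee_fin nm_sqr sqr_ge0.
    + by apply/measurable_EFinP; apply: measurable_normc2; exact: gc.
    move=> x _; rewrite lee_fin nm_sqr lerXn2r ?nnegrE ?nm_ge0 //.
      by apply: addr_ge0; [exact: le_trans (nm_ge0 _) (g1 N 0 n1)|exact: le_trans (nm_ge0 _) (g2 N 0 n2)].
    rewrite (_ : _ - _ = (phi1 x - symsum N (fun k => u k * XW k x)) +
       (phi2 x - symsum N (fun k => v k * YW k x))).
      by apply: le_trans (nmD _ _) _; apply: lerD; [exact: g1|exact: g2].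
    by rewrite symsumD; ring.
  rewrite integral_cst //= lebesgue_measure_itv /= lte_fin gtrN // -EFinB -EFinM lee_fin.
  by rewrite le_eqVlt; apply/orP; left; apply/eqP; ring.
- exact: cvg_cst.
apply: cvg_EFin; first by near=> N.
rewrite /comp /= -[X in _ --> X](mulr0 (2 * M)); apply: cvgMl_tmp.
rewrite -[X in _ --> X](mulr0 (0 : R)).
have e00 : e @ \oo --> (0 : R) by rewrite -[X in _ --> X](addr0 (0 : R)); apply: cvgD.
by apply: cvgM.
Unshelve. all: by end_near. Qed.

End Geometric.

Lemma ae_imp (R : realType) (P Q : R -> Prop) : {ae (@lebesgue_measure R), forall x, P x} ->
  (forall x, P x -> Q x) -> {ae (@lebesgue_measure R), forall x, Q x}.
Proof.
move=> [A [mA A0 sub]] PQ; exists A; split => // x nQ; apply: sub => Px.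
exact: nQ (PQ x Px).
Qed.

Section Uniqueness.
Variables (R : realType) (d : nat) (h t : R).
Local Notation mu := (@lebesgue_measure R).
Local Notation XW := (XW d h t).
Local Notation YW := (YW d h t).
Implicit Types (u v : int -> R[i]) (phi psi : R -> R[i]).

Lemma measurable_normc2_sub psi (S : R -> R[i]) (D : set R) :
  measurable_fun [set: R] (fun x => complex.Re (psi x)) ->
  measurable_fun [set: R] (fun x => complex.Im (psi x)) -> ccont S ->
  measurable_fun D (fun x => normc2 (psi x - S x)).
Proof.
move=> mr mi [cr ci]; apply: measurable_funTS.
rewrite (_ : (fun x => _) = fun x =>
  (complex.Re (psi x) - complex.Re (S x)) ^+ 2 + (complex.Im (psi x) - complex.Im (S x)) ^+ 2).
  apply: measurable_funD; apply: measurable_funX; apply: measurable_funB => //;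
    exact: continuous_measurable_fun.
by apply/funext => x; rewrite /normc2; case: (psi x) (S x) => ? ? [].
Qed.

Lemma ccont_symsum u v N : ccont (fun x => symsum N (fun k => u k * XW k x + v k * YW k x)).
Proof.
apply: ccont_sum => i; apply: ccontD; apply: ccontM;
  by [apply: ccont_cst|apply: ccont_expi].
Qed.

Lemma Vexp_unique u v u' v' psi phi : generic_time d t ->
  Vexpansion d h t u v psi -> Vexpansion d h t u' v' phi ->
  {ae mu, forall x, psi x = phi x} ->
  (forall k, u k = u' k) /\ (forall k, v k = v' k).
Proof.
move=> gen [mr mi _ _ cv] [mr' mi' _ _ cv'] ae.
pose S N x := symsum N (fun k => u k * XW k x + v k * YW k x).
pose S' N x := symsum N (fun k => u' k * XW k x + v' k * YW k x).
have n0 (z : R[i]) : 0 <= normc2 z by rewrite nm_sqr sqr_ge0.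
have [|hu hv] := @coef_zero R d h t (fun k => u k - u' k) (fun k => v k - v' k) gen.
- move=> M M0.
  have cv2 : ((2%:E * (\int[mu]_(x in `[(- M)%R, M]) (normc2 (psi x - S N x))%:E) +
     2%:E * \int[mu]_(x in `[(- M)%R, M]) (normc2 (phi x - S' N x))%:E)%E @[N --> \oo] --> 0%E).
    have -> : 0%E = (2%:E * 0 + 2%:E * 0)%E :> \bar R by rewrite !mule0 adde0.
    apply: cvgeD; [by rewrite !mule0| |].
      by apply: cvgeZl => //; exact: cv.
    by apply: cvgeZl => //; exact: cv'.
  apply: (@squeeze_cvge _ _ _ _ (fun=> 0%E) _ _ _ 0%E (cvg_cst _) cv2).
  near=> N.
  rewrite integral_ge0 /=; last by move=> x _; rewrite lee_fin.
  have m1 : measurable_fun `[- M, M] (fun x => (normc2 (psi x - S N x))%:E).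
    apply/measurable_EFinP; apply: measurable_normc2_sub => //; exact: ccont_symsum.
  have m2 : measurable_fun `[- M, M] (fun x => (normc2 (phi x - S' N x))%:E).
    apply/measurable_EFinP; apply: measurable_normc2_sub => //; exact: ccont_symsum.
  rewrite -!ge0_integralZl_EFin //; try by move=> x _; rewrite lee_fin.
  rewrite -ge0_integralD //=; first last.
  + by apply: measurable_funeM.
  + by move=> x _; rewrite mule_ge0 ?lee_fin.
  + by apply: measurable_funeM.
  + by move=> x _; rewrite mule_ge0 ?lee_fin.
  apply: ae_ge0_le_integral => //=.
  + by move=> x _; rewrite lee_fin.
  + by apply/measurable_EFinP; apply: measurable_normc2; exact: ccont_symsum.
  + by move=> x _; rewrite adde_ge0 // mule_ge0 ?lee_fin.
  + by apply: emeasurable_funD; apply: measurable_funeM.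
  apply: (ae_imp ae) => x px _; rewrite -!EFinM -EFinD lee_fin.
  have -> : symsum N (fun k => (u k - u' k) * XW k x + (v k - v' k) * YW k x) =
     (phi x - S' N x) - (psi x - S N x).
    transitivity (S N x + -1 * S' N x); last by rewrite px; ring.
    by rewrite /S /S' -symsumZ -symsumD; apply: eq_symsum => k; ring.
  case: (phi x - S' N x) (psi x - S N x) => p q [p' q']; rewrite /normc2 /=.
  have : 0 <= (p + p') ^+ 2 + (q + q') ^+ 2 by rewrite addr_ge0 ?sqr_ge0.
  by move=> H; rewrite -subr_ge0; apply: le_trans H _; rewrite le_eqVlt; apply/orP; left; apply/eqP; ring.
by split=> k; apply/eqP; rewrite -subr_eq0; apply/eqP; [exact: hu|exact: hv].
Unshelve. all: by end_near. Qed.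

End Uniqueness.

(** * The operator equation as a finite linear system *)

Section PhiAlgebra.
Variables (R : realType) (d : nat) (c : 'I_d.+1 -> R[i]) (a : nat -> R[i]) (rho : R).
Local Notation c0 := (c0 c).
Local Notation ppol := (ppol c).
Local Notation qpol := (qpol c).
Local Notation ath := (ath a).
Hypothesis c0N0 : c0 != 0.
Hypothesis p0N0 : ppol`_0 != 0.
Hypothesis DN0 : forall n, (1 <= n <= d)%N -> Ddet c n != 0.
Hypothesis aP : taylor rho ppol qpol a.
Implicit Types (A B f : {poly R[i]}) (s : R[i]).

Lemma ppol_mul_low n f : (forall i, (i < n)%N -> (ppol * f)`_i = 0) <->
  (forall i, (i < n)%N -> f`_i = 0).
Proof.
split=> H i; elim/ltn_ind: i => i IH hi; last first.
  rewrite coefM big1 // => j _; rewrite H ?mulr0 //.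
  by apply: leq_ltn_trans hi; rewrite leq_subr.
have := H i hi; rewrite coefM big_ord_recl subn0 big1 ?addr0 => [/eqP|j _].
  by rewrite mulf_eq0 (negbTE p0N0) => /eqP.
rewrite IH ?mulr0 //=; rewrite /bump /=; have := ltn_ord j; lia.
Qed.

(** Up to degree [N], the polynomial [p^*] is [p] times the truncated series of
    [p^* / p]. *)
Lemma qpol_low N f i : (i <= N)%N -> (qpol * f)`_i = (ppol * (psum a N * f))`_i.
Proof.
move=> iN; have [_ _ /(_ N) [S e]] := aP.
by rewrite mulrA e mulrDl coefD -mulrA coefXnM ltnS iN addr0.
Qed.

Lemma coef_psum N i : (i <= N)%N -> (psum a N)`_i = a i.
Proof. by move=> iN; rewrite coef_poly ltnS iN. Qed.

Lemma ath_nat (k l : nat) : ath (k%:Z - l%:Z) = if (l <= k)%N then a (k - l)%N else 0.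
Proof.
rewrite /ath subr_ge0 lez_nat; case: leqP => // lk.
by rewrite subzn.
Qed.

(** Since [p(0) <> 0], the coefficients of degree below [n] can be read after
    division by [p], which turns [p^*] into the series [a]. *)
Lemma low_coefs_eqs n s A B : (size B <= n)%N ->
  (forall i, (i < n)%N -> (ppol * (1 - A) - s *: (qpol * B))`_i = 0) <->
  (forall k, (k < n)%N ->
     A`_k = (k == 0%N)%:R - s * \sum_(l < n) B`_l * ath (k%:Z - l%:Z)).
Proof.
move=> sB.
have e i : (i < n)%N -> (ppol * (1 - A) - s *: (qpol * B))`_i =
    (ppol * (1 - A - s *: (psum a n * B)))`_i.
  move=> hi; rewrite coefB coefZ (@qpol_low n) 1?ltnW // -coefZ -coefB.
  by rewrite (mulrBr _ (1 - A)) -scalerAr.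
have e2 i : (i < n)%N -> (1 - A - s *: (psum a n * B))`_i =
    (i == 0%N)%:R - A`_i - s * \sum_(l < n) B`_l * ath (i%:Z - l%:Z).
  move=> hi; rewrite !coefB coef1 coefZ (coefM_trunc _ _ sB); congr (_ - _ * _).
  apply: eq_bigr => l _; rewrite ath_nat mulrC; congr (_ * _).
  by case: leqP => // li; rewrite coef_psum //; lia.
split=> H i hi.
  have [/(_ _ i hi)] := ppol_mul_low n (1 - A - s *: (psum a n * B)).
  rewrite e2 // => H' _.
  have /eqP : (i == 0%N)%:R - A`_i - s * (\sum_(l < n) B`_l * ath (i%:Z - l%:Z)) = 0.
    by apply: H' => j hj; rewrite -e ?H.
  by rewrite addrAC subr_eq0 => /eqP <-.
rewrite e //; apply: (proj2 (ppol_mul_low n _)) => // j hj.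
by rewrite e2 // H //; ring.
Qed.

(** Reversal turns the coefficients of degree [d, ..., d + n - 1] into those of
    degree below [n], which are then read after division by [p]. *)
Lemma high_coefs_eqs n s A B : conjc s = s -> s * s = 1 -> (0 < n)%N ->
  (size A <= n)%N -> (size B <= n)%N ->
  (forall i, (i < n)%N -> (ppol * (1 + A) + s *: (qpol * B))`_(d + i) = 0) <->
  (forall l, (l < n)%N ->
     conjc B`_l = - s * (ath (0 - l%:Z) + \sum_(k < n) conjc A`_k * ath (k%:Z - l%:Z))).
Proof.
move=> sr ss n0 sA sB; set F := ppol * (1 + A) + s *: (qpol * B).
have sA1 : (size (1 + A)%R <= n)%N.
  by rewrite (leq_trans (size_polyD _ _)) // geq_max size_poly1 n0.
have sR (f : {poly R[i]}) : (size (revp n.-1 f) <= n)%N.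
  by rewrite (leq_trans (size_revp _ _)) ?prednK.
pose G := psum a n * revp n.-1 (1 + A) + s *: revp n.-1 B.
have FG i : (i < n)%N -> conjc F`_(d + (n.-1 - i)) = (ppol * G)`_i.
  move=> hi; have -> : conjc F`_(d + (n.-1 - i)) = (revp (d + n.-1) F)`_i.
    by rewrite coef_revp ifT; [congr (conjc _`_ _); lia|lia].
  rewrite /F scalerAr revp_comb ?prednK //; last first.
    by rewrite (leq_trans (size_scale_leq _ _)).
  rewrite revpZ sr coefD (@qpol_low n) 1?ltnW // -coefD; congr (_`_i).
  by rewrite /G mulrDr addrC.
have Gc l : (l < n)%N -> G`_(n.-1 - l) =
   ath (0 - l%:Z) + \sum_(k < n) conjc A`_k * ath (k%:Z - l%:Z) + s * conjc B`_l.
  move=> hl; rewrite /G coefD coefZ coef_revp leq_subr subKn; last by lia.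
  congr (_ + _); rewrite (coefM_trunc _ _ (sR _)) (reindex_inj rev_ord_inj) /=.
  transitivity (\sum_(k < n) ((k == 0%N :> nat)%:R + conjc A`_k) * ath (k%:Z - l%:Z)).
    apply: eq_bigr => k _; have kn := ltn_ord k.
    rewrite ath_nat coef_revp mulrC ifT; last by lia.
    congr (_ * _).
      have -> : (n.-1 - (n - k.+1) = k)%N by lia.
      by rewrite coefD coef1 conjcD conjc_nat.
    have -> : (n - k.+1 <= n.-1 - l)%N = (l <= k)%N by lia.
    by case: leqP => // lk; rewrite coef_psum; [congr a; lia|lia].
  transitivity (\sum_(k < n) ((k == 0%N :> nat)%:R * ath (k%:Z - l%:Z) + conjc A`_k * ath (k%:Z - l%:Z))).
    by apply: eq_bigr => k _; rewrite mulrDl.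
  rewrite big_split /=; congr (_ + _); rewrite (bigD1 (Ordinal n0)) //= mul1r big1 ?addr0 // => k.
  by rewrite -val_eqE /= => /negbTE ->; rewrite mul0r.
have sN : s != 0 by apply/eqP => s0; move/eqP: ss; rewrite s0 mul0r eq_sym oner_eq0.
split=> H.
  move=> l hl; have [/(_ _ (n.-1 - l)%N) H' _] := ppol_mul_low n G.
  have : G`_(n.-1 - l) = 0.
    apply: H' => [i hi|]; last by lia.
    by rewrite -FG // H ?conjc0 //; lia.
  by rewrite Gc // => /eqP; rewrite addrC addr_eq0 => /eqP e; apply: (mulfI sN); rewrite e mulrA mulrN ss mulN1r.
move=> i hi; rewrite -[LHS]conjcK.
have -> : (d + i = d + (n.-1 - (n.-1 - i)))%N by lia.
rewrite FG; last by lia.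
rewrite (proj2 (ppol_mul_low n G)) ?conjc0 //; last by lia.
move=> j hj; have -> : (j = n.-1 - (n.-1 - j))%N by lia.
rewrite Gc; last by lia.
by rewrite H; [rewrite mulrA mulrN ss mulN1r subrr|lia].
Qed.

(** The operator equation with [n = 0] has no unknown and yields the constant [1],
    half of [x_0]; this accounts for [half_weight] below. *)
Definition xt n : {poly R[i]} := if n is 0 then 1 else xpol c n.
Definition Apol n : {poly R[i]} := 1 - xt n.
Definition Bpol n s : {poly R[i]} := - s *: ypol c n.
Definition ft n : {poly R[i]} := ppol * xt n + qpol * ypol c n.

Lemma size_Apol n : (size (Apol n) <= n)%N.
Proof.
case: n => [|n]; first by rewrite /Apol subrr size_poly0.
by rewrite (leq_trans (size_polyD _ _)) // size_polyN geq_max size_poly1 size_xpol.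
Qed.

Lemma size_Bpol n s : (size (Bpol n s) <= n)%N.
Proof. by rewrite (leq_trans (size_scale_leq _ _)) // size_ypol. Qed.

(** The equations satisfied by [A_k = u(k)] and [B_l = conj v(l)], [0 <= k, l < n],
    for a solution [phi] of the operator equation with coefficients [u], [v]; they
    are the restrictions of [ucf] and [vcf] below. *)
Definition solves n s A B :=
  (forall k, (k < n)%N ->
     A`_k = (k == 0%N)%:R - s * \sum_(l < n) B`_l * ath (k%:Z - l%:Z)) /\
  (forall l, (l < n)%N ->
     conjc B`_l = - s * (ath (0 - l%:Z) + \sum_(k < n) conjc A`_k * ath (k%:Z - l%:Z))).

(** The first system says that the low coefficients of [f_n] vanish.  For the
    second, [p (1 + A) + s p^* B = 2 p - f_n], whose coefficient of degree [d]
    vanishes because both terms have the same leading coefficient [2 c0]. *)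
Lemma solves_AB n s : conjc s = s -> s * s = 1 -> (n <= d)%N -> solves n s (Apol n) (Bpol n s).
Proof.
case: n => [|n] sr ss nd; first by split.
have good : ngood c n.+1 by apply: ngood_det => // k kn; apply: DN0; lia.
have [lo top hi] := fn_coef c0N0 nd good.
have yE : s *: (qpol * Bpol n.+1 s) = - (qpol * ypol c n.+1).
  by rewrite /Bpol -scalerAr scalerA mulrN ss scaleN1r.
split; [apply/low_coefs_eqs; rewrite ?size_Bpol // => i hin | apply/high_coefs_eqs; rewrite ?size_Apol ?size_Bpol // => i hin].
  rewrite yE opprK /Apol subKr /xt -fnE; exact: lo.
have -> : ppol * (1 + Apol n.+1) + s *: (qpol * Bpol n.+1 s) = 2 *: ppol - fn c n.+1.
  by rewrite yE /Apol /xt fnE scaler_nat; ring.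
rewrite coefB coefZ coef_ppol; case: i hin => [|i] hin.
  by rewrite addn0 leqnn subnn inord0E top subrr.
rewrite hi ?subr0; last by lia.
by rewrite ifF ?mulr0 //; apply/negbTE; lia.
Qed.

Lemma solves_uniq n s A B : conjc s = s -> s * s = 1 -> (0 < n <= d)%N ->
  (size A <= n)%N -> (size B <= n)%N -> solves n s A B -> A = Apol n /\ B = Bpol n s.
Proof.
move=> sr ss nd sA sB [lo hi]; have n0 : (0 < n)%N by lia.
have nd' : (n <= d)%N by lia.
have [lo' hi'] := solves_AB sr ss nd'.
move/(low_coefs_eqs s A sB): lo => lo; move/(low_coefs_eqs s (Apol n) (size_Bpol n s)): lo' => lo'.
move/(high_coefs_eqs sr ss n0 sA sB): hi => hi.
move/(high_coefs_eqs sr ss n0 (size_Apol n) (size_Bpol n s)): hi' => hi'.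
have s1 (f : {poly R[i]}) : (size f <= n)%N -> (size (1 - f)%R <= n)%N.
  by move=> sf; rewrite (leq_trans (size_polyD _ _)) // size_polyN geq_max size_poly1 n0.
have s2 (f : {poly R[i]}) : (size f <= n)%N -> (size (- s *: f)%R <= n)%N.
  by move=> sf; rewrite (leq_trans (size_scale_leq _ _)).
have e1 f g : ppol * (1 - f) + qpol * (- s *: g) = ppol * (1 - f) - s *: (qpol * g).
  by rewrite -scalerAr scaleNr.
have e2 f g : ppol * (1 - f) - s *: (qpol * g) = 2 *: ppol - (ppol * (1 + f) + s *: (qpol * g)).
  by rewrite scaler_nat; ring.
have [||/eqP eA eB] := @Lmx_uniq _ _ c n (1 - A) (- s *: B) (1 - Apol n) (- s *: Bpol n s)
   (DN0 nd) nd' (s1 _ sA) (s2 _ sB) (s1 _ (size_Apol n)) (s2 _ (size_Bpol n s)).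
- by move=> i h; rewrite !e1 lo ?lo'.
- by move=> i h; rewrite !e1 !e2 !coefB hi ?hi'.
have sN : - s != 0.
  by rewrite oppr_eq0; apply/eqP => s0; move/eqP: ss; rewrite s0 mul0r eq_sym oner_eq0.
split; last exact: (scalerI sN) eB.
by move: eA; rewrite (inj_eq (addrI 1)) (inj_eq oppr_inj) => /eqP.
Qed.

End PhiAlgebra.

Lemma ae_all (R : realType) (P : R -> Prop) : (forall x, P x) ->
  {ae (@lebesgue_measure R), forall x, P x}.
Proof. by move=> Px; exists set0; split => // x; apply; exact: Px. Qed.

Lemma ae_imp2 (R : realType) (P Q S : R -> Prop) :
  {ae (@lebesgue_measure R), forall x, P x} ->
  {ae (@lebesgue_measure R), forall x, Q x} ->
  (forall x, P x -> Q x -> S x) -> {ae (@lebesgue_measure R), forall x, S x}.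
Proof.
move=> aP aQ PQS; have := negligibleU aP aQ.
apply: negligibleS => x nS; apply: contrapT => /not_orP[/contrapT Px /contrapT Qx].
exact: nS (PQS x Px Qx).
Qed.

Section Phi.
Local Notation "z ^*" := (conjc z) : ring_scope.
Variables (R : realType) (d : nat) (c : 'I_d.+1 -> R[i]) (h : R) (a : nat -> R[i]).
Local Notation c0 := (c0 c).
Local Notation ppol := (ppol c).
Local Notation qpol := (qpol c).
Local Notation r := ((rpar d)%:R : R).
Local Notation ath := (ath a).
Local Notation XW := (XW d h).
Local Notation YW := (YW d h).
Local Notation QP := (QP c h).
Hypothesis c0N0 : c0 != 0.
Hypothesis p0N0 : ppol`_0 != 0.
Hypothesis DN0 : forall n, (1 <= n <= d)%N -> Ddet c n != 0.
Hypothesis hE : forall z : R[i], h <= complex.Im z -> Eexp c z != 0.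
Hypothesis aP : taylor (qmod d h) (ppol) (qpol) a.
Implicit Types (u v : int -> R[i]) (phi psi : R -> R[i]) (t x : R) (s z : R[i]).

(** The function to which the operator equation forces [phi] to be equal, given
    the coefficients [u], [v] that enter [P_n phi]. *)
Definition RHSfun n s t u v x : R[i] :=
  XW t 0 x - s * (YW t 0 x * QP x)
  - s * (\sum_(k < n) (u k%:Z)^* * (YW t k%:Z x * QP x) +
         \sum_(l < n) (v l%:Z)^* * (XW t l%:Z x * QP x)).

Definition ucf n s v (k : int) : R[i] :=
  (k == 0)%:R + - s * \sum_(l < n) (v l%:Z)^* * ath (k - l%:Z).

Definition vcf n s u (l : int) : R[i] :=
  - s * (ath (0 - l) + \sum_(k < n) (u k%:Z)^* * ath (k%:Z - l)).

Lemma RHS_exp n s t u v :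
  Vexpansion d h t (ucf n s v) (vcf n s u) (RHSfun n s t u v).
Proof.
have f1 : famexp (XW t) (ucf n s v)
   (fun x => XW t 0 x + - s * \sum_(l < n) (v l%:Z)^* * (XW t l%:Z x * QP x)).
  apply: famexpD; first by apply: famexp_single; exact: ccont_expi.
  by apply: famexpZ; apply: famexp_sum => l; apply: famexpZ; exact: famexp_X.
have f2 : famexp (YW t) (vcf n s u)
   (fun x => - s * (YW t 0 x * QP x + \sum_(k < n) (u k%:Z)^* * (YW t k%:Z x * QP x))).
  apply: famexpZ; apply: famexpD; first exact: famexp_Y.
  by apply: famexp_sum => l; apply: famexpZ; exact: famexp_Y.
by apply: (Vexp_famexp f1 f2) => x; rewrite /RHSfun; ring.
Qed.

Lemma sharp_X0 t : sharp (Xfun d 0 t) = Yfun d 0 t :> (R[i] -> R[i]).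
Proof. by apply/funext => z; rewrite /sharp sharp_expi. Qed.

Lemma sharp_Pproj n t u v z : sharp (Pproj d n t u v) z =
  \sum_(k < n) (u k%:Z)^* * sharp (Xfun d k%:Z t) z +
  \sum_(l < n) (v l%:Z)^* * sharp (Yshift d l%:Z t) z.
Proof.
rewrite /sharp /Pproj conjcD !conjc_sum; congr (_ + _); apply: eq_bigr => k _;
  by rewrite conjcM.
Qed.

Lemma RHS_eq n s t u v x : Xfun d 0 t (x +i* h) - s * Theta c (x +i* h) * Yfun d 0 t (x +i* h)
  - s * Theta c (x +i* h) * sharp (Pproj d n t u v) (x +i* h) = RHSfun n s t u v x.
Proof.
rewrite -sharp_X0 -(mulrA s) (Theta_sharpX c h t 0) /RHSfun; congr (_ - _ - _).
rewrite -mulrA sharp_Pproj; congr (_ * _); rewrite mulrDr !mulr_sumr.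
congr (_ + _); apply: eq_bigr => k _; rewrite mulrCA; congr (_ * _).
  exact: Theta_sharpX.
exact: Theta_sharpY.
Qed.

Lemma RHS_ext n s t u v u' v' : (forall k : nat, (k < n)%N -> u k%:Z = u' k%:Z) ->
  (forall k : nat, (k < n)%N -> v k%:Z = v' k%:Z) ->
  RHSfun n s t u v = RHSfun n s t u' v'.
Proof.
move=> hu hv; apply/funext => x; rewrite /RHSfun; congr (_ - _ * (_ + _));
  apply: eq_bigr => k _.
  by rewrite hu.
by rewrite hv.
Qed.

Definition U0 n (k : int) : R[i] := (Apol c n)`_(`|k|%N).
Definition V0 n s (l : int) : R[i] := ((Bpol c n s)`_(`|l|%N))^*.

Definition phi0 n s t : R -> R[i] := RHSfun n s t (U0 n) (V0 n s).

Hypotheses (s : R[i]) (sr : s^* = s) (ss : s * s = 1).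

Lemma ucf_U0 n k : (n <= d)%N -> (k < n)%N -> ucf n s (V0 n s) k%:Z = U0 n k%:Z.
Proof.
move=> nd kn; have [e _] := solves_AB c0N0 p0N0 DN0 aP sr ss nd.
rewrite /U0 absz_nat e //.
rewrite /ucf mulNr; congr (_ - _ * _); apply: eq_bigr => l _.
by rewrite /V0 conjcK.
Qed.

Lemma vcf_V0 n k : (n <= d)%N -> (k < n)%N -> vcf n s (U0 n) k%:Z = V0 n s k%:Z.
Proof.
move=> nd kn; have [_ e] := solves_AB c0N0 p0N0 DN0 aP sr ss nd.
by rewrite /V0 absz_nat e.
Qed.

Lemma ath_neg j : j < 0 -> ath j = 0.
Proof. by rewrite /ath ltNge => /negbTE ->. Qed.

Lemma is_phi0 n t : (n <= d)%N -> is_phi c h n s t (phi0 n s t).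
Proof.
move=> nd; exists (ucf n s (V0 n s)), (vcf n s (U0 n)).
have pe := RHS_exp n s t (U0 n) (V0 n s).
split; first exact: pe.
  (* phi already lies in V_{t,n}, so the second summand is taken to be 0 *)
  move=> n0; exists (phi0 n s t), (fun=> 0), (ucf n s (V0 n s)), (vcf n s (U0 n)), (fun=> 0), (fun=> 0).
  split.
  - split; first exact: pe.
    split=> [k k0|l nl].
      rewrite /ucf (lt_eqF k0) add0r big1 ?mulr0 // => l _.
      by rewrite ath_neg ?mulr0 //; lia.
    rewrite /vcf ath_neg ?add0r ?big1 ?mulr0 //; last by lia.
    by move=> k _; rewrite ath_neg ?mulr0 //; have := ltn_ord k; lia.
  - split; last by split.
    by apply: (Vexp_famexp (famexp0 _) (famexp0 _)) => x; rewrite addr0.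
  apply: ae_all => x; rewrite sharp_Pproj !big1 ?addr0 ?mulr0 ?addr0 //;
    by move=> k _; rewrite conjc0 mul0r.
apply: ae_all => x; rewrite {1}/phi0.
rewrite (@RHS_ext n s t (U0 n) (V0 n s) (ucf n s (V0 n s)) (vcf n s (U0 n))).
- by rewrite -RHS_eq subrK.
- by move=> k kn; rewrite ucf_U0.
- by move=> k kn; rewrite vcf_V0.
Qed.

Lemma is_phi_uniq n t psi : (n <= d)%N -> generic_time d t -> is_phi c h n s t psi ->
  {ae (@lebesgue_measure R), forall x, psi x = phi0 n s t x}.
Proof.
move=> nd gen [u [v [pe _ eq]]].
have ae1 : {ae (@lebesgue_measure R), forall x, psi x = RHSfun n s t u v x}.
  by apply: (ae_imp eq) => x e; rewrite -RHS_eq -e addrK.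
have [hu hv] := Vexp_unique gen pe (RHS_exp n s t u v) ae1.
case: (posnP n) => [n0|n0]; first by rewrite n0 in ae1 *; rewrite /phi0 (@RHS_ext 0 s t _ _ u v).
pose A : {poly R[i]} := \poly_(k < n) u k%:Z.
pose B : {poly R[i]} := \poly_(l < n) (v l%:Z)^*.
have AB : solves a n s A B.
  split=> k kn.
    rewrite coef_poly kn hu /ucf mulNr; congr (_ - _ * _); apply: eq_bigr => l _.
    by rewrite coef_poly ltn_ord.
  rewrite coef_poly kn conjcK hv /vcf; congr (_ * (_ + _)); apply: eq_bigr => l _.
  by rewrite coef_poly ltn_ord.
have n0d : (0 < n <= d)%N by rewrite n0.
have [eA eB] := solves_uniq c0N0 p0N0 DN0 aP sr ss n0d (size_poly _ _) (size_poly _ _) AB.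
apply: (ae_imp ae1) => x ->; rewrite /phi0; congr (_ x); apply: RHS_ext => k kn.
  by rewrite /U0 -eA coef_poly kn.
by rewrite /V0 -eB coef_poly kn conjcK.
Qed.

Lemma unique_phi0 n t : (n <= d)%N -> generic_time d t -> is_unique_phi c h n s t (phi0 n s t).
Proof. by move=> nd gen; split; [exact: is_phi0|move=> psi; exact: is_phi_uniq]. Qed.

(** The function [E (phi + X(0))] with the denominator of [Theta] cleared, which
    makes sense for all [t] and [z]. *)
Definition Gf n s t z : R[i] := 2 * (E0 c z * Xfun d 0 t z)
  - s * (sharp (E0 c) z * (Yfun d 0 t z + sharp (Pproj d n t (U0 n) (V0 n s)) z)).

Lemma Gf_line n t x : Gf n s t (x +i* h) = E0 c (x +i* h) * (phi0 n s t x + Xfun d 0 t (x +i* h)).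
Proof.
rewrite /phi0 -RHS_eq /Gf; have eN := E0_N0 hE (lexx h : h <= complex.Im (x +i* h)).
have gen (E F X Y P : R[i]) : E != 0 ->
    2 * (E * X) - s * (F * (Y + P)) = E * (X - s * (E^-1 * F) * Y - s * (E^-1 * F) * P + X).
  by move=> EN; field.
exact: gen.
Qed.

End Phi.

(** * The functions [A_n^*] and [B_n^*] *)

Section SymsumSupport.
Variable V : nmodType.
Implicit Types F : int -> V.

Lemma symsumS N F : symsum N.+1 F = F (- N.+1%:Z) + symsum N F + F N.+1%:Z.
Proof.
rewrite /symsum doubleS big_ord_recl big_ord_recr /= addrA sub0r.
congr (_ + _ + _); last by congr F; rewrite /bump /=; lia.
by apply: eq_bigr => i _; congr F; rewrite /bump /=; lia.
Qed.

Lemma symsum_support K N F : (K <= N)%N -> (forall k, (K < `|k|)%N -> F k = 0) ->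
  symsum N F = symsum K F.
Proof.
move=> KN F0; elim: N KN => [|N IH]; first by rewrite leqn0 => /eqP ->.
rewrite leq_eqVlt => /predU1P[->//|]; rewrite ltnS => KN.
by rewrite symsumS IH // !F0 ?addr0 ?add0r //; lia.
Qed.

Lemma symsum_shift1 K N F : (K < N)%N -> (forall k, (K < `|k|)%N -> F k = 0) ->
  symsum N (fun k => F (k - 1)) = symsum N F.
Proof.
move=> KN F0; rewrite /symsum big_ord_recl [RHS]big_ord_recr /= !F0; [|lia|lia].
by rewrite add0r addr0; apply: eq_bigr => i _; congr F; rewrite /bump /=; lia.
Qed.

End SymsumSupport.

Section FinComb.
Local Notation "z ^*" := (conjc z) : ring_scope.
Variables (R : realType) (d : nat).
Local Notation r := ((rpar d)%:R : R).
Local Notation mu := (@lebesgue_measure R).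
Implicit Types (G : R -> R[i] -> R[i]) (t : R) (z : R[i]) (k l : int).

Definition trunc K (p : int -> R[i]) k : R[i] := if (`|k| <= K)%N then p k else 0.

Lemma trunc0 K p k : (K < `|k|)%N -> trunc K p k = 0.
Proof. by rewrite /trunc ltnNge => /negbTE ->. Qed.

Lemma fin_comb_trunc K N (p q : int -> R[i]) t z : (K <= N)%N ->
  symsum N (fun k => trunc K p k * Xfun d k t z + trunc K q k * Yfun d k t z) =
  symsum K (fun k => p k * Xfun d k t z + q k * Yfun d k t z).
Proof.
move=> KN; rewrite (symsum_support KN).
  apply: eq_bigr => i _; have iK : (`|(i%:Z - K%:Z)%R| <= K)%N by have := ltn_ord i; lia.
  by rewrite /trunc iK.
by move=> k Kk; rewrite !trunc0 // !mul0r addr0.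
Qed.

Lemma fin_combD G G' : fin_comb d G -> fin_comb d G' -> fin_comb d (fun t z => G t z + G' t z).
Proof.
move=> [K [p [q e]]] [K' [p' [q' e']]].
exists (maxn K K'), (fun k => trunc K p k + trunc K' p' k), (fun k => trunc K q k + trunc K' q' k) => t z.
rewrite e e' -(fin_comb_trunc _ _ _ _ (leq_maxl K K')) -(fin_comb_trunc _ _ _ _ (leq_maxr K K')).
by rewrite -symsumD; apply: eq_symsum => k; ring.
Qed.

Lemma fin_combZ G b : fin_comb d G -> fin_comb d (fun t z => b * G t z).
Proof.
move=> [K [p [q e]]]; exists K, (fun k => b * p k), (fun k => b * q k) => t z.
by rewrite e -symsumZ; apply: eq_symsum => k; ring.
Qed.

Lemma fin_combX k : fin_comb d (Xfun d k : R -> R[i] -> R[i]).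
Proof.
exists `|k|%N, (fun j => (j == k)%:R), (fun=> 0) => t z.
rewrite (@symsum_single _ _ k) //; first by rewrite eqxx mul1r mul0r addr0.
by move=> j /negbTE ->; rewrite !mul0r addr0.
Qed.

Lemma fin_combY k : fin_comb d (Yfun d k : R -> R[i] -> R[i]).
Proof.
exists `|k|%N, (fun=> 0), (fun j => (j == k)%:R) => t z.
rewrite (@symsum_single _ _ k) //; first by rewrite eqxx mul1r mul0r add0r.
by move=> j /negbTE ->; rewrite !mul0r addr0.
Qed.

Lemma fin_comb_sum (I : Type) (s : seq I) (F : I -> R -> R[i] -> R[i]) :
  (forall i, fin_comb d (F i)) -> fin_comb d (fun t z => \sum_(i <- s) F i t z).
Proof.
move=> Fc; elim: s => [|i s [K [p [q e]]]].
  by exists 0%N, (fun=> 0), (fun=> 0) => t z; rewrite big_nil symsum0 // => k; rewrite !mul0r addr0.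
have [K' [p' [q' e']]] : fin_comb d (fun t z => F i t z + \sum_(i <- s) F i t z).
  by apply: fin_combD => //; exists K, p, q.
by exists K', p', q' => t z; rewrite big_cons e'.
Qed.

Lemma fin_comb_ext G G' : (forall t z, G t z = G' t z) -> fin_comb d G -> fin_comb d G'.
Proof. by move=> e [K [p [q h]]]; exists K, p, q => t z; rewrite -e. Qed.

(** The families [Y(k)] and [Y(l-r+1)] differ by a shift of the index by [r - 1],
    which is [0] or [1] and does not affect long symmetric sums of finite support;
    then [coef_zero] applies. *)
Lemma fin_comb_zero G h t0 : fin_comb d G -> generic_time d t0 ->
  {ae mu, forall x, G t0 (x +i* h) = 0} -> forall t z, G t z = 0.
Proof.
move=> [K [p [q e]]] gen ae.
pose e1 := ((rpar d)%:Z - 1)%R.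
have e01 : e1 = 0 \/ e1 = 1 by rewrite /e1 /rpar; case: ifP; [right|left].
pose v l := trunc K q (l - (rpar d)%:Z + 1).
have [|hu hv] := @coef_zero R d h t0 (trunc K p) v gen.
  move=> M M0; have cv0 : (fun _ : nat => 0%E : \bar R) @ \oo --> 0%E by exact: cvg_cst.
  apply: cvg_trans cv0; apply: near_eq_cvg.
  exists K.+1 => // N /= KN.
  have SE x : symsum N (fun k => trunc K p k * XW d h t0 k x + v k * YW d h t0 k x) = G t0 (x +i* h).
    rewrite e symsumD -(fin_comb_trunc _ _ _ _ (ltnW KN)) symsumD; congr (_ + _).
    pose F k := trunc K q k * Yfun d k t0 (x +i* h).
    have F0 k : (K < `|k|)%N -> F k = 0 by move=> Kk; rewrite /F trunc0 // mul0r.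
    rewrite -/(symsum N F) (_ : symsum N F = symsum N (fun k => F (k - e1))).
      apply: eq_symsum => k; rewrite /F /v /YW /Yshift.
      by have -> : k - (rpar d)%:Z + 1 = k - e1 by rewrite /e1; lia.
    by case: e01 => ->; [apply: eq_symsum => k; rewrite subr0|rewrite (symsum_shift1 KN F0)].
  rewrite -[LHS](@integral0 _ _ _ mu `[(- M)%R, M]).
  apply/esym; apply: ae_eq_integral => //.
  - apply/measurable_EFinP; apply: measurable_normc2; exact: ccont_symsum.
  - by apply: (ae_imp ae) => x ex _; rewrite SE ex nm_sqr nm0 expr0n.
move=> t z; rewrite e -(fin_comb_trunc _ _ _ _ (leqnn K)) symsum0 // => k.
rewrite hu mul0r add0r; have := hv (k + (rpar d)%:Z - 1); rewrite /v.
have -> : k + (rpar d)%:Z - 1 - (rpar d)%:Z + 1 = k by lia.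
by move=> ->; rewrite mul0r.
Qed.

Lemma fin_comb_eq G G' h t0 : fin_comb d G -> fin_comb d G' -> generic_time d t0 ->
  {ae mu, forall x, G t0 (x +i* h) = G' t0 (x +i* h)} -> forall t z, G t z = G' t z.
Proof.
move=> fG fG' gen ae t z; apply/eqP; rewrite -subr_eq0 -mulN1r; apply/eqP.
apply: (@fin_comb_zero (fun t z => G t z + -1 * G' t z) h t0) => //.
  by apply: fin_combD => //; apply: fin_combZ.
by apply: (ae_imp ae) => x ->; rewrite mulN1r subrr.
Qed.

Lemma generic_quarter : generic_time d (r / 4).
Proof.
move=> k; apply/eqP => e; have r0 := rpar_gt0 R d.
have : (2 * k)%:~R = 1%:~R :> R.
  have rN : r != 0 by rewrite gt_eqF.
  apply: (mulfI (_ : r / 4 != 0)); first by rewrite mulf_neq0 // invr_neq0.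
  by rewrite {2}e intrM; field.
by move/eqP; rewrite eqr_int => /eqP; lia.
Qed.

Variable c : 'I_d.+1 -> R[i].

Definition kap (j : nat) : int := (d./2)%:Z - j%:Z.

Lemma freq_kap j : freq R d j = r * (kap j + 1)%:~R - 1.
Proof.
rewrite /freq /Lpar /rpar /kap natrM !intrD rmorphN /= -!pmulrn.
have := odd_double_half d; case: (odd d) => /= e; rewrite -{1}e ?add1n ?add0n -?addnn.
  by rewrite -natr1 natrD; ring.
by rewrite natrD; field.
Qed.

Lemma E0_X k t z : E0 c z * Xfun d k t z = \sum_(j < d.+1) c j * Xfun d (kap j + k) t z.
Proof.
rewrite /E0 /Eexp mulrAC mulr_sumr; apply: eq_bigr => j _; rewrite mulrCA; congr (_ * _).
rewrite /Xfun -(expiD (- (r - 1))) -(expiD (- (r - 1) + _)); congr (expi _ z).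
rewrite freq_kap !intrD; ring.
Qed.

Lemma sharpE0_sharpX k t z : sharp (E0 c) z * sharp (Xfun d k t) z =
  \sum_(j < d.+1) (c j)^* * Yfun d (kap j + k) t z.
Proof.
have -> : sharp (E0 c) z * sharp (Xfun d k t) z = (E0 c z^* * Xfun d k t z^*)^* by rewrite conjcM.
rewrite E0_X conjc_sum; apply: eq_bigr => j _; rewrite conjcM; congr (_ * _).
by rewrite /Xfun sharp_expi.
Qed.

Lemma sharpE0_sharpY l t z : sharp (E0 c) z * sharp (Yshift d l t) z =
  \sum_(j < d.+1) (c j)^* * Xfun d (l - kap j + 1 - (rpar d)%:Z) t z.
Proof.
rewrite /sharp /E0 /Eexp conjcM sharp_expi opprK conjc_sum mulrAC mulr_sumr.
apply: eq_bigr => j _; rewrite (conjcM (c j)) sharp_expi mulrCA; congr (_ * _).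
rewrite /Xfun /Yshift /Yfun sharp_expi opprK -(expiD (r - 1)) -(expiD (r - 1 + _)); congr (expi _ z).
rewrite freq_kap !intrD !rmorphN /= !intrD -!pmulrn.
ring.
Qed.

End FinComb.

Section StarFunctions.
Local Notation "z ^*" := (conjc z) : ring_scope.
Variables (R : realType) (d : nat) (c : 'I_d.+1 -> R[i]).
Local Notation ppol := (ppol c).
Local Notation qpol := (qpol c).
Local Notation r := ((rpar d)%:R : R).
Implicit Types (t : R) (z s : R[i]).

Lemma fin_comb_Gf n s : fin_comb d (Gf c n s).
Proof.
have XX : fin_comb d (fun t z => 2 * (\sum_(j < d.+1) c j * Xfun d (kap d j + 0) t z)).
  by apply: fin_combZ; apply: fin_comb_sum => j; apply: fin_combZ; exact: fin_combX.
have YY (k : int) : fin_comb d (fun t z => \sum_(j < d.+1) (c j)^* * Yfun d (kap d j + k) t z).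
  by apply: fin_comb_sum => j; apply: fin_combZ; exact: fin_combY.
have ZZ (l : int) : fin_comb d (fun t z => \sum_(j < d.+1) (c j)^* * Xfun d (l - kap d j + 1 - (rpar d)%:Z) t z).
  by apply: fin_comb_sum => j; apply: fin_combZ; exact: fin_combX.
have S1 : fin_comb d (fun t z => \sum_(k < n) (U0 c n k%:Z)^* *
     (\sum_(j < d.+1) (c j)^* * Yfun d (kap d j + k%:Z) t z)).
  by apply: fin_comb_sum => k; apply: fin_combZ; exact: YY.
have S2 : fin_comb d (fun t z => \sum_(l < n) (V0 c n s l%:Z)^* *
     (\sum_(j < d.+1) (c j)^* * Xfun d (l%:Z - kap d j + 1 - (rpar d)%:Z) t z)).
  by apply: fin_comb_sum => l; apply: fin_combZ; exact: ZZ.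
apply: fin_comb_ext (fin_combD XX (fin_combZ (- s) (fin_combD (YY 0) (fin_combD S1 S2)))) => t z.
rewrite /Gf (E0_X c 0) -mulNr; congr (_ + _ * _).
rewrite mulrDr -sharp_X0 sharpE0_sharpX; congr (_ + _).
rewrite sharp_Pproj mulrDr !mulr_sumr; congr (_ + _); apply: eq_bigr => k _.
  by rewrite mulrCA sharpE0_sharpX.
by rewrite mulrCA sharpE0_sharpY.
Qed.

Lemma E0_X0 t z : E0 c z * Xfun d 0 t z = expi (- t) z * exp_poly d ppol z.
Proof.
rewrite E0E mulrAC; congr (_ * _).
by rewrite /Xfun -(expiD (- (r - 1))); congr (expi _ z); rewrite add0r mulr1; ring.
Qed.

Lemma sharp_exp_poly_ppol z : sharp (exp_poly d ppol) z = exp_poly d qpol z.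
Proof. by rewrite sharp_exp_poly0 ?size_ppol. Qed.

Lemma sharp_exp_poly_qpol z : sharp (exp_poly d qpol) z = exp_poly d ppol z.
Proof. by rewrite sharp_exp_poly0 ?size_qpol // revp_qpol. Qed.

Lemma sharp_E0_Y0 t z : sharp (E0 c) z * Yfun d 0 t z = expi t z * exp_poly d qpol z.
Proof.
rewrite -sharp_X0 -sharp_exp_poly_ppol.
have -> : sharp (E0 c) z * sharp (Xfun d 0 t) z = (E0 c z^* * Xfun d 0 t z^*)^* by rewrite conjcM.
by rewrite E0_X0 conjcM sharp_expi opprK.
Qed.

Lemma conj_horner_qz n (f : {poly R[i]}) z : (size f <= n)%N ->
  (f.[qz d z^*])^* = \sum_(k < n) (f`_k)^* * expi (- (r * k%:R)) z.
Proof.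
move=> sf; rewrite (horner_coef_wide _ sf) conjc_sum; apply: eq_bigr => k _.
by rewrite conjcM /qz expiX sharp_expi.
Qed.

Lemma sharp_E0_Pproj n s t z : sharp (E0 c) z * sharp (Pproj d n t (U0 c n) (V0 c n s)) z =
  exp_poly d qpol z * (expi t z * ((Apol c n).[qz d z^*])^* + expi (- t) z * (Bpol c n s).[qz d z]).
Proof.
rewrite sharp_E0 sharp_Pproj (conj_horner_qz _ (size_Apol c n)) (horner_coef_wide _ (size_Bpol c n s)).
rewrite mulrAC mulrC; congr (_ * _); rewrite mulrDr !mulr_sumr; congr (_ + _); apply: eq_bigr => k _.
  rewrite mulrCA [RHS]mulrCA; congr (_ * _).
  rewrite /sharp /Xfun sharp_expi -(expiD (r - 1)) -(expiD t); congr (expi _ z).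
  by rewrite intrD -pmulrn; ring.
rewrite mulrCA [RHS]mulrCA /V0 conjcK absz_nat; congr (_ * _).
rewrite /sharp /Yshift /Yfun /qz expiX sharp_expi -(expiD (r - 1)) -(expiD (- t)); congr (expi _ z).
rewrite opprK !intrD rmorphN /= -!pmulrn.
have := rr_case R d; set b := r => e.
have -> : b - 1 + (b * (k%:R - b + 1%:R + 1%:R) - 1 - t) = - t + b * k%:R - (b - 1) * (b - 2) by ring.
by rewrite e subr0.
Qed.

Lemma Gf_form n s t z : Gf c n s t z =
  2 * (expi (- t) z * exp_poly d ppol z) - s * (exp_poly d qpol z *
    (expi t z * (2 - ((xt c n).[qz d z^*])^*) - s * (expi (- t) z * (ypol c n).[qz d z]))).
Proof.
rewrite /Gf E0_X0 mulrDr sharp_E0_Y0 sharp_E0_Pproj /Apol /Bpol.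
rewrite hornerD hornerN hornerC hornerZ conjcB conjc1; ring.
Qed.

Lemma sharp_Gf_form n s t z : s^* = s -> sharp (Gf c n s t) z =
  2 * (expi t z * exp_poly d qpol z) - s * (exp_poly d ppol z *
    (expi (- t) z * (2 - (xt c n).[qz d z]) - s * (expi t z * ((ypol c n).[qz d z^*])^*))).
Proof.
move=> sr; have conjE (e1 e2 P Q X y : R[i]) :
    (2 * (e1 * P) - s * (Q * (e2 * (2 - X^*) - s * (e1 * y))))^* =
    2 * (e1^* * P^*) - s * (Q^* * (e2^* * (2 - X) - s * (e1^* * y^*))).
  by rewrite !(conjcB, conjcM) !conjc_nat conjcK sr.
rewrite {1}/sharp Gf_form conjE !sharp_expi opprK conjcK.
by rewrite -[(exp_poly d ppol z^*)^*]/(sharp (exp_poly d ppol) z) -[(exp_poly d qpol z^*)^*]/(sharp (exp_poly d qpol) z)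
  sharp_exp_poly_ppol sharp_exp_poly_qpol.
Qed.

Lemma exp_poly_ft n z : exp_poly d (ft c n) z = exp_poly d ppol z * (xt c n).[qz d z] + exp_poly d qpol z * (ypol c n).[qz d z].
Proof. by rewrite /exp_poly /ft hornerD !hornerM; ring. Qed.

Lemma sharp_exp_poly_ft n z : sharp (exp_poly d (ft c n)) z =
  exp_poly d ppol z * ((ypol c n).[qz d z^*])^* + exp_poly d qpol z * ((xt c n).[qz d z^*])^*.
Proof.
rewrite {1}/sharp exp_poly_ft conjcD (conjcM (exp_poly d ppol z^*)) (conjcM (exp_poly d qpol z^*)) addrC.
by rewrite -[(exp_poly d ppol z^*)^*]/(sharp (exp_poly d ppol) z) -[(exp_poly d qpol z^*)^*]/(sharp (exp_poly d qpol) z)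
  sharp_exp_poly_ppol sharp_exp_poly_qpol.
Qed.

(** The terms that contain neither [x_n] nor [y_n] cancel between [G] and
    [G^#]. *)
Lemma Gf_Af n t z : 2^-1 * (Gf c n 1 t z + sharp (Gf c n 1 t) z) = Af d (ft c n) t z.
Proof. by rewrite sharp_Gf_form ?conjc1 // Gf_form /Af exp_poly_ft sharp_exp_poly_ft; ring. Qed.

Lemma Gf_Bf n t z : 'i / 2 * (Gf c n (- 1) t z - sharp (Gf c n (- 1) t) z) = Bf d (ft c n) t z.
Proof. by rewrite sharp_Gf_form ?conjcN ?conjc1 // Gf_form /Bf exp_poly_ft sharp_exp_poly_ft; ring. Qed.

Variables (h : R) (a : nat -> R[i]).
Hypothesis c0N0 : c0 c != 0.
Hypothesis p0N0 : ppol`_0 != 0.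
Hypothesis DN0 : forall n, (1 <= n <= d)%N -> Ddet c n != 0.
Hypothesis hE : forall z : R[i], h <= complex.Im z -> Eexp c z != 0.
Hypothesis aP : taylor (qmod d h) (ppol) (qpol) a.

Lemma is_Ephi_Gf n s : s^* = s -> s * s = 1 -> (n <= d)%N -> is_Ephi c h n s (Gf c n s).
Proof.
move=> sr ss nd; split; first exact: fin_comb_Gf.
move=> t gen; exists (phi0 c h n s t); split; first exact: (unique_phi0 c0N0 p0N0 DN0 hE aP).
by apply: ae_all => x; exact: Gf_line.
Qed.

Lemma is_Ephi_uniq n s G : s^* = s -> s * s = 1 -> (n <= d)%N -> is_Ephi c h n s G ->
  forall t z, G t z = Gf c n s t z.
Proof.
move=> sr ss nd [fG hG]; have gen := generic_quarter R d.
have [psi [[psiP _] Gpsi]] := hG _ gen.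
have psiE := is_phi_uniq c0N0 p0N0 DN0 hE aP sr ss nd gen psiP.
apply: (fin_comb_eq (h := h) fG (fin_comb_Gf n s) gen).
by apply: (ae_imp2 Gpsi psiE) => x -> ->; rewrite Gf_line.
Qed.

Let r11 : (1 : R[i])^* = 1 := conjc1 R.
Let rm1 : (- 1 : R[i])^* = - 1. Proof. by rewrite conjcN conjc1. Qed.
Let s11 : 1 * 1 = 1 :> R[i] := mulr1 1.
Let sm1 : - 1 * - 1 = 1 :> R[i]. Proof. by rewrite mulrNN mulr1. Qed.

Lemma Astar_Af n F : (n <= d)%N -> is_Astar c h n F -> forall t z, F t z = Af d (ft c n) t z.
Proof.
move=> nd [G [/(is_Ephi_uniq r11 s11 nd) GE FE]] t z.
by rewrite FE -Gf_Af /sharp !GE.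
Qed.

Lemma Bstar_Bf n F : (n <= d)%N -> is_Bstar c h n F -> forall t z, F t z = Bf d (ft c n) t z.
Proof.
move=> nd [G [/(is_Ephi_uniq rm1 sm1 nd) GE FE]] t z.
by rewrite FE -Gf_Bf /sharp !GE.
Qed.

Lemma Af_Astar n : (n <= d)%N -> is_Astar c h n (Af d (ft c n)).
Proof.
by move=> nd; exists (Gf c n 1); split => [|t z]; [exact: is_Ephi_Gf|rewrite Gf_Af].
Qed.

Lemma Bf_Bstar n : (n <= d)%N -> is_Bstar c h n (Bf d (ft c n)).
Proof.
by move=> nd; exists (Gf c n (- 1)); split => [|t z]; [exact: is_Ephi_Gf|rewrite Gf_Bf].
Qed.

End StarFunctions.

(** * Absolute continuity of functions defined piecewise *)

Section Lipschitz.
Variable R : realType.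
Implicit Types (f g : R -> R) (K a b x y : R).

Lemma lipschitz_abs_continuous (I : set R) f K :
  (forall x y, I x -> I y -> x <= y -> `|f y - f x| <= K * (y - x)) -> abs_continuous_on I f.
Proof.
move=> fK e e0; pose K1 := `|K| + 1.
have K1p : 0 < K1 by rewrite ltr_wpDl.
exists (e / K1); first by rewrite divr_gt0.
move=> m u v uv _ small.
apply: (@le_lt_trans _ _ (K1 * \sum_(i < m) (v i - u i))); last by rewrite mulrC -ltr_pdivlMr.
rewrite mulr_sumr; apply: ler_sum => i _; have [uvi sub] := uv i.
apply: le_trans (fK _ _ _ _ uvi) _.
- by apply: sub; rewrite /= in_itv /= lexx uvi.
- by apply: sub; rewrite /= in_itv /= lexx uvi.
by rewrite ler_wpM2r ?subr_ge0 // /K1 (le_trans (ler_norm K)) // lerDl.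
Qed.

Lemma C1_lipschitz f g a b : a <= b -> (forall x, is_derive x 1 f (g x)) -> continuous g ->
  exists K, forall x y, a <= x -> x <= y -> y <= b -> `|f y - f x| <= K * (y - x).
Proof.
move=> ab fg gc.
have nc : {within `[a, b], continuous (fun x => `|g x|)}.
  by apply: continuous_subspaceT => x; apply: cvg_norm; exact: gc.
have [m mab mM] := EVT_max ab nc.
exists `|g m| => x y ax xy yb.
have [e|] := eqVneq x y; first by rewrite e !subrr normr0 mulr0.
move=> xNy; have xy' : x < y by rewrite lt_neqAle xNy.
have [z zxy ->] : exists2 z, z \in `]x, y[ & f y - f x = g z * (y - x).
  apply: MVT => //.
  apply: derivable_within_continuous => z _; by have [] := fg z.
rewrite normrM (ger0_norm (_ : 0 <= y - x)) ?subr_ge0 // ler_wpM2r ?subr_ge0 //.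
apply: mM; move: zxy; rewrite !in_itv /= => /andP[h1 h2].
by rewrite (le_trans ax (ltW h1)) (le_trans (ltW h2) yb).
Qed.

(** Consecutive pieces agree at the joints, so an increment of [f] is the sum of
    increments of single pieces. *)
Lemma lipschitz_glue f (g : nat -> R -> R) (tt : nat -> R) d :
  (forall n, tt n < tt n.+1) ->
  (forall n, exists K, forall x y, tt 0%N <= x -> x <= y -> y <= tt d ->
     `|g n y - g n x| <= K * (y - x)) ->
  (forall n, (n.+1 < d)%N -> g n.+1 (tt n.+1) = g n (tt n.+1)) ->
  (forall n x, (n < d)%N -> tt n <= x < tt n.+1 -> f x = g n x) ->
  exists K, forall x y, tt 0%N <= x -> x <= y -> y < tt d -> `|f y - f x| <= K * (y - x).
Proof.
move=> ttS gK gj fg.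
have tt_mono m n : (m <= n)%N -> tt m <= tt n.
  elim: n => [|n IH]; first by rewrite leqn0 => /eqP ->.
  rewrite leq_eqVlt => /predU1P[->//|/IH h]; exact: le_trans h (ltW (ttS n)).
suff H n : (n <= d)%N -> exists K, forall x y, tt 0%N <= x -> x <= y -> y < tt n -> `|f y - f x| <= K * (y - x).
  exact: H.
elim: n => [_|n IH nd].
  by exists 0 => x y h1 h2 h3; have := le_lt_trans (le_trans h1 h2) h3; rewrite ltxx.
have [K hK] := IH (ltnW nd); have [K1 hK1] := gK n; have [K2 hK2] := gK n.-1.
pose M := `|K| + `|K1| + `|K2|.
have MK : K <= M by apply: le_trans (ler_norm K) _; rewrite /M -addrA lerDl.
have MK1 : K1 <= M by apply: le_trans (ler_norm K1) _; rewrite /M addrAC lerDr.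
have MK2 : K2 <= M by apply: le_trans (ler_norm K2) _; rewrite /M lerDr.
have up k x y (w : R) : x <= y -> w <= k * (y - x) -> k <= M -> w <= M * (y - x).
  by move=> xy hw kM; apply: le_trans hw _; rewrite ler_wpM2r ?subr_ge0.
exists M => x y x0 xy yn.
have [yt|ty] := ltP y (tt n); first by apply: (up K) => //; exact: hK.
have yd : y <= tt d by apply: le_trans (ltW yn) (tt_mono _ _ nd).
have [tx|xt] := leP (tt n) x.
  rewrite !(fg n) ?tx ?ty ?yn ?(le_lt_trans xy yn) //.
  by apply: (up K1) => //; exact: hK1.
have n0 : (0 < n)%N.
  by case: (n) xt => // xt; have := le_lt_trans x0 xt; rewrite ltxx.
have [n' nE] : exists n', n = n'.+1 by exists n.-1; rewrite prednK.
(* [x, y] is cut at x' and tt n; hK, the piece n' and the piece n bound the increments *)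
pose x' := Num.max x (tt n').
have xx' : x <= x' by rewrite le_max lexx.
have x't : x' < tt n by rewrite gt_max xt nE ttS.
have x'0 : tt 0%N <= x' by apply: le_trans xx'.
have n'd : (n' < d)%N by apply: leq_trans (ltnW nd); rewrite nE.
have tn'd : tt n <= tt d by apply: tt_mono; exact: ltnW.
have e1 : f x' = g n' x' by apply: fg => //; rewrite -nE x't andbT le_max lexx orbT.
have e2 : g n' (tt n) = g n (tt n) by rewrite nE gj // -nE.
have e3 : f y = g n y by apply: fg => //; rewrite ty.
have -> : f y - f x = (g n y - g n (tt n)) + (g n' (tt n) - g n' x') + (f x' - f x).
  by rewrite e1 e2 e3; ring.
have -> : M * (y - x) = M * (y - tt n) + M * (tt n - x') + M * (x' - x) by ring.
apply: le_trans (ler_normD _ _) _; apply: lerD; last first.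
  by apply: (up K) => //; exact: hK.
apply: le_trans (ler_normD _ _) _; apply: lerD.
  by apply: (up K1) => //; apply: hK1 => //; apply: tt_mono.
apply: (up K2) => //; first exact: ltW.
by have := hK2 x' (tt n); rewrite nE /=; apply => //; rewrite -?nE // ltW.
Qed.

End Lipschitz.

(** * The matrices [P_n^*] *)

Section Assembly.
Local Notation "z ^*" := (conjc z) : ring_scope.
Variables (R : realType) (d : nat) (c : 'I_d.+1 -> R[i]).
Local Notation ppol := (ppol c).
Local Notation L := (Lpar R d).
Local Notation r := ((rpar d)%:R : R).
Hypothesis c0N0 : c0 c != 0.
Hypothesis DN0 : forall n, (1 <= n <= d)%N -> Ddet c n != 0.
Implicit Types (t : R) (z : R[i]).

Definition joint n : R := r * n%:R / 2.

Lemma joint0 : joint 0 = 0. Proof. by rewrite /joint mulr0 mul0r. Qed.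

Lemma jointS n : joint n < joint n.+1.
Proof. by rewrite /joint ltr_pM2r ?invr_gt0 // ltr_pM2l ?rpar_gt0 // ltr_nat. Qed.

Lemma joint_mono m n : (m <= n)%N -> joint m <= joint n.
Proof. by move=> mn; rewrite /joint ler_pM2r ?invr_gt0 // ler_pM2l ?rpar_gt0 // ler_nat. Qed.

Lemma joint_end : joint d = L.
Proof. by rewrite /joint -two_Lpar mulrC mulKf // pnatr_eq0. Qed.

Lemma in_step_exists t : 0 <= t < L -> exists2 n, (1 <= n <= d)%N & in_step d n t.
Proof.
move=> /andP[t0 tL]; rewrite -joint_end in tL.
have ex : exists n, t < joint n by exists d.
case: (ex_minnP ex) => n tn nmin; exists n.
  rewrite (nmin _ tL) andbT lt0n; apply/eqP => n0.
  by move: tn; rewrite n0 joint0 ltNge t0.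
rewrite /in_step tn andbT; case: n tn nmin => [|n] tn nmin.
  by move: tn; rewrite joint0 ltNge t0.
by rewrite leNgt; apply/negP => /nmin; rewrite ltnn.
Qed.

Lemma in_step_uniq m n t : (0 < m)%N -> (0 < n)%N -> in_step d m t -> in_step d n t -> m = n.
Proof.
have le a b : (0 < a)%N -> (0 < b)%N -> in_step d a t -> in_step d b t -> (a <= b)%N.
  case: a => // a _ _ /andP[h1 _] /andP[_ h2]; rewrite ltnNge; apply/negP => ba.
  by have := le_lt_trans (le_trans (joint_mono ba) h1) h2; rewrite ltxx.
by move=> m0 n0 hm hn; apply/eqP; rewrite eqn_leq (le m n m0 n0 hm hn) (le n m n0 m0 hn hm).
Qed.

Definition half_weight n : R := if n is 0 then 2^-1 else 1.

Lemma half_weight_N0 n : half_weight n != 0.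
Proof. by case: n => [|n]; rewrite /half_weight ?invr_eq0 ?pnatr_eq0 ?oner_eq0. Qed.

Lemma ft_fn n : ft c n = (half_weight n)%:C *: fn c n.
Proof.
case: n => [|n]; last by rewrite /half_weight rmorph1 scale1r /ft fnE.
have h : (2^-1 : R)%:C * 2 = 1 :> R[i].
  by rewrite fmorphV rmorph_nat mulVf // pnatr_eq0.
have -> : fn c 0 = 2 *: ppol by rewrite fnE /xpol /ypol /= mulr0 addr0 mulrC mul_polyC.
by rewrite scalerA h scale1r /ft mulr1 mulr0 addr0.
Qed.

Lemma Kf_scale (w : R) f t z : Kf d (w%:C *: f) t z = w%:C *: Kf d f t z.
Proof.
rewrite !KfE /sharp !exp_polyZ conjcM conjc_real scalerDr !scalerA.
by congr (_ *: _ + _ *: _); ring.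
Qed.

Lemma Kf_ft n t z : Kf d (ft c n) t z = (half_weight n)%:C *: Kf d (fn c n) t z.
Proof. by rewrite ft_fn Kf_scale. Qed.

Lemma poly_qz0 (P : {poly R[i]}) : (forall z, P.[qz d z] = 0) -> P = 0.
Proof.
move=> P0; apply/eqP; rewrite -[_ == _]negbK; apply/negP => PN.
(* qz takes infinitely many values, already on the imaginary axis *)
pose x (k : nat) : R[i] := qz d (0 +i* k%:R).
have xE k : x k = (expR (- (r * k%:R)))%:C.
  by rewrite /x /qz expiE mulr0 cos0 sin0 mulr1.
have xinj : injective x.
  move=> i j; rewrite !xE => /complexI/expR_inj/oppr_inj.
  by move/(mulfI (lt0r_neq0 (rpar_gt0 R d)))/eqP; rewrite eqr_nat => /eqP.
have := max_poly_roots PN (_ : all (root P) [seq x k | k <- iota 0 (size P)]).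
rewrite map_inj_uniq ?iota_uniq // size_map size_iota ltnn => H.
suff : false by []. apply: H => //.
by apply/allP => y /mapP[k _ ->]; rewrite /root P0.
Qed.

(** Comparison of the coefficients of degree [d] gives [w = - conj (w g_n)] for
    each row [w] read as a complex number, and [|g_n| <> 1].  This is what
    determines [P_n^*] from its defining identity. *)
Lemma Kf_indep n (M : 'M[R]_2) : (n < d)%N ->
  (forall z, cmx M *m Kf d (fn c n) (joint n) z = 0) -> M = 0.
Proof.
move=> nd MK.
have good : ngood c n.+1 by apply: ngood_det => // k kn; apply: DN0; lia.
have goodn : ngood c n by move=> k kn; apply: good; lia.
have [lo top hi] := fn_coef c0N0 (ltnW nd) goodn.
have sz : (size (fn c n) <= (d + n).+1)%N.
  by apply: leq_trans (size_fn c0N0 DN0 (ltnW nd)) _; rewrite ltnS leq_addr.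
have row i : M i 0 = 0 /\ M i 1 = 0.
  (* w and its conjugate are the products of the row with (1, i) and (1, -i) *)
  pose w : R[i] := M i 0 +i* M i 1.
  pose P := w *: fn c n + w^* *: revp (d + n) (fn c n).
  have P0 : P = 0.
    apply: poly_qz0 => z; have /matrixP/(_ i 0) := MK z.
    rewrite Kf_joint // mulmx2E !mxE /= => e.
    have : (2^-1 * expi (- joint n) z * expi (- L) z) * P.[qz d z] = 0.
      rewrite -[RHS]e /P hornerD !hornerZ /exp_poly /w.
      have -> : (M i 0 +i* M i 1)^* = (M i 0)%:C - 'i * (M i 1)%:C.
        by apply/eqP; rewrite eq_complex /=; apply/andP; split; apply/eqP; ring.
      have -> : M i 0 +i* M i 1 = (M i 0)%:C + 'i * (M i 1)%:C.
        by apply/eqP; rewrite eq_complex /=; apply/andP; split; apply/eqP; ring.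
      rewrite -/(joint n); ring.
    have eN : 2^-1 * expi (- joint n) z * expi (- L) z != 0.
      by apply: mulf_neq0 (expi_N0 _ _); apply: mulf_neq0 (expi_N0 _ _); rewrite invr_eq0 pnatr_eq0.
    by move/eqP; rewrite mulf_eq0 (negbTE eN) => /eqP.
  have gnE : (fn c n)`_n = gn c n * (2 * (c0 c)^*).
    by rewrite /gn /reflection_coef divfK // mulf_eq0 pnatr_eq0 /= conjc_eq0.
  have := congr1 (fun q : {poly R[i]} => q`_d) P0.
  rewrite /P coefD !coefZ coef_revp leq_addr addKn top gnE coef0.
  rewrite (conjcM (gn c n)) (conjcM 2) conjc_nat conjcK => e.
  have {}e : w + w^* * (gn c n)^* = 0.
    have cN : 2 * c0 c != 0 by rewrite mulf_neq0 // pnatr_eq0.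
    apply: (mulIf cN); rewrite mul0r -[RHS]e; ring.
  have n1 : normc2 w = normc2 w * normc2 (gn c n).
    have : w = - (w^* * (gn c n)^*) by apply/eqP; rewrite -addr_eq0 e.
    by move/(congr1 (@nm R)); rewrite nmN nmM !nm_conjc => e'; rewrite !nm_sqr {1}e' exprMn.
  have : normc2 w * rn c n = 0 by rewrite /rn mulrBr mulr1 -n1 subrr.
  move/eqP; rewrite mulf_eq0 (negbTE (rn_N0 c0N0 DN0 nd)) orbF nm_sqr sqrf_eq0 nm_eq0.
  by move/eqP => [-> ->].
by apply: mx2P; rewrite mxE; case: (row 0) (row 1) => ? ? [].
Qed.

Lemma prod_Ps n (Ps : nat -> 'M[R]_2) : (n <= d)%N ->
  (forall k, (k < n)%N -> Ps k.+1 = (half_weight k)^-1 *: ((rn c k)^-1 *: Smx c k)) ->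
  \prod_(1 <= k < n.+1) invmx (Ps k) = (half_weight n)^-1 *: Umx c n.
Proof.
elim: n => [_ _|n IH nd PsE].
  rewrite big_geq // /Umx /= invmx1 /xr /xpol /= coefC /= scalerA invrK.
  have -> : 2 * (1 + 1)^-1 = 1 :> R by rewrite mulfV // pnatr_eq0.
  by rewrite scale1r.
rewrite big_nat_recr //= IH; [|exact: ltnW|by move=> k kn; apply: PsE; exact: ltnW].
rewrite PsE // /half_weight invr1 scale1r.
have rN : rn c n != 0 by exact: rn_N0.
have Su : (rn c n)^-1 *: Smx c n \in unitmx.
  by rewrite unitmxZ ?unitfE ?invr_eq0 // Smx_unit.
have wu : (half_weight n)^-1 *: ((rn c n)^-1 *: Smx c n) \in unitmx.
  by rewrite unitmxZ // unitfE invr_eq0 half_weight_N0.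
apply: (can_inj (mulmxK wu)).
rewrite -[_ * invmx _]/(_ *m invmx _) mulmxKV // -scalemxAr UmxS //.
Qed.

End Assembly.

(** * The solution on [[0, L)] *)

Section Main.
Local Notation "z ^*" := (conjc z) : ring_scope.
Variables (R : realType) (d : nat) (c : 'I_d.+1 -> R[i]).
Local Notation ppol := (ppol c).
Local Notation L := (Lpar R d).
Local Notation r := ((rpar d)%:R : R).
Local Notation joint := (joint R d).
Hypothesis d0 : (0 < d)%N.
Hypothesis cN0 : c ord0 * c ord_max != 0.
Hypothesis DN0 : forall n, (1 <= n <= d)%N -> Ddet c n != 0.
Implicit Types (t : R) (z : R[i]).

Let c0N0 : c0 c != 0.
Proof. by move: cN0; rewrite mulf_eq0 negb_or => /andP[]. Qed.

Let p0N0 : ppol`_0 != 0.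
Proof.
rewrite coef_ppol leq0n subn0.
have -> : inord d = ord_max :> 'I_d.+1 by apply/val_inj; rewrite /= inordK.
by move: cN0; rewrite mulf_eq0 negb_or => /andP[].
Qed.

Section Line.
Variables (h : R).
Hypothesis hE : forall z : R[i], h <= complex.Im z -> Eexp c z != 0.

(** The functions [A_n^*], [B_n^*] and the matrices [P_n^*] are all forced, and
    the ordered product of the inverses is [U_n] by [UmxS]. *)
Lemma AB_Uf A B : is_AB c h A B -> forall n t z, (1 <= n <= d)%N -> in_step d n t ->
  col2 (A t z) (B t z) = Uf c n t z.
Proof.
move=> [As [Bs [Ps [h1 h2 h3]]]] n t z nd tn.
have [a aP] := theta_exists cN0 hE.
have KE k s w : (k <= d)%N -> col2 (As k s w) (Bs k s w) = Kf d (ft c k) s w.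
  move=> kd; have [hA hB] := h1 k kd.
  by rewrite (Astar_Af c0N0 p0N0 DN0 hE aP kd hA) (Bstar_Bf c0N0 p0N0 DN0 hE aP kd hB).
have nd' : (n <= d)%N by case/andP: nd.
have PsE k : (k < n)%N -> Ps k.+1 = (half_weight R k)^-1 *: ((rn c k)^-1 *: Smx c k).
  move=> kn; have kd : (k < d)%N := leq_trans kn nd'.
  have [_ h2k] := h2 k.+1 kd.
  have e : (rn c k)^-1 *: Smx c k - half_weight R k *: Ps k.+1 = 0.
    apply: (Kf_indep c0N0 DN0 kd) => w; have := h2k w; rewrite /= !KE ?(ltnW kd) //.
    rewrite !Kf_ft scale1r Kf_step // => e.
    have -> : cmx ((rn c k)^-1 *: Smx c k - half_weight R k *: Ps k.+1) =
        cmx ((rn c k)^-1 *: Smx c k) - (half_weight R k)%:C *: cmx (Ps k.+1).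
      by rewrite /cmx map_mxB; congr (_ - _); exact: map_mxZ.
    by rewrite mulmxBl -scalemxAl scalemxAr -e subrr.
  by have -> := subr0_eq e; rewrite scalerA mulVf ?half_weight_N0 // scale1r.
rewrite (h3 n t z nd tn) KE // (prod_Ps c0N0 DN0 nd' PsE) Kf_ft cmxZ -scalemxAl -scalemxAr scalerA.
by rewrite -rmorphM mulVf ?half_weight_N0 // scale1r.
Qed.

Definition pieces i t z : R[i] :=
  \sum_(1 <= n < d.+1) if (r * n.-1%:R / 2 <= t < r * n%:R / 2) then Uf c n t z i 0 else 0.

Lemma pieces_step i n t z : (1 <= n <= d)%N -> in_step d n t -> pieces i t z = Uf c n t z i 0.
Proof.
move=> nd tn; rewrite /pieces (bigD1_seq n) ?iota_uniq //=; last by rewrite mem_index_iota.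
rewrite -/(in_step d n t) in tn.
rewrite (_ : (_ <= t < _) = true) // big_nat_cond big1 ?addr0 // => m /andP[/andP[m1 md] mn].
case: ifP => // tm; exfalso; move/eqP: mn; apply.
by apply: (@in_step_uniq R d m n t) => //; case/andP: nd.
Qed.

Lemma AB_exists : exists A B, is_AB c h A B.
Proof.
have [a aP] := theta_exists cN0 hE.
pose Ps n : 'M[R]_2 := if n is k.+1 then (half_weight R k)^-1 *: ((rn c k)^-1 *: Smx c k) else 1%:M.
have KE f t z : col2 (Af d f t z) (Bf d f t z) = Kf d f t z by [].
exists (pieces 0), (pieces 1), (fun n => Af d (ft c n)), (fun n => Bf d (ft c n)), Ps.
split.
- move=> n nd; split; first exact: (Af_Astar c0N0 p0N0 DN0 hE aP nd).
  exact: (Bf_Bstar c0N0 p0N0 DN0 hE aP nd).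
- case=> // n nd; have wu := half_weight_N0 R n.
  have wK : ((half_weight R n)^-1)%:C * (half_weight R n)%:C = 1 by rewrite -(rmorphM (real_complex R)) mulVf.
  split.
    rewrite /Ps unitmxZ ?unitfE ?invr_eq0 // unitmxZ ?unitfE ?invr_eq0 ?rn_N0 //.
    exact: Smx_unit.
  move=> z /=; rewrite !KE !Kf_ft scale1r Kf_step //= /Ps.
  by rewrite [cmx (_^-1 *: (_ *: _))]cmxZ -[RHS]scalemxAl -scalemxAr scalerA wK scale1r.
move=> n t z nd tn; rewrite !(pieces_step _ _ nd tn).
have nd' : (n <= d)%N by case/andP: nd.
rewrite (prod_Ps c0N0 DN0 nd' (Ps := Ps)) // KE Kf_ft.
rewrite cmxZ -scalemxAl -scalemxAr scalerA -rmorphM mulVf ?half_weight_N0 // scale1r.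
by apply: col2P; rewrite !mxE.
Qed.

End Line.

Definition dUf n z t : 'cV[R[i]]_2 :=
  z *: (cmx (Umx c n) *m col2 (- Bf d (fn c n) t z) (Af d (fn c n) t z)).

Lemma Uf_deriv n z i t : is_cderive (fun t => Uf c n t z i 0) t (dUf n z t i 0).
Proof.
have [dA dB] := Kf_deriv d (fn c n) t z.
have := is_cderiveD (is_cderiveZ (cmx (Umx c n) i 0) dA) (is_cderiveZ (cmx (Umx c n) i 1) dB).
rewrite (_ : (fun t => _) = (fun t => Uf c n t z i 0)); last first.
  by apply/funext => s; rewrite /Uf mulmx2E !col2E.
by congr is_cderive; rewrite /dUf [RHS]mxE mulmx2E !col2E; ring.
Qed.

Lemma ccont_Uf n z i : ccont (fun t => Uf c n t z i 0).
Proof. by apply: is_cderive_ccont => t; eexists; apply: Uf_deriv. Qed.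

Lemma ccont_dUf n z i : ccont (fun t => dUf n z t i 0).
Proof.
have cA : ccont (Af d (fn c n) ^~ z).
  by apply: is_cderive_ccont => t; eexists; have [dA _] := Kf_deriv d (fn c n) t z; apply: dA.
have cB : ccont (Bf d (fn c n) ^~ z).
  by apply: is_cderive_ccont => t; eexists; have [_ dB] := Kf_deriv d (fn c n) t z; apply: dB.
rewrite (_ : (fun t => _) = fun t => (- z * cmx (Umx c n) i 0) * Bf d (fn c n) t z +
    (z * cmx (Umx c n) i 1) * Af d (fn c n) t z).
  by apply: ccontD; apply: ccontM => //; apply: ccont_cst.
by apply/funext => t; rewrite /dUf [LHS]mxE mulmx2E !col2E; ring.
Qed.

(** A function of [t] that follows the pieces [Uf c n] on the successive steps
    is Lipschitz because the pieces agree at the joints. *)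
Lemma abs_continuous_pieces (F : R -> R[i]) z i :
  (forall n t, (1 <= n <= d)%N -> in_step d n t -> F t = Uf c n t z i 0) ->
  cabs_continuous_on `[0, L[ F.
Proof.
move=> FU; have L0 : 0 <= L by rewrite -joint_end -(joint0 R d) joint_mono.
have glue (p : R[i] -> R) :
   (forall n, exists g, continuous g /\ forall t, is_derive t 1 (fun t => p (Uf c n t z i 0)) (g t)) ->
   abs_continuous_on `[0, L[ (fun t => p (F t)).
  move=> pd.
  have [||||K hK] := @lipschitz_glue R (fun t => p (F t)) (fun n t => p (Uf c n.+1 t z i 0)) joint d.
  - exact: jointS.
  - move=> n; have [g [gc gd]] := pd n.+1.
    by apply: (C1_lipschitz _ gd gc); apply: joint_mono.
  - by move=> n nd; rewrite Uf_joint.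
  - by move=> n x nd hx; rewrite (FU n.+1).
  apply: (@lipschitz_abs_continuous R _ _ K) => x y /=; rewrite !in_itv /= => /andP[x0 _] /andP[_ yL] xy.
  by apply: hK => //; rewrite ?joint0 ?joint_end.
split; apply: glue => n; [exists (fun t => complex.Re (dUf n z t i 0))|exists (fun t => complex.Im (dUf n z t i 0))].
  by have [cr _] := ccont_dUf n z i; split => // t; have [] := Uf_deriv n z i t.
by have [_ ci] := ccont_dUf n z i; split => // t; have [] := Uf_deriv n z i t.
Qed.

Lemma pieces_deriv (F : R -> R[i]) z i n t :
  (forall n t, (1 <= n <= d)%N -> in_step d n t -> F t = Uf c n t z i 0) ->
  (1 <= n <= d)%N -> joint n.-1 < t < joint n -> is_cderive F t (dUf n z t i 0).
Proof.
move=> FU nd tn; have [d1 d2] := Uf_deriv n z i t.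
have nr : \near t, Uf c n t z i 0 = F t.
  have ti : t \in `]joint n.-1, joint n[ by rewrite in_itv.
  apply: filterS (near_in_itvoo ti) => s; rewrite in_itv /= => /andP[s1 s2].
  by rewrite (FU n) // /in_step (ltW s1).
split; [apply: near_eq_is_derive d1|apply: near_eq_is_derive d2];
  by apply: filterS nr => s ->.
Qed.

Lemma pieces_limit (F : R -> R[i]) z i :
  (forall n t, (1 <= n <= d)%N -> in_step d n t -> F t = Uf c n t z i 0) ->
  ctends_left F L (Uf c d L z i 0).
Proof.
move=> FU; have [cr ci] := ccont_Uf d z i.
have jd : joint d.-1 < L by have := jointS R d d.-1; rewrite (prednK d0) joint_end.
have nr : \forall t \near L^'-, Uf c d t z i 0 = F t.
  near=> t; rewrite (FU d) ?leqnn ?d0 // /in_step.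
  have -> : r * d%:R / 2 = L by rewrite -joint_end.
  by apply/andP; split; [near: t; apply: nbhs_left_ge|near: t; apply: nbhs_left_lt].
split.
  apply: cvg_trans (cvg_at_left_filter (cr L)); apply: near_eq_cvg.
  by apply: filterS nr => s ->.
apply: cvg_trans (cvg_at_left_filter (ci L)); apply: near_eq_cvg.
by apply: filterS nr => s ->.
Unshelve. all: by end_near. Qed.

Lemma ae_not_joint : {ae (@lebesgue_measure R), forall t, forall n, t != joint n}.
Proof.
have cj : countable (range joint) by apply: card_le_trans (card_image_le _ _) _; exact: countableP.
exists (range joint); split.
- by apply: countable_measurable => // t; exact: measurable_set1.
- exact: countable_lebesgue_measure0.
move=> t nt; apply: contrapT => nr; apply: nt => n; apply/eqP => e.
by apply: nr; exists n.
Qed.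

Lemma solution (Hc : R -> 'M[R]_2) (A B : R -> R[i] -> R[i]) :
  is_Hstep d (Hmx c) Hc ->
  (forall n t z, (1 <= n <= d)%N -> in_step d n t -> col2 (A t z) (B t z) = Uf c n t z) ->
  quasi_canonical_solution 0 L Hc A B.
Proof.
move=> HcE ABU.
have AU z n t : (1 <= n <= d)%N -> in_step d n t -> A t z = Uf c n t z 0 0.
  by move=> nd tn; rewrite -(ABU n) // col2E.
have BU z n t : (1 <= n <= d)%N -> in_step d n t -> B t z = Uf c n t z 1 0.
  by move=> nd tn; rewrite -(ABU n) // col2E.
split=> [t tL|z].
  have [n nd tn] := in_step_exists tL; rewrite (HcE n) //.
  by rewrite /Hmx linearZ /= trmx_mul trmxK.
split; [exact: abs_continuous_pieces (AU z)|exact: abs_continuous_pieces (BU z)|].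
apply: (ae_imp (ae_not_joint)) => t tj tL.
have [n nd tn] := in_step_exists tL; have nd' : (n <= d)%N by case/andP: nd.
have tn' : joint n.-1 < t < joint n.
  by move: tn => /andP[h1 ->]; rewrite andbT lt_neqAle h1 andbT eq_sym tj.
exists (dUf n z t 0 0), (dUf n z t 1 0); split.
- exact: (pieces_deriv (AU z) nd tn').
- exact: (pieces_deriv (BU z) nd tn').
rewrite (HcE n) // (ABU n) // -Uf_ode //.
by congr (- _); apply: col2P; rewrite col2E.
Qed.

Lemma Ddet_gt0 n : (n <= d)%N -> (0 < Ddet c n) = (0 < Dr c n).
Proof. by move=> nd; rewrite Ddet_real // ltcR. Qed.

(** Stated for any notion [P] between definite and semidefinite.  As [H_n] is a
    definite matrix divided by [D_{n-1} D_n], positivity of the [H_n] propagates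
    the sign of [D_0 = 1] to all [D_n]. *)
Lemma Hmx_posdef_equiv (Hc : R -> 'M[R]_2) (P : 'M[R]_2 -> Prop) :
  is_Hstep d (Hmx c) Hc ->
  (forall M, P M -> possemidef M) -> (forall M, posdef M -> P M) ->
  (forall t : R, 0 <= t < L -> P (Hc t)) <->
  (forall n : nat, (1 <= n <= d)%N -> 0 < Ddet c n).
Proof.
move=> HcE P1 P2; split=> [HP n /andP[_ nd]|D t tL].
  rewrite Ddet_gt0 //; elim: n nd => [|n IH] nd; first by rewrite /Dr Ddet0 /= ltr01.
  have tn : in_step d n.+1 (joint n) by rewrite /in_step /= lexx; exact: jointS.
  have tL : 0 <= joint n < L.
    rewrite -joint_end -(joint0 R d) joint_mono //=.
    exact: lt_le_trans (jointS R d n) (joint_mono R d nd).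
  have nd1 : (1 <= n.+1 <= d)%N by [].
  have := P1 _ (HP _ tL); rewrite (HcE n.+1) // => /(possemidef_Hmx_gt0 c0N0 DN0 nd1) /=.
  by rewrite pmulr_rgt0 // IH // ltnW.
have [n nd tn] := in_step_exists tL; rewrite (HcE n) //; apply: P2.
apply: (posdef_Hmx c0N0 DN0 nd); case: n nd {tn} => // n /= nd.
have Dp m : (m < d)%N -> 0 < Dr c m.+1 by move=> md; rewrite -Ddet_gt0 //; exact: D.
apply: mulr_gt0; last exact: Dp.
by case: n nd => [|n] nd; [rewrite /Dr Ddet0 /= ltr01|exact: Dp (ltnW nd)].
Qed.

Lemma posdef_semidef (M : 'M[R]_2) : posdef M -> possemidef M.
Proof.
move=> [Ms Mp]; split => // x; have [->|x0] := eqVneq x 0; first by rewrite mulmx0 mxE.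
exact/ltW/Mp.
Qed.

Lemma z_exists_unique n (s : R[i]) : s^* = s -> s * s = 1 -> (1 <= n <= d)%N ->
  exists! z : 'cV[R[i]]_n, is_z c s z.
Proof.
move=> sr ss nd; exists (pvec n (zpol c n s)); split; first exact: zpol_is_z.
by move=> z /(is_z_uniq c0N0 DN0 sr ss nd) ->.
Qed.

End Main.

Theorem theorem1p1 (R : realType) (d : nat) (c : 'I_d.+1 -> R[i])
  (hd : (1 <= d)%N)
  (hC : c ord0 * c ord_max != 0)
  (hDd : Ddet c d != 0)
  (hDn : forall n : nat, (1 <= n < d)%N -> Ddet c n != 0) :
  (forall n : nat, (1 <= n <= d)%N ->
     [/\ exists! z : 'cV[R[i]]_n, is_z c 1 z,
         exists! z : 'cV[R[i]]_n, is_z c (- 1) z &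
         exists! Hn : 'M[R]_2, is_H c n Hn]) /\
  forall (H : nat -> 'M[R]_2) (Hc : R -> 'M[R]_2),
    (forall n : nat, (1 <= n <= d)%N -> is_H c n (H n)) ->
    is_Hstep d H Hc ->
    [/\ forall h : R, (forall z : R[i], h <= complex.Im z -> Eexp c z != 0) ->
          (exists A B : R -> R[i] -> R[i], is_AB c h A B) /\
          forall A B : R -> R[i] -> R[i], is_AB c h A B ->
            [/\ quasi_canonical_solution 0 (Lpar R d) Hc A B,
                forall z : R[i], A 0 z = Aexp c z /\ B 0 z = Bexp c z,
                forall z : R[i],
                  ctends_left (A ^~ z) (Lpar R d) (Aexp c 0) /\
                  ctends_left (B ^~ z) (Lpar R d) (Bexp c 0) &
                forall (n : nat) (t : R) (z : R[i]),
                  (1 <= n <= d)%N -> in_step d n t ->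
                  let ab j := abcoef d H (col2 (Aexp c 0) (Bexp c 0)) (d - n) j in
                  A t z = 2^-1 * (\sum_(j < (d - n).+1)
                    (ab j 0 0 * expi (freq R d j - t) z
                     + (ab j 0 0)^* * expi (- (freq R d j - t)) z)) /\
                  B t z = 2^-1 * (\sum_(j < (d - n).+1)
                    (ab j 1 0 * expi (freq R d j - t) z
                     + (ab j 1 0)^* * expi (- (freq R d j - t)) z))],
        exists Ht : nat -> 'M[R]_2, forall n : nat, (1 <= n <= d)%N ->
          posdef (Ht n) /\
          cmx (H n) = (Ddet c n.-1 * Ddet c n)^-1 *: cmx (Ht n),
        (forall t : R, 0 <= t < Lpar R d -> posdef (Hc t)) <->
        (forall n : nat, (1 <= n <= d)%N -> 0 < Ddet c n) &
        (forall t : R, 0 <= t < Lpar R d -> possemidef (Hc t)) <->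
        (forall n : nat, (1 <= n <= d)%N -> 0 < Ddet c n)].
Proof.
have DN0 n : (1 <= n <= d)%N -> Ddet c n != 0.
  move=> /andP[n1]; rewrite leq_eqVlt => /predU1P[->//|nd].
  by apply: hDn; rewrite n1.
have c0N0 : c0 c != 0 by move: hC; rewrite mulf_eq0 negb_or => /andP[].
split=> [n nd|H Hc HE HcH].
  split.
  - by apply: z_exists_unique; rewrite ?conjc1 ?mulr1.
  - by apply: z_exists_unique; rewrite ?conjcN ?conjc1 ?mulrNN ?mulr1.
  have nd' : (n <= d)%N by case/andP: nd.
  exists (Hmx c n); split; first exact: Hmx_is_H.
  by move=> Hn /(is_H_uniq c0N0 DN0 nd') ->.
have {}HE n : (1 <= n <= d)%N -> H n = Hmx c n.
  by move=> nd; apply: (is_H_uniq c0N0 DN0 _ (HE n nd)); case/andP: nd.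
have HcE : is_Hstep d (Hmx c) Hc by move=> n t nd tn; rewrite (HcH n) // HE.
split.
- move=> h hE; split; first exact: AB_exists.
  move=> A B hAB; have ABU := AB_Uf hC DN0 hE hAB.
  split.
  + exact: (solution hC DN0 HcE ABU).
  + move=> z; have s1 : in_step d 1 (0 : R).
      by rewrite /in_step /= mulr0 mul0r lexx -(joint0 R d); exact: jointS.
    have := ABU 1%N 0 z hd s1; have := @Uf_joint R d c c0N0 DN0 0 z hd.
    rewrite mulr0 mul0r => ->; rewrite Uf0 => e.
    by move/matrixP: e => e; have := e 0 0; have := e 1 0; rewrite !col2E => -> ->.
  + move=> z; rewrite -{1}(col2_0 (Aexp c 0) (Bexp c 0)) -{2}(col2_1 (Aexp c 0) (Bexp c 0)).
    rewrite -(Uf_end c0N0 DN0 z); split; apply: pieces_limit => // n t nd tn.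
      by rewrite -(ABU n) // col2E.
    by rewrite -(ABU n) // col2E.
  + move=> n t z nd tn ab; have U := Uf_formula c0N0 DN0 t z nd HE.
    have /matrixP e := ABU n t z nd tn.
    by split; [have := e 0 0|have := e 1 0]; rewrite col2E U.
- exists (Htilde c) => n nd; split; first exact: Htilde_posdef.
  rewrite HE // (Hmx_Htilde c0N0 DN0 nd) cmxZ; congr (_ *: _).
  by rewrite fmorphV rmorphM !Ddet_real //; case/andP: nd => // _; apply: leq_trans; exact: leq_pred.
- by apply: Hmx_posdef_equiv => // M; exact: posdef_semidef.
- by apply: Hmx_posdef_equiv => // M; exact: posdef_semidef.
Qed.
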